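(* Let $\mu$ be a probability measure on $\partial\mathbb{D}$ with $\mu_{\mathrm s}=0$ satisfying the Szeg\H{o} condition, and let $R>1$. If $D^{-1}$ has an analytic continuation to $\{z:|z|<R\}$, then $F$ is meromorphic there with singularities precisely at the zeros of $D^{-1}$, and the order of any pole of $F$ is precisely the order of the corresponding zero of $D^{-1}$. Moreover $(\delta_0D)(z)$ is meromorphic in $\{z:|z|<R\}$ with poles precisely at the poles of $F$, of order no greater than those of $F$. Finally $(D^{(1)})^{-1}$ is analytic in $\{z:|z|<R\}$, and hence (by induction) so is each $(D^{(n)})^{-1}$, $n\ge1$.
   Context: $\mathbb{D}=\{|z|<1\}$. Write $d\mu=w(\theta)\frac{d\theta}{2\pi}+d\mu_{\mathrm s}$; the Szeg\H{o} condition is $\int\log w\,\frac{d\theta}{2\pi}>-\infty$, and then the Szeg\H{o} function is $D(z)=\exp\bigl(\int\frac{e^{i\theta}+z}{e^{i\theta}-z}\log w(\theta)\frac{d\theta}{4\pi}\bigr)$, $z\in\mathbb{D}$. Let $\alpha_0,\alpha_1,\dots$ be the Verblunsky coefficients of $\mu$ (recursion coefficients $\Phi_{k+1}(z)=z\Phi_k(z)-\bar\alpha_k\Phi_k^*(z)$, $\Phi_k^*(z)=z^k\overline{\Phi_k(1/\bar z)}$ of the monic orthogonal polynomials), $\rho_n=(1-|\alpha_n|^2)^{1/2}$. $\mu^{(n)}$ is the probability measure with Verblunsky coefficients $\{\alpha_{n+k}\}_{k\ge0}$ ($\mu^{(0)}=\mu$), $D^{(n)}$ its Szeg\H{o} function,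 $F^{(n)}(z)=\int\frac{e^{i\theta}+z}{e^{i\theta}-z}d\mu^{(n)}(\theta)$, and $f^{(n)}$ is defined by $F^{(n)}=\frac{1+zf^{(n)}}{1-zf^{(n)}}$. $F=F^{(0)}$, $D=D^{(0)}$, $f=f^{(0)}$. The relative Szeg\H{o} function is $(\delta_0D)(z)=\frac{1-\bar\alpha_0f(z)}{\rho_0}\cdot\frac{1-zf^{(1)}(z)}{1-zf(z)}$, which equals $D(z)/D^{(1)}(z)$ on $\mathbb D$. *)

(* Defs.v *)
(* Complex numbers are R[i]
   (mathcomp-real-closed `complex`) over an arbitrary R : realType;
   R[i]^o is a normed module over R[i], so `derivable f z 1` is complex
   differentiability.  The unit circle is parametrized by the angle
   theta in circ = [0, 2 pi). *)
From HB Require Import structures.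
From mathcomp Require Import all_boot all_order all_algebra.
From mathcomp Require Import complex.
From mathcomp Require Import all_classical all_reals all_analysis.
Import Order.TTheory GRing.Theory Num.Theory.
Import numFieldNormedType.Exports.

Set Implicit Arguments.
Unset Strict Implicit.
Unset Printing Implicit Defensive.

Local Open Scope classical_set_scope.
Local Open Scope ring_scope.

Section Defs.
Context {R : realType}.
Local Notation C := R[i].

(** the circle, parametrized by theta in [0, 2 pi) *)
Definition circ : set R := `[0, pi *+ 2[.

(** e^{i t} *)
Definition eit (t : R) : C := (cos t +i* sin t)%C.

(** complex exponential *)
Definition cexp (z : C) : C :=
  (expR (complex.Re z))%:C%C * (cos (complex.Im z) +i* sin (complex.Im z))%C.

(** integral over the circle of a complex valued function w.r.t. mu *)
Definition cint (mu : {measure set (measurableTypeR R) -> \bar R}) (f : R -> C) : C :=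
  (Rintegral mu circ (fun t => complex.Re (f t)))%:C%C
  + 'i%C * (Rintegral mu circ (fun t => complex.Im (f t)))%:C%C.

(** mu is a probability measure on the circle *)
Definition circle_prob (mu : {measure set (measurableTypeR R) -> \bar R}) : Prop :=
  mu setT = 1%E /\ mu (~` circ) = 0%E.

(** Lebesgue decomposition  d mu = w dtheta/(2 pi) + d mus  on the circle,
    with mus singular (w.r.t. Lebesgue measure) *)
Definition lebesgue_decomp (mu : {measure set (measurableTypeR R) -> \bar R}) (w : R -> R)
    (mus : {measure set (measurableTypeR R) -> \bar R}) : Prop :=
  (forall t, 0 <= w t) /\ measurable_fun (circ : set (measurableTypeR R)) w /\
  (exists N : set (measurableTypeR R), measurable N /\ N `<=` circ /\
      lebesgue_measure N = 0%E /\ mus (~` N) = 0%E) /\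
  (forall A : set (measurableTypeR R), measurable A ->
     mu A = (\int[lebesgue_measure]_(t in A `&` circ) (w t / (pi *+ 2))%:E
             + mus A)%E).

(** extended logarithm: log 0 = -oo *)
Definition logE (x : R) : \bar R := if 0 < x then (ln x)%:E else -oo%E.

(** Szego condition  int log w dtheta/(2 pi) > -oo *)
Definition szego_cond (w : R -> R) : Prop :=
  (-oo < \int[lebesgue_measure]_(t in circ) (logE (w t) * ((pi *+ 2)^-1)%:E))%E.

(** Szego function D(z) = exp( int (e^{it}+z)/(e^{it}-z) log w(t) dt/(4 pi) ) *)
Definition szego (w : R -> R) (z : C) : C :=
  cexp (cint lebesgue_measure
          (fun t => (eit t + z) / (eit t - z) * (ln (w t))%:C%C / (pi *+ 4)%:C%C)).

(** Caratheodory function F(z) = int (e^{it}+z)/(e^{it}-z) dmu(t) *)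
Definition carath (mu : {measure set (measurableTypeR R) -> \bar R}) (z : C) : C :=
  cint mu (fun t => (eit t + z) / (eit t - z)).

(** Schur function f, defined by F = (1 + z f)/(1 - z f); at z = 0 by
    continuity (f(0) = F'(0)/2). *)
Definition schur (mu : {measure set (measurableTypeR R) -> \bar R}) (z : C) : C :=
  if z == 0 then 'D_1 (carath mu : C^o -> C^o) 0 / 2
  else (carath mu z - 1) / (z * (carath mu z + 1)).

(** reversed polynomial  p^*(z) = z^n conj(p(1/conj z))  for degree n *)
Definition pstar (n : nat) (p : {poly C}) : {poly C} :=
  \poly_(i < n.+1) (p`_(n - i))^*.

(** monic OPUC generated by the Szego recursion from coefficients a *)
Fixpoint opuc (a : nat -> C) (n : nat) : {poly C} :=
  if n is k.+1 then 'X * opuc a k - ((a k)^*)%:P * pstar k (opuc a k)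
  else 1.

(** a is the sequence of Verblunsky coefficients of mu: the polynomials
    generated by the recursion with coefficients a are the monic
    orthogonal polynomials of mu. *)
Definition verblunsky (mu : {measure set (measurableTypeR R) -> \bar R}) (a : nat -> C) : Prop :=
  forall n j : nat, (j < n)%N ->
    cint mu (fun t => (eit t ^+ j)^* * (opuc a n).[eit t]) = 0.

Definition rho (a : C) : C := sqrtC (1 - `|a| ^+ 2).

(** relative Szego function (delta_0 D)(z), mu1 = mu^(1), a0 = alpha_0 *)
Definition rel_szego (mu mu1 : {measure set (measurableTypeR R) -> \bar R}) (a0 : C) (z : C) : C :=
  (1 - a0^* * schur mu z) / rho a0 * ((1 - z * schur mu1 z) / (1 - z * schur mu z)).

(** complex analysis *)
Definition cball (c : C) (r : R) : set C := [set z | `|z - c| < r%:C%C].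

Definition holo (U : set C) (f : C -> C) : Prop :=
  forall z, U z -> derivable (f : C^o -> C^o) z 1.

(** g has a zero of order k at a (k = 0: g a <> 0) *)
Definition zero_order (g : C -> C) (a : C) (k : nat) : Prop :=
  exists e : R, 0 < e /\ exists h : C -> C,
    holo (cball a e) h /\ h a != 0 /\
    forall z, cball a e z -> g z = (z - a) ^+ k * h z.

(** G has a pole of order k >= 1 at a *)
Definition pole_order (G : C -> C) (a : C) (k : nat) : Prop :=
  (0 < k)%N /\ exists e : R, 0 < e /\ exists h : C -> C,
    holo (cball a e) h /\ h a != 0 /\
    forall z, cball a e z -> z != a -> G z = h z / (z - a) ^+ k.

(** h (given on the unit disc) has an analytic continuation to |z| < r *)
Definition analytic_cont (h : C -> C) (r : R) : Prop :=
  exists g : C -> C, holo (cball 0 r) g /\ forall z, cball 0 1 z -> g z = h z.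

End Defs.

(* Main.v *)
(* Write g = 1/D and g#(z) = conj (g (1 / conj z)).  Jensen's inequality keeps g from
   vanishing on the circle, and the uniqueness theorem for Poisson integrals gives
   w = |g|^-2 there.  Hence F(z) = int (e+z)/(e-z) / (g g#) dtheta/(2 pi), and pushing the
   contour outwards past z continues F: beyond the circle g F = 2/g# - g F#, which is
   analytic in |z| < R and equals 2/g# != 0 at the zeros of g.

   With t_0 = F + 1, z u_0 = F - 1, t_(n+1) = t_n - conj(alpha_n) u_n and
   z u_(n+1) = u_n - alpha_n t_n one has F^(n) = (t_n + z u_n) / (t_n - z u_n).  The functions
   g t_n and g u_n are analytic in |z| < R, and
   g_n = g (t_n - z u_n) / (2 rho_0 ... rho_(n-1)) has no zero in the closed disc while
   Re F^(n) = |g_n|^-2 on the circle; therefore g_n = 1/D^(n).  Finally delta_0 D = g_1 / g,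
   and at a zero p of g, where |p| > 1,
   2 rho_0 p g_1(p) = (g F)(p) (p (1 + alpha_0) - (1 + conj alpha_0)) != 0.

   Analyticity enters only through Goursat's theorem: r |-> int f(r e^(i t)) dt is constant
   when f is analytic in an annulus. *)
Require Import Defs.
From HB Require Import structures.
From mathcomp Require Import all_boot all_order all_algebra.
From mathcomp Require Import complex ring lra.
From mathcomp Require Import all_classical all_reals all_analysis measurable_realfun.
Import Order.TTheory GRing.Theory Num.Theory.
Import numFieldNormedType.Exports.

Set Implicit Arguments.
Unset Strict Implicit.
Unset Printing Implicit Defensive.

Local Open Scope classical_set_scope.
Local Open Scope ring_scope.

Local Notation N := (@ComplexField.Normc.normc _).
Local Notation Re := complex.Re.
Local Notation Im := complex.Im.

(** * Limits and derivatives of complex functions *)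

Section ComplexModulus.
Context {R : realType}.
Local Notation C := R[i].
Implicit Types (z : C) (x : R).

Lemma cnormE z : `|z| = (N z)%:C%C.
Proof. by rewrite normc_def; case: z. Qed.

Lemma normcE2 z : N z = Num.sqrt (Re z ^+ 2 + Im z ^+ 2).
Proof. by case: z. Qed.

Lemma normc_ge0 z : 0 <= N z.
Proof. by rewrite normcE2 sqrtr_ge0. Qed.

Lemma normc_0 : N (0 : C) = 0.
Proof. by rewrite /= expr0n addr0 sqrtr0. Qed.

Lemma normc_1 : N (1 : C) = 1.
Proof. by rewrite /= expr0n addr0 expr1n sqrtr1. Qed.

Lemma normc_eq0 z : (N z == 0) = (z == 0).
Proof.
by apply/eqP/eqP => [/ComplexField.Normc.eq0_normc|->] //; rewrite normc_0.
Qed.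

Lemma normc_gt0 z : (0 < N z) = (z != 0).
Proof. by rewrite lt_def normc_ge0 andbT normc_eq0. Qed.

Lemma normc_M z w : N (z * w) = N z * N w.
Proof. exact: ComplexField.Normc.normcM. Qed.

Lemma normc_V z : N z^-1 = (N z)^-1.
Proof. exact: ComplexField.Normc.normcV. Qed.

Lemma normc_X z n : N (z ^+ n) = N z ^+ n.
Proof. by elim: n => [|n IH]; rewrite ?expr0 ?normc_1 // !exprS normc_M IH. Qed.

Lemma normc_N z : N (- z) = N z.
Proof. by case: z => a b /=; rewrite !sqrrN. Qed.

Lemma normc_D z w : N (z + w) <= N z + N w.
Proof. exact: le_normcD. Qed.

Lemma normc_B z w : N (z - w) <= N z + N w.
Proof. by rewrite -[N w]normc_N normc_D. Qed.

Lemma normcBC z w : N (z - w) = N (w - z).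
Proof. by rewrite -opprB normc_N. Qed.

Lemma normc_lB z w : N z - N w <= N (z - w).
Proof. by rewrite lerBlDr (le_trans _ (normc_D _ _)) // subrK. Qed.

Lemma normc_lB_abs z w : `|N z - N w| <= N (z - w).
Proof.
rewrite ler_norml normc_lB andbT lerNl opprB normcBC; exact: normc_lB.
Qed.

Lemma normc_real x : N (x%:C%C) = `|x|.
Proof. by rewrite /= expr0n addr0 sqrtr_sqr. Qed.

Lemma normc_conj z : N (z^*) = N z.
Proof. by case: z => a b; rewrite /= sqrrN. Qed.

Lemma normc_sqr z : N z ^+ 2 = Re z ^+ 2 + Im z ^+ 2.
Proof. by rewrite normcE2 sqr_sqrtr // addr_ge0 // sqr_ge0. Qed.

Lemma normcRe z : `|Re z| <= N z.
Proof.
by rewrite normcE2 -sqrtr_sqr ler_wsqrtr // lerDl sqr_ge0.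
Qed.

Lemma normcIm z : `|Im z| <= N z.
Proof.
by rewrite normcE2 -sqrtr_sqr ler_wsqrtr // lerDr sqr_ge0.
Qed.

Lemma normc_ReIm z : N z <= `|Re z| + `|Im z|.
Proof.
rewrite -(@ler_pXn2r _ 2) ?nnegrE ?normc_ge0 ?addr_ge0 //.
rewrite normc_sqr sqrrD !real_normK ?num_real // lerD2r lerDl.
by rewrite mulrn_wge0 // mulr_ge0.
Qed.

Lemma mulc_conj z : z * z^* = ((N z) ^+ 2)%:C%C.
Proof.
rewrite normc_sqr; case: z => a b.
by apply/eqP; rewrite eq_complex; apply/andP; split; apply/eqP => /=; ring.
Qed.

Lemma invc_conj z : N z = 1 -> z^* = z^-1.
Proof.
move=> z1; have z0 : z != 0 by rewrite -normc_eq0 z1 oner_eq0.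
by apply: (mulfI z0); rewrite mulc_conj z1 expr1n divff.
Qed.

Lemma cReD z w : Re (z + w) = Re z + Re w. Proof. by case: z; case: w. Qed.
Lemma cImD z w : Im (z + w) = Im z + Im w. Proof. by case: z; case: w. Qed.
Lemma cReN z : Re (- z) = - Re z. Proof. by case: z. Qed.
Lemma cImN z : Im (- z) = - Im z. Proof. by case: z. Qed.
Lemma cReB z w : Re (z - w) = Re z - Re w. Proof. by rewrite cReD cReN. Qed.
Lemma cImB z w : Im (z - w) = Im z - Im w. Proof. by rewrite cImD cImN. Qed.
Lemma cReM z w : Re (z * w) = Re z * Re w - Im z * Im w.
Proof. by case: z; case: w. Qed.
Lemma cImM z w : Im (z * w) = Re z * Im w + Im z * Re w.
Proof. by case: z; case: w. Qed.
Lemma cReJ z : Re (z^*) = Re z. Proof. by case: z. Qed.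
Lemma cImJ z : Im (z^*) = - Im z. Proof. by case: z. Qed.
Lemma cReV z : Re z^-1 = Re z / (N z) ^+ 2.
Proof. by rewrite normc_sqr; case: z. Qed.
Lemma cImV z : Im z^-1 = - Im z / (N z) ^+ 2.
Proof. by rewrite normc_sqr mulNr; case: z. Qed.
Lemma Rereal x : Re (x%:C%C) = x. Proof. by []. Qed.
Lemma Imreal x : Im (x%:C%C) = 0. Proof. by []. Qed.

Lemma complex_ext z w : Re z = Re w -> Im z = Im w -> z = w.
Proof. by case: z; case: w => a b c d /= -> ->. Qed.

Lemma realCD x y : (x + y)%:C%C = x%:C%C + y%:C%C :> C.
Proof. exact: rmorphD. Qed.
Lemma realCB x y : (x - y)%:C%C = x%:C%C - y%:C%C :> C.
Proof. exact: rmorphB. Qed.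
Lemma realCM x y : (x * y)%:C%C = x%:C%C * y%:C%C :> C.
Proof. exact: rmorphM. Qed.
Lemma realCV x : (x^-1)%:C%C = (x%:C%C)^-1 :> C.
Proof. exact: fmorphV. Qed.
Lemma realCX x n : (x ^+ n)%:C%C = (x%:C%C) ^+ n :> C.
Proof. exact: rmorphXn. Qed.
Lemma realC_eq0 x : (x%:C%C == 0 :> C) = (x == 0).
Proof. by rewrite eq_complex /= eqxx andbT. Qed.
Lemma conj_realC x : (x%:C%C)^* = x%:C%C :> C.
Proof. by apply: complex_ext; rewrite ?cReJ ?cImJ //= oppr0. Qed.

Lemma ltC_normc z x : (`|z| < x%:C%C) = (N z < x).
Proof. by rewrite cnormE ltcR. Qed.

Lemma cballE c r z : cball c r z = (N (z - c) < r) :> Prop.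
Proof. by rewrite /cball /= ltC_normc. Qed.

Lemma cball0E r z : cball 0 r z = (N z < r) :> Prop.
Proof. by rewrite cballE subr0. Qed.

Lemma normc_eit t : N (eit t : C) = 1.
Proof. by rewrite normcE2 /= cos2Dsin2 sqrtr1. Qed.

Lemma eit_neq0 t : (eit t : C) != 0.
Proof. by rewrite -normc_eq0 normc_eit oner_eq0. Qed.

Lemma eitD s t : eit (s + t) = eit s * eit t :> C.
Proof. by apply: complex_ext; rewrite ?cReM ?cImM /= ?cosD ?sinD //; ring. Qed.

Lemma eit0 : eit 0 = 1 :> C.
Proof. by apply: complex_ext; rewrite /= ?cos0 ?sin0. Qed.

Lemma eit2pi : eit (pi *+ 2) = 1 :> C.
Proof. by apply: complex_ext; rewrite /= ?cos2pi ?sin2pi. Qed.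

Lemma eit_conj t : (eit t : C)^* = (eit t)^-1.
Proof. by rewrite invc_conj // normc_eit. Qed.

Lemma cexpE z : cexp z = (expR (Re z))%:C%C * eit (Im z).
Proof. by []. Qed.

Lemma cexpD z w : cexp (z + w) = cexp z * cexp w.
Proof. by rewrite !cexpE cReD cImD expRD eitD realCM; ring. Qed.

Lemma normc_cexp z : N (cexp z) = expR (Re z).
Proof. by rewrite cexpE normc_M normc_eit mulr1 normc_real ger0_norm ?expR_ge0. Qed.

Lemma cexp_neq0 z : cexp z != 0.
Proof. by rewrite -normc_eq0 normc_cexp gt_eqF // expR_gt0. Qed.

Lemma cexp0 : cexp 0 = 1 :> C.
Proof. by rewrite cexpE /= expR0 eit0 mulr1. Qed.

Lemma cexpN z : cexp (- z) = (cexp z)^-1.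
Proof.
apply: (mulfI (cexp_neq0 z)); rewrite -cexpD subrr cexp0 divff //.
exact: cexp_neq0.
Qed.

Lemma cexp_real x : cexp x%:C%C = (expR x)%:C%C :> C.
Proof. by rewrite cexpE /= eit0 mulr1. Qed.

Lemma polar z : exists t : R, 0 <= t <= pi *+ 2 /\ z = (N z)%:C%C * eit t.
Proof.
have [->|z0] := eqVneq z 0.
  exists 0; split; first by rewrite lexx /= mulrn_wge0 // pi_ge0.
  by rewrite normc_0 /= mul0r.
have Nz : 0 < N z by rewrite normc_gt0.
pose c := Re z / N z; pose s := Im z / N z.
have cs : c ^+ 2 + s ^+ 2 = 1.
  by rewrite !expr_div_n -mulrDl -normc_sqr divff // expf_neq0 // gt_eqF.
have c1 : -1 <= c <= 1.
  rewrite -ler_norml -(@ler_pXn2r _ 2) ?nnegrE // real_normK ?num_real //.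
  by rewrite expr1n -cs lerDl sqr_ge0.
have cosa : cos (acos c) = c by rewrite acosK // in_itv /=.
have sins : sin (acos c) = `|s|.
  by rewrite sin_acos // -cs addrC addKr sqrtr_sqr.
have zE : z = (N z)%:C%C * (c +i* s)%C.
  by apply: complex_ext; rewrite ?cReM ?cImM /= /c /s ?mul0r ?subr0 ?addr0; field; rewrite gt_eqF.
have api : 0 <= acos c <= pi by rewrite acos_ge0 // acos_lepi.
have [s0|s0] := leP 0 s.
  exists (acos c); split; first by lra.
  by rewrite {1}zE /eit cosa sins ger0_norm.
exists (pi *+ 2 - acos c); split; first by lra.
rewrite {1}zE /eit cosB sinB cos2pi sin2pi cosa sins !mul1r !mul0r addr0 add0r ?sub0r.
by rewrite ltr0_norm // opprK.
Qed.

Lemma normc_i : N ('i%C : C) = 1.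
Proof. by rewrite /= expr0n /= expr1n add0r sqrtr1. Qed.

End ComplexModulus.

Arguments ComplexField.Normc.normc : simpl never.

Section ComplexLimits.
Context {R : realType}.
Local Notation C := R[i].

Lemma nearC (z : C) (P : C -> Prop) :
  (\forall y \near (z : C^o), P y) <->
  exists2 e : R, 0 < e & forall y, N (y - z) < e -> P y.
Proof.
split=> [/nbhs_ballP[e /= e0 He]|[e e0 He]].
  have := e0; rewrite ltcE /= => /andP[/eqP ime re0].
  exists (Re e) => // y yz; apply: He.
  rewrite -ball_normE /ball_ /= distrC cnormE.
  by rewrite ltcE /= ime eqxx.
apply/nbhs_ballP; exists e%:C%C; first by rewrite /= ltcR.
move=> y; rewrite -ball_normE /ball_ /= distrC cnormE ltcR; exact: He.
Qed.

Lemma ccvgP {T : Type} (F : set_system T) {FF : Filter F} (f : T -> C) (l : C) :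
  ((f : T -> C^o) @ F --> (l : C^o)) <->
  (forall e : R, 0 < e -> \forall x \near F, N (f x - l) < e).
Proof.
split => [fl e e0|H].
  by have /fl := (nearC l (fun y => N (y - l) < e)).2 (ex_intro2 _ _ e e0 (fun=> id)).
move=> A /nearC[e e0 HA]; rewrite /nbhs /=.
by apply: filterS (H e e0) => x; exact: HA.
Qed.

Lemma rcvgP {T : Type} (F : set_system T) {FF : Filter F} (f : T -> R) (l : R) :
  ((f : T -> R) @ F --> l) <->
  (forall e : R, 0 < e -> \forall x \near F, `|f x - l| < e).
Proof.
split => [/cvgrPdist_lt H e /H|H].
  by apply: filterS => x; rewrite distrC.
by apply/cvgrPdist_lt => e /H; apply: filterS => x; rewrite distrC.
Qed.

Lemma ccvg_ReIm {T : Type} (F : set_system T) {FF : Filter F} (f : T -> C) (l : C) :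
  ((f : T -> C^o) @ F --> (l : C^o)) <->
  ((fun x => Re (f x)) @ F --> Re l /\ (fun x => Im (f x)) @ F --> Im l).
Proof.
rewrite ccvgP; split.
  by move=> H; split; apply/rcvgP => e /H; apply: filterS => x; apply: le_lt_trans;
    [rewrite -cReB normcRe|rewrite -cImB normcIm].
move=> [/rcvgP r /rcvgP i] e e0.
have e2 : 0 < e / 2 by rewrite divr_gt0.
apply: filterS2 (r _ e2) (i _ e2) => x /= rx ix.
rewrite (le_lt_trans (normc_ReIm _)) // cReB cImB; lra.
Qed.

Lemma ccvg_Re {T : Type} (F : set_system T) {FF : Filter F} (f : T -> C) (l : C) :
  ((f : T -> C^o) @ F --> (l : C^o)) -> (fun x => Re (f x)) @ F --> Re l.
Proof. by move=> /ccvg_ReIm[]. Qed.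

Lemma ccvg_Im {T : Type} (F : set_system T) {FF : Filter F} (f : T -> C) (l : C) :
  ((f : T -> C^o) @ F --> (l : C^o)) -> (fun x => Im (f x)) @ F --> Im l.
Proof. by move=> /ccvg_ReIm[]. Qed.

Lemma ccvg_norm {T : Type} (F : set_system T) {FF : Filter F} (f : T -> C) (l : C) :
  ((f : T -> C^o) @ F --> (l : C^o)) -> (fun x => N (f x)) @ F --> N l.
Proof.
move=> /ccvgP H; apply/rcvgP => e /H; apply: filterS => x; apply: le_lt_trans.
exact: normc_lB_abs.
Qed.

Lemma ccvg_real {T : Type} (F : set_system T) {FF : Filter F} (f : T -> R) (l : R) :
  f @ F --> l -> ((fun x => (f x)%:C%C) : T -> C^o) @ F --> (l%:C%C : C^o).
Proof.
move=> /rcvgP H; apply/ccvgP => e /H; apply: filterS => x.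
by rewrite -realCB normc_real.
Qed.

Lemma continuous_eit : continuous (eit : R -> C^o).
Proof.
move=> t; apply/ccvg_ReIm; split; [exact: continuous_cos|exact: continuous_sin].
Qed.

Lemma ccvgM {T : Type} (F : set_system T) {FF : Filter F} (f g : T -> C) (l m : C) :
  ((f : T -> C^o) @ F --> (l : C^o)) -> ((g : T -> C^o) @ F --> (m : C^o)) ->
  ((fun x => f x * g x) : T -> C^o) @ F --> (l * m : C^o).
Proof. exact: (@cvgM C). Qed.

Lemma ccvgD {T : Type} (F : set_system T) {FF : Filter F} (f g : T -> C) (l m : C) :
  ((f : T -> C^o) @ F --> (l : C^o)) -> ((g : T -> C^o) @ F --> (m : C^o)) ->
  ((fun x => f x + g x) : T -> C^o) @ F --> (l + m : C^o).
Proof. exact: (@cvgD C C^o). Qed.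

Lemma ccvgB {T : Type} (F : set_system T) {FF : Filter F} (f g : T -> C) (l m : C) :
  ((f : T -> C^o) @ F --> (l : C^o)) -> ((g : T -> C^o) @ F --> (m : C^o)) ->
  ((fun x => f x - g x) : T -> C^o) @ F --> (l - m : C^o).
Proof. exact: (@cvgB C C^o). Qed.

Lemma ccvgV {T : Type} (F : set_system T) {FF : Filter F} (f : T -> C) (l : C) :
  l != 0 -> ((f : T -> C^o) @ F --> (l : C^o)) ->
  ((fun x => (f x)^-1) : T -> C^o) @ F --> (l^-1 : C^o).
Proof. by move=> l0 fl; apply: (@cvgV C). Qed.

Lemma cvg_compose {T : Type} {V U : topologicalType} (F : set_system T)
  (f : T -> V) (h : V -> U) (l : V) :
  {for l, continuous h} -> f @ F --> l -> (fun x => h (f x)) @ F --> h l.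
Proof. by move=> hc fl A /hc /fl. Qed.

(* Records rather than definitions, so that conversion never unfolds the filters. *)
Record cdiff (f : C -> C) (z : C) : Prop :=
  Cdiff { cdiff_derivable : derivable (f : C^o -> C^o) z 1 }.
Record ccont (f : C -> C) (z : C) : Prop :=
  Ccont { ccont_cvg : (f : C^o -> C^o) @ (z : C^o) --> (f z : C^o) }.

Lemma ccontP (f : C -> C) z : ccont f z <->
  forall e : R, 0 < e -> exists2 d : R, 0 < d & forall y, N (y - z) < d -> N (f y - f z) < e.
Proof.
have P := @ccvgP C^o (nbhs (z : C^o)) (nbhs_filter (z : C^o)) f (f z).
split=> [[/P H] e /H /nearC|H] //; split; apply/P => e /H ?; exact/nearC.
Qed.

Lemma cdiffP (f : C -> C) z : cdiff f z <->
  exists phi : C -> C, ccont phi z /\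
    (exists2 e : R, 0 < e & forall y, N (y - z) < e -> f y = f z + (y - z) * phi y).
Proof.
split.
  move=> [/cvg_ex[/= l /(@cvgrPdist_lt _ C^o) fl]].
  exists (fun y => if y == z then l else (f y - f z) / (y - z)); split.
    apply/ccontP => e e0; rewrite eqxx.
    have := fl e%:C%C; rewrite ltcR => /(_ e0) /nbhs_ballP[d /= d0 Hd].
    have := d0; rewrite ltcE /= => /andP[/eqP imd rd0].
    exists (Re d) => // y yz; case: eqVneq => [_|yz0]; first by rewrite subrr normc_0.
    have := Hd (y - z); rewrite -ball_normE /ball_ /= sub0r normrN cnormE.
    rewrite ltcE /= imd eqxx /= => /(_ yz).
    rewrite subr_eq0 yz0 => /(_ isT).
    by rewrite distrC cnormE ltcR /= scaler1 subrK /GRing.scale /= mulrC.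
  exists 1 => // y _; case: eqVneq => [->|yz]; first by rewrite subrr mul0r addr0.
  by rewrite mulrCA divff ?mulr1 ?subr_eq0 // addrC subrK.
move=> [phi [phic [d d0 H]]]; split; apply/cvg_ex; exists (phi z) => /=.
apply/(@cvgrPdist_lt _ C^o) => e e0.
have := e0; rewrite ltcE /= => /andP[/eqP ime re0].
move/ccontP: phic => /(_ _ re0)[d' d'0 H'].
apply/nbhs_ballP; exists (Num.min d d')%:C%C; first by rewrite /= ltcR lt_min d0.
move=> h; rewrite -ball_normE /ball_ /= sub0r normrN cnormE ltcR lt_min => /andP[h1 h2 h0].
have -> : f (h%:A + z) - f z = h * phi (h + z).
  by rewrite scaler1 (H (h + z)) ?addrK //; ring.
rewrite /GRing.scale /= mulKf //.
by rewrite distrC cnormE ltcE /= ime eqxx /= H' // addrK.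
Qed.

Lemma ccont_cst (c : C) z : ccont (fun=> c) z.
Proof. by apply/ccontP => e e0; exists 1 => // y _; rewrite subrr normc_0. Qed.

Lemma ccont_id z : ccont id z.
Proof. by apply/ccontP => e e0; exists e. Qed.

Lemma ccontD f g z : ccont f z -> ccont g z -> ccont (fun y => f y + g y) z.
Proof.
move=> [cf] [cg]; split.
exact: (@ccvgD C^o (nbhs (z : C^o)) (nbhs_filter (z : C^o)) f g (f z) (g z) cf cg).
Qed.

Lemma ccontB f g z : ccont f z -> ccont g z -> ccont (fun y => f y - g y) z.
Proof.
move=> [cf] [cg]; split.
exact: (@ccvgB C^o (nbhs (z : C^o)) (nbhs_filter (z : C^o)) f g (f z) (g z) cf cg).
Qed.

Lemma ccontM f g z : ccont f z -> ccont g z -> ccont (fun y => f y * g y) z.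
Proof.
move=> [cf] [cg]; split.
exact: (@ccvgM C^o (nbhs (z : C^o)) (nbhs_filter (z : C^o)) f g (f z) (g z) cf cg).
Qed.

Lemma ccontV f z : f z != 0 -> ccont f z -> ccont (fun y => (f y)^-1) z.
Proof.
move=> fz [cf]; split.
exact: (@ccvgV C^o (nbhs (z : C^o)) (nbhs_filter (z : C^o)) f (f z) fz cf).
Qed.

Lemma ccont_comp f g z : ccont f z -> ccont g (f z) -> ccont (fun y => g (f y)) z.
Proof. by move=> [cf] [cg]; split; move=> A /cg /cf. Qed.

Lemma ccont_conj z : ccont Num.conj z.
Proof.
by apply/ccontP => e e0; exists e => // y; rewrite -rmorphB normc_conj.
Qed.

Lemma cdiff_near (f g : C -> C) z (e : R) : 0 < e ->
  (forall y, N (y - z) < e -> f y = g y) -> cdiff f z -> cdiff g z.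
Proof.
move=> e0 fg /cdiffP[phi [phic [d d0 H]]]; apply/cdiffP; exists phi; split=> //.
exists (Num.min d e); first by rewrite lt_min d0.
move=> y; rewrite lt_min => /andP[yd ye].
by rewrite -fg // H // fg // subrr normc_0.
Qed.

Lemma cdiff_ext (f g : C -> C) z : f =1 g -> cdiff f z -> cdiff g z.
Proof. by move=> fg; apply: (@cdiff_near _ _ _ 1). Qed.

Lemma cdiff_cont f z : cdiff f z -> ccont f z.
Proof.
by move=> [/derivable1_diffP fz]; split; exact: differentiable_continuous.
Qed.

Lemma cdiff_cst (c : C) z : cdiff (fun=> c) z.
Proof. by split; exact: derivable_cst. Qed.

Lemma cdiff_id z : cdiff id z.
Proof. by split; exact: derivable_id. Qed.

Lemma cdiffD f g z : cdiff f z -> cdiff g z -> cdiff (fun y => f y + g y) z.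
Proof.
move=> df dg; apply: Cdiff; move: (cdiff_derivable df) (cdiff_derivable dg).
exact: derivableD.
Qed.

Lemma cdiffN f z : cdiff f z -> cdiff (fun y => - f y) z.
Proof.
move=> df; apply: Cdiff; move: (cdiff_derivable df); exact: derivableN.
Qed.

Lemma cdiffB f g z : cdiff f z -> cdiff g z -> cdiff (fun y => f y - g y) z.
Proof.
move=> df dg; apply: Cdiff; move: (cdiff_derivable df) (cdiff_derivable dg).
exact: derivableB.
Qed.

Lemma cdiffM f g z : cdiff f z -> cdiff g z -> cdiff (fun y => f y * g y) z.
Proof.
move=> df dg; apply: Cdiff; move: (cdiff_derivable df) (cdiff_derivable dg).
exact: derivableM.
Qed.

Lemma cdiffV f z : f z != 0 -> cdiff f z -> cdiff (fun y => (f y)^-1) z.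
Proof.
move=> fz df; apply: Cdiff; move: fz (cdiff_derivable df); exact: derivableV.
Qed.

Lemma cdiff_div f g z : g z != 0 -> cdiff f z -> cdiff g z ->
  cdiff (fun y => f y / g y) z.
Proof. by move=> gz df dg; exact: cdiffM df (cdiffV gz dg). Qed.

Lemma cdiffX f n z : cdiff f z -> cdiff (fun y => f y ^+ n) z.
Proof.
move=> df; elim: n => [|n IH]; first exact: cdiff_cst.
by apply: (cdiff_ext _ (cdiffM df IH)) => y; rewrite exprS.
Qed.

Lemma cdiff_comp f g z : cdiff f z -> cdiff g (f z) -> cdiff (fun y => g (f y)) z.
Proof.
move=> fd /cdiffP[psi [psic [e e0 Hg]]].
have fc := cdiff_cont fd.
move/cdiffP: fd => [phi [phic [d d0 Hf]]].
apply/cdiffP; exists (fun y => phi y * psi (f y)); split.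
  exact: ccontM phic (ccont_comp fc psic).
move/ccontP: fc => /(_ _ e0)[d' d'0 fc].
exists (Num.min d d'); first by rewrite lt_min d0.
move=> y; rewrite lt_min => /andP[yd yd'].
have fyz : f y - f z = (y - z) * phi y by rewrite Hf // addrAC subrr add0r.
by rewrite Hg ?fc // fyz mulrA.
Qed.

Lemma cdiff_conj f z : cdiff f (z^*) -> cdiff (fun y => (f y^*)^*) z.
Proof.
move=> /cdiffP[phi [phic [e e0 H]]]; apply/cdiffP.
exists (fun y => (phi y^*)^*); split.
  exact: ccont_comp (ccont_comp (ccont_conj z) phic) (ccont_conj _).
exists e => // y ye.
have cye : N (y^* - z^*) < e by rewrite -(rmorphB Num.conj) normc_conj.
by rewrite [f y^*]H // rmorphD rmorphM rmorphB /= !conjCK.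
Qed.

Lemma cdiff_derive f z : cdiff f z ->
  exists2 l : C, 'D_1 (f : C^o -> C^o) z = l &
  ccont (fun y => if y == z then l else (f y - f z) / (y - z)) z.
Proof.
move=> /cdiffP[phi [phic [e e0 H]]]; exists (phi z).
  apply: cvg_lim => //=; apply/(@cvgrPdist_lt _ C^o) => d.
  rewrite ltcE /= => /andP[/eqP imd rd0].
  move/ccontP: phic => /(_ _ rd0)[d' d'0 H'].
  apply/nbhs_ballP; exists (Num.min e d')%:C%C; first by rewrite /= ltcR lt_min e0.
  move=> h; rewrite -ball_normE /ball_ /= sub0r normrN cnormE ltcR lt_min => /andP[h1 h2 h0].
  have -> : f (h%:A + z) - f z = h * phi (h + z).
    by rewrite scaler1 (H (h + z)) ?addrK //; ring.
  rewrite /GRing.scale /= mulKf //.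
  by rewrite distrC cnormE ltcE /= imd eqxx /= H' // addrK.
apply/ccontP => d d0; rewrite eqxx.
move/ccontP: phic => /(_ _ d0)[d2 d20 H2].
exists (Num.min e d2); first by rewrite lt_min e0.
move=> y; rewrite lt_min => /andP[y1 y2].
case: eqVneq => [_|yz]; first by rewrite subrr normc_0.
by rewrite H // addrAC subrr add0r mulrC mulKf ?subr_eq0 // H2.
Qed.

Lemma holoP (U : set C) f : holo U f <-> forall z, U z -> cdiff f z.
Proof. by split=> H z /H; [move=> ?; split|case]. Qed.

End ComplexLimits.

Definition leb {R : realType} : {measure set (measurableTypeR R) -> \bar R} := lebesgue_measure.

(** * Complex valued integrals *)

Section ComplexIntegral.
Context {R : realType}.
Local Notation C := R[i].
Local Notation TR := (measurableTypeR R).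
Implicit Types (D : set TR) (f g : R -> C).

Definition Cint (mu : {measure set TR -> \bar R}) D f : C :=
  (Rintegral mu D (fun t => Re (f t)))%:C%C + 'i%C * (Rintegral mu D (fun t => Im (f t)))%:C%C.

Definition cmeas D f : Prop :=
  measurable_fun D (fun t => Re (f t)) /\ measurable_fun D (fun t => Im (f t)).

Definition cintegrable (mu : {measure set TR -> \bar R}) D f : Prop :=
  mu.-integrable D (EFin \o (fun t => Re (f t))) /\
  mu.-integrable D (EFin \o (fun t => Im (f t))).

Lemma cmeas_ext D f g : (forall t, D t -> f t = g t) -> cmeas D f -> cmeas D g.
Proof.
move=> fg [mr mi]; split.
  by apply: eq_measurable_fun mr => t /[!inE] Dt; rewrite fg.
by apply: eq_measurable_fun mi => t /[!inE] Dt; rewrite fg.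
Qed.

Lemma cmeas_cst D (c : C) : cmeas D (fun=> c).
Proof. by split; exact: measurable_cst. Qed.

Lemma cmeasD D f g : cmeas D f -> cmeas D g -> cmeas D (fun t => f t + g t).
Proof.
move=> [fr fi] [gr gi]; split.
  by under eq_fun do rewrite cReD; exact: measurable_funD.
by under eq_fun do rewrite cImD; exact: measurable_funD.
Qed.

Lemma cmeasB D f g : cmeas D f -> cmeas D g -> cmeas D (fun t => f t - g t).
Proof.
move=> [fr fi] [gr gi]; split.
  by under eq_fun do rewrite cReB; exact: measurable_funB.
by under eq_fun do rewrite cImB; exact: measurable_funB.
Qed.

Lemma cmeasM D f g : cmeas D f -> cmeas D g -> cmeas D (fun t => f t * g t).
Proof.
move=> [fr fi] [gr gi]; split.
  by under eq_fun do rewrite cReM; apply: measurable_funB; exact: measurable_funM.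
by under eq_fun do rewrite cImM; apply: measurable_funD; exact: measurable_funM.
Qed.

Lemma cmeas_real D (h : R -> R) : measurable_fun D h -> cmeas D (fun t => (h t)%:C%C).
Proof. by move=> mh; split => //=; exact: measurable_cst. Qed.

Lemma measurable_fun_cont D (h : R -> R) : measurable D ->
  (forall t, D t -> {for t, continuous h}) -> measurable_fun D h.
Proof.
move=> mD hc; apply: subspace_continuous_measurable_fun => //.
by apply: continuous_in_subspaceT => t /[!inE] /hc.
Qed.

Lemma cmeas_cont D f : measurable D ->
  (forall t, D t -> {for t, continuous (f : R -> C^o)}) -> cmeas D f.
Proof.
by move=> mD fc; split; apply: measurable_fun_cont => // t /fc /ccvg_ReIm[].
Qed.

Lemma bounded_onP D (h : R -> R) (M : R) :
  (forall t, D t -> `|h t| <= M) -> [bounded h x | x in D].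
Proof.
by move=> H; exists M; split; rewrite ?num_real // => y My x /= Dx; apply: le_trans (ltW My); exact: H.
Qed.

Section Fixed.
Variables (mu : {measure set TR -> \bar R}) (D : set TR).
Hypothesis mD : measurable D.

Lemma cintegrable_meas f : cintegrable mu D f -> cmeas D f.
Proof.
by move=> [/measurable_int/measurable_EFinP r /measurable_int/measurable_EFinP i].
Qed.

Lemma cintegrable_ext f g : (forall t, D t -> f t = g t) ->
  cintegrable mu D f -> cintegrable mu D g.
Proof.
move=> fg [r i]; split.
  by apply: (eq_integrable mD _ _ _ r) => t /[!inE] Dt /=; rewrite fg.
by apply: (eq_integrable mD _ _ _ i) => t /[!inE] Dt /=; rewrite fg.
Qed.

Lemma cintegrableD f g : cintegrable mu D f -> cintegrable mu D g ->
  cintegrable mu D (fun t => f t + g t).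
Proof.
move=> [fr fi] [gr gi]; split.
  apply: (eq_integrable mD _ _ _ (integrableD mD fr gr)) => t _ /=.
  by rewrite cReD.
apply: (eq_integrable mD _ _ _ (integrableD mD fi gi)) => t _ /=.
by rewrite cImD.
Qed.

Lemma cintegrable_bounded f (M : R) : (mu D < +oo)%E -> cmeas D f ->
  (forall t, D t -> N (f t) <= M) -> cintegrable mu D f.
Proof.
move=> Doo [fr fi] fM; split; apply: measurable_bounded_integrable => //.
  by apply: (@bounded_onP _ _ M) => t /fM; apply: le_trans; exact: normcRe.
by apply: (@bounded_onP _ _ M) => t /fM; apply: le_trans; exact: normcIm.
Qed.

Lemma rintegrable_mulb (h k : R -> R) (M : R) : mu.-integrable D (EFin \o h) ->
  measurable_fun D k -> (forall t, D t -> `|k t| <= M) ->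
  mu.-integrable D (EFin \o (fun t => k t * h t)).
Proof.
move=> hi mk kM.
by apply: (eq_integrable mD _ _ _ (integrableMr mD mk (bounded_onP kM) hi)).
Qed.

Lemma rintegrableD (h k : R -> R) : mu.-integrable D (EFin \o h) ->
  mu.-integrable D (EFin \o k) -> mu.-integrable D (EFin \o (fun t => h t + k t)).
Proof. by move=> hi ki; apply: (eq_integrable mD _ _ _ (integrableD mD hi ki)). Qed.

Lemma rintegrableB (h k : R -> R) : mu.-integrable D (EFin \o h) ->
  mu.-integrable D (EFin \o k) -> mu.-integrable D (EFin \o (fun t => h t - k t)).
Proof. by move=> hi ki; apply: (eq_integrable mD _ _ _ (integrableB mD hi ki)). Qed.

Lemma cintegrable_mulb f g (M : R) : cintegrable mu D f -> cmeas D g ->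
  (forall t, D t -> N (g t) <= M) -> cintegrable mu D (fun t => g t * f t).
Proof.
move=> [fr fi] [gr gi] gM.
have rM t : D t -> `|Re (g t)| <= M by move=> /gM; apply: le_trans; exact: normcRe.
have iM t : D t -> `|Im (g t)| <= M by move=> /gM; apply: le_trans; exact: normcIm.
split.
  apply: (eq_integrable mD _ _ _ (rintegrableB (rintegrable_mulb fr gr rM) (rintegrable_mulb fi gi iM))).
  by move=> t _ /=; rewrite cReM.
apply: (eq_integrable mD _ _ _ (rintegrableD (rintegrable_mulb fi gr rM) (rintegrable_mulb fr gi iM))).
by move=> t _ /=; rewrite cImM.
Qed.

Lemma cintegrableZ f (c : C) : cintegrable mu D f -> cintegrable mu D (fun t => c * f t).
Proof. by move=> fi; apply: (cintegrable_mulb (M := N c)) => //; exact: cmeas_cst. Qed.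

Lemma cintegrableB f g : cintegrable mu D f -> cintegrable mu D g ->
  cintegrable mu D (fun t => f t - g t).
Proof.
move=> fi gi; apply: (cintegrable_ext _ (cintegrableD fi (cintegrableZ (-1) gi))) => t _.
by rewrite mulN1r.
Qed.

Lemma cintegrable_conj f : cintegrable mu D f -> cintegrable mu D (fun t => (f t)^*).
Proof.
move=> [r i]; split.
  by apply: (eq_integrable mD _ _ _ r) => t _ /=; rewrite cReJ.
apply: (eq_integrable mD _ _ _ (integrableZl mD (-1) i)) => t _ /=.
by rewrite cImJ -EFinM mulN1r.
Qed.

Lemma cintegrable_real (h : R -> R) : mu.-integrable D (EFin \o h) ->
  cintegrable mu D (fun t => (h t)%:C%C).
Proof. by move=> hi; split => //=; exact: integrable0. Qed.

Lemma cintegrable_norm f : cintegrable mu D f ->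
  mu.-integrable D (EFin \o (fun t => N (f t))).
Proof.
move=> fi; have [fr fm] := cintegrable_meas fi; have [r i] := fi.
have ri := integrable_norm r; have ii := integrable_norm i.
apply: (le_integrable mD _ _ (rintegrableD ri ii)) => /=.
  apply/measurable_EFinP; under eq_fun do rewrite normcE2.
  apply: (@measurableT_comp _ _ _ _ _ _ (@Num.sqrt R)).
    by apply: continuous_measurable_fun; exact: sqrt_continuous.
  by apply: measurable_funD; exact: measurable_funX.
move=> t Dt; have : `|N (f t)| <= `| `|Re (f t)| + `|Im (f t)| |.
  by rewrite (ger0_norm (normc_ge0 _)) (ger0_norm (addr_ge0 _ _)) ?normc_ReIm.
by rewrite -lee_fin.
Qed.

Lemma Cint_ext f g : (forall t, D t -> f t = g t) -> Cint mu D f = Cint mu D g.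
Proof.
by move=> fg; congr (_%:C%C + _ * _%:C%C); apply: eq_Rintegral => t /[!inE] Dt; rewrite fg.
Qed.

Lemma Re_Cint f : Re (Cint mu D f) = \int[mu]_(t in D) Re (f t).
Proof. by rewrite /Cint cReD cReM /= mul0r mulr0 subrr addr0. Qed.

Lemma Im_Cint f : Im (Cint mu D f) = \int[mu]_(t in D) Im (f t).
Proof. by rewrite /Cint cImD cImM /= mul0r mul1r !add0r. Qed.

Lemma Cint_real (h : R -> R) : Cint mu D (fun t => (h t)%:C%C) = (\int[mu]_(t in D) h t)%:C%C.
Proof. by apply: complex_ext; rewrite ?Re_Cint ?Im_Cint //= Rintegral_cst // mul0r. Qed.

Lemma CintD f g : cintegrable mu D f -> cintegrable mu D g ->
  Cint mu D (fun t => f t + g t) = Cint mu D f + Cint mu D g.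
Proof.
move=> [fr fi] [gr gi]; apply: complex_ext.
  rewrite [RHS]cReD !Re_Cint -RintegralD //; apply: eq_Rintegral => t _.
  by rewrite cReD.
rewrite [RHS]cImD !Im_Cint -RintegralD //; apply: eq_Rintegral => t _.
by rewrite cImD.
Qed.

Lemma CintZ f (c : C) : cintegrable mu D f ->
  Cint mu D (fun t => c * f t) = c * Cint mu D f.
Proof.
move=> [fr fi]; have ZI (r : R) h : mu.-integrable D (EFin \o h) ->
    mu.-integrable D (EFin \o (fun t => r * h t)).
  move=> hi; exact: (eq_integrable mD _ _ _ (integrableZl mD r hi)).
apply: complex_ext.
  rewrite [RHS]cReM !Re_Cint !Im_Cint -!RintegralZl // -RintegralB //; try exact: ZI.
  by apply: eq_Rintegral => t _; rewrite cReM.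
rewrite [RHS]cImM !Re_Cint !Im_Cint -!RintegralZl // -RintegralD //; try exact: ZI.
by apply: eq_Rintegral => t _; rewrite cImM.
Qed.

Lemma CintB f g : cintegrable mu D f -> cintegrable mu D g ->
  Cint mu D (fun t => f t - g t) = Cint mu D f - Cint mu D g.
Proof.
move=> fi gi; rewrite -[- Cint _ _ g]mulN1r -CintZ // -CintD //; last exact: cintegrableZ.
by apply: Cint_ext => t _; rewrite mulN1r.
Qed.

Lemma Cint_cst (c : C) : Cint mu D (fun=> c) = c * (fine (mu D))%:C%C.
Proof.
apply: complex_ext; rewrite ?Re_Cint ?Im_Cint Rintegral_cst // ?cReM ?cImM /= ?mulr0 ?subr0 ?add0r //.
Qed.

Lemma Cint_conj f : cintegrable mu D f -> Cint mu D (fun t => (f t)^*) = (Cint mu D f)^*.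
Proof.
move=> [fr fi]; apply: complex_ext; rewrite ?cReJ ?cImJ ?Re_Cint ?Im_Cint.
  by apply: eq_Rintegral => t _; rewrite cReJ.
rewrite -[RHS]mulN1r -RintegralZl //; apply: eq_Rintegral => t _.
by rewrite cImJ mulN1r.
Qed.

Lemma normc_Cint f (b : R -> R) : cintegrable mu D f ->
  mu.-integrable D (EFin \o b) -> (forall t, D t -> N (f t) <= b t) ->
  N (Cint mu D f) <= 2 * \int[mu]_(t in D) b t.
Proof.
move=> [fr fi] bi fb; rewrite (le_trans (normc_ReIm _)) // Re_Cint Im_Cint.
rewrite mulr_natl mulr2n; apply: lerD.
  rewrite (le_trans (le_normr_Rintegral mD fr)) //; apply: le_Rintegral => //.
    exact: integrable_norm.
  by move=> t /fb; apply: le_trans; exact: normcRe.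
rewrite (le_trans (le_normr_Rintegral mD fi)) //; apply: le_Rintegral => //.
  exact: integrable_norm.
by move=> t /fb; apply: le_trans; exact: normcIm.
Qed.

Lemma normc_Cint_mul f g (M : R) : cintegrable mu D f -> cmeas D g ->
  (forall t, D t -> N (g t) <= M) ->
  N (Cint mu D (fun t => g t * f t)) <= M * (2 * \int[mu]_(t in D) N (f t)).
Proof.
move=> fi mg gM; have ni := cintegrable_norm fi.
have -> : M * (2 * \int[mu]_(t in D) N (f t)) = 2 * \int[mu]_(t in D) (M * N (f t)).
  by rewrite RintegralZl // mulrCA.
apply: normc_Cint; first exact: (cintegrable_mulb fi mg gM).
  exact: (eq_integrable mD _ _ _ (integrableZl mD M ni)).
by move=> t Dt; rewrite normc_M ler_wpM2r ?normc_ge0 ?gM.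
Qed.

Lemma normc_Cint_bound f (M : R) : (mu D < +oo)%E -> cmeas D f ->
  (forall t, D t -> N (f t) <= M) -> N (Cint mu D f) <= 2 * (M * fine (mu D)).
Proof.
move=> Doo mf fM; rewrite -Rintegral_cst //; apply: normc_Cint => //.
  exact: cintegrable_bounded fM.
by apply: measurable_bounded_integrable => //; exact: (@bounded_onP _ _ `|M|).
Qed.

End Fixed.

Lemma cintE mu f : cint mu f = Cint mu circ f. Proof. by []. Qed.

Lemma measurable_circ : measurable (circ : set TR).
Proof. exact: measurable_itv. Qed.

Lemma pi2_gt0 : 0 < pi *+ 2 :> R.
Proof. by rewrite mulrn_wgt0 // pi_gt0. Qed.

Lemma leb_itv (a b : R) : a <= b -> (leb (`[a, b[%classic : set TR) = (b - a)%:E)%E.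
Proof.
move=> ab; have := @lebesgue_measure_itv R `[a, b[; rewrite /= lte_fin => E.
rewrite [LHS]E; case: ltP => // ba; by rewrite (@le_anti _ _ a b) ?ab // subrr.
Qed.

Lemma leb_circ : (leb (circ : set TR) = (pi *+ 2)%:E)%E.
Proof. by rewrite leb_itv ?subr0 // ltW // pi2_gt0. Qed.

Lemma fine_leb_circ : fine (leb (circ : set TR)) = pi *+ 2.
Proof. by rewrite leb_circ. Qed.

Lemma leb_circ_lty : (leb (circ : set TR) < +oo)%E.
Proof. by rewrite leb_circ ltry. Qed.

End ComplexIntegral.

(** * Cauchy theory on discs and annuli *)

Section Goursat.
Context {R : realType}.
Local Notation C := R[i].
Local Notation TR := (measurableTypeR R).

Lemma is_derive_littleo (f : R -> R) (df : R) : is_derive (0 : R) (1 : R) f df ->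
  forall e : R, 0 < e -> exists2 d : R, 0 < d &
    forall x, `|x| < d -> `|f x - f 0 - df * x| <= e * `|x|.
Proof.
move=> [/cvg_ex[/= l fl] fE] e e0.
have {fE} lE : l = df by rewrite -fE; apply/esym/cvg_lim.
move: fl; rewrite lE => /cvgrPdist_lt /(_ e e0) /nbhs_ballP[d /= d0 Hd].
exists d => // x xd; have [->|x0] := eqVneq x 0.
  by rewrite subrr mulr0 subr0 normr0 mulr0.
have := Hd x; rewrite -ball_normE /ball_ /= sub0r normrN => /(_ xd x0).
rewrite scaler1 addr0 /GRing.scale /= => /ltW H.
have -> : f x - f 0 - df * x = - (df - x^-1 * (f x - f 0)) * x by field.
by rewrite normrM normrN ler_wpM2r.
Qed.

Lemma cexp_littleo (e : R) : 0 < e -> exists2 d : R, 0 < d &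
  forall h : C, N h < d -> N (cexp h - 1 - h) <= e * N h.
Proof.
move=> e0; have e8 : 0 < Num.min (e / 16) 1 by rewrite lt_min divr_gt0 ?ltr01.
have [d1 d10 H1] := is_derive_littleo (is_derive_expR 0) e8.
have [d2 d20 H2] := is_derive_littleo (is_derive_cos 0) e8.
have [d3 d30 H3] := is_derive_littleo (is_derive_sin 0) e8.
exists (Num.min (Num.min d1 d2) (Num.min d3 (Num.min (e / 16) 1))).
  by rewrite !lt_min d10 d20 d30 divr_gt0 //=.
move=> h; rewrite !lt_min => /andP[/andP[h1 h2] /andP[h3 /andP[h4 h5]]].
have := H1 (Re h) (le_lt_trans (normcRe h) h1).
have := H2 (Im h) (le_lt_trans (normcIm h) h2).
have := H3 (Im h) (le_lt_trans (normcIm h) h3).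
rewrite expR0 cos0 sin0 oppr0 mul0r !mul1r ?subr0 ?addr0 {H1 H2 H3}.
move: (normcRe h) (normcIm h) h4 h5.
set x := Re h; set y := Im h; set n := N h; set m := Num.min _ _ => xn yn n8 n1 s c ex.
have m8 : m <= e / 16 by rewrite ge_min lexx.
have m1 : m <= 1 by rewrite ge_min lexx orbT.
have m0 : 0 < m by [].
have {}s : `|sin y - y| <= m * n by rewrite (le_trans s) // ler_wpM2l // ltW.
have {}c : `|cos y - 1| <= m * n by rewrite (le_trans c) // ler_wpM2l // ltW.
have {}ex : `|expR x - 1 - x| <= m * n by rewrite (le_trans ex) // ler_wpM2l // ltW.
have n0 : 0 <= n by rewrite normc_ge0.
have -> : cexp h - 1 - h = (expR x - 1 - x)%:C%C
    + (expR x)%:C%C * ((cos y - 1)%:C%C + 'i%C * (sin y - y)%:C%C)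
    + (expR x - 1)%:C%C * ('i%C * y%:C%C).
  by apply: complex_ext; rewrite ?(cReD, cImD, cReM, cImM, cReN, cImN) /= -/x -/y; ring.
have i1 := @normc_i R.
have ex1 : `|expR x - 1| <= 2 * n.
  have -> : expR x - 1 = (expR x - 1 - x) + x by ring.
  rewrite (le_trans (ler_normD _ _)) // mulr_natl mulr2n lerD //.
  by rewrite (le_trans ex) // ler_piMl.
have ex3 : expR x <= 3.
  have := ler_norm (expR x - 1); lra.
rewrite (le_trans (normc_D _ _)) // (le_trans (lerD (normc_D _ _) (lexx _))) //.
rewrite !normc_M i1 !normc_real mul1r (ger0_norm (expR_ge0 x)).
have A1 : N ((cos y - 1)%:C%C + 'i%C * (sin y - y)%:C%C) <= 2 * (m * n).
  rewrite (le_trans (normc_D _ _)) // normc_M i1 !normc_real mul1r mulr_natl mulr2n.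
  by rewrite lerD.
have A2 : expR x * N ((cos y - 1)%:C%C + 'i%C * (sin y - y)%:C%C) <= 3 * (2 * (m * n)).
  by rewrite ler_pM ?expR_ge0 ?normc_ge0.
have A3 : `|expR x - 1| * `|y| <= 2 * n * n by rewrite ler_pM.
have A4 : m * n <= e / 16 * n by rewrite ler_wpM2r.
have A5 : n * n <= e / 16 * n by rewrite ler_wpM2r // ltW.
have en : 0 <= e * n by rewrite mulr_ge0 // ltW.
rewrite (le_trans (lerD (lerD ex A2) A3)) //; lra.
Qed.

Lemma cexp_quotient (z : C) : exists phi : C -> C,
  [/\ ccont phi z, phi z = cexp z & forall y, cexp y = cexp z + (y - z) * phi y].
Proof.
exists (fun y => cexp z * (if y == z then 1 else (cexp (y - z) - 1) / (y - z))).
split; first last.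
- move=> y; case: eqVneq => [->|yz]; first by rewrite subrr mul0r addr0.
  have yz0 : y - z != 0 by rewrite subr_eq0.
  have -> : cexp y = cexp z * cexp (y - z) by rewrite -cexpD addrC subrK.
  by field.
- by rewrite eqxx mulr1.
apply: (ccontM (ccont_cst _ _)); apply/ccontP => e e0; rewrite eqxx.
have e2 : 0 < e / 2 by rewrite divr_gt0.
have [d d0 Hd] := cexp_littleo e2; exists d => // y yz.
case: eqVneq => [_|yz0]; first by rewrite subrr normc_0.
have yz1 : y - z != 0 by rewrite subr_eq0.
have -> : (cexp (y - z) - 1) / (y - z) - 1 = (cexp (y - z) - 1 - (y - z)) / (y - z) by field.
rewrite normc_M normc_V ltr_pdivrMr ?normc_gt0 //.
rewrite (le_lt_trans (Hd _ yz)) // ltr_pM2r ?normc_gt0 //; lra.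
Qed.

Lemma cdiff_cexp (z : C) : cdiff cexp z.
Proof.
have [phi [pc _ pE]] := cexp_quotient z.
by apply/cdiffP; exists phi; split => //; exists 1.
Qed.

Lemma near_circle (r0 : R) (Q : R -> R -> Prop) :
  (forall t, 0 <= t <= pi *+ 2 -> exists2 d : R, 0 < d &
     forall r t', `|r - r0| < d -> `|t' - t| < d -> Q r t') ->
  exists2 d : R, 0 < d & forall r t, `|r - r0| < d -> 0 <= t <= pi *+ 2 -> Q r t.
Proof.
move=> H.
have /compact_near_coveringP K : compact (`[0, pi *+ 2]%classic : set R).
  exact: segment_compact.
have /nbhs_ballP[d /= d0 Hd] : \forall r \near r0, (`[0, pi *+ 2]%classic : set R) `<=` Q r.
  apply: (K _ (nbhs r0)) => t; rewrite /= in_itv /= => /H[d d0 Hd].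
  exists (ball t d, ball r0 d); first by split; exact: nbhsx_ballx.
  move=> [t' r] /= [tt' rr]; apply: Hd.
    by move: rr; rewrite -ball_normE /ball_ /= distrC.
  by move: tt'; rewrite -ball_normE /ball_ /= distrC.
exists d => // r t rr0 tt; apply: Hd; last by rewrite /= in_itv.
by rewrite -ball_normE /ball_ /= distrC.
Qed.

Lemma eit_lipschitz_near (t : R) (e : R) : 0 < e -> exists2 d : R, 0 < d &
  forall t', `|t' - t| < d -> N (eit t' - eit t : C) < e.
Proof.
move=> e0; have /ccvgP/(_ e e0)/nbhs_ballP[d /= d0 Hd] := @continuous_eit R t.
exists d => // t' tt'; apply: Hd; rewrite -ball_normE /ball_ /= distrC //.
Qed.

Lemma near_circleC (r0 t : R) (e : R) : 0 < e -> exists2 d : R, 0 < d &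
  forall r t', `|r - r0| < d -> `|t' - t| < d ->
    N (r%:C%C * eit t' - r0%:C%C * eit t : C) < e.
Proof.
move=> e0; have e2 : 0 < e / (2 * (`|r0| + 1)) by rewrite divr_gt0 // mulr_gt0 // ltr_wpDl.
have [d d0 Hd] := eit_lipschitz_near t e2.
exists (Num.min d (e / 2)); first by rewrite lt_min d0 divr_gt0.
move=> r t'; rewrite !lt_min => /andP[_ r2] /andP[t1 _].
have -> : r%:C%C * eit t' - r0%:C%C * eit t =
   (r - r0)%:C%C * eit t' + r0%:C%C * (eit t' - eit t) :> C by rewrite realCB; ring.
rewrite (le_lt_trans (normc_D _ _)) // !normc_M normc_eit !normc_real mulr1.
have : `|r0| * N (eit t' - eit t : C) <= e / 2.
  have : (`|r0| + 1) * N (eit t' - eit t : C) <= (`|r0| + 1) * (e / (2 * (`|r0| + 1))).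
    by rewrite ler_wpM2l ?addr_ge0 // ltW // Hd.
  have -> : (`|r0| + 1) * (e / (2 * (`|r0| + 1))) = e / 2.
    by field; rewrite gt_eqF // ltr_wpDl.
  by apply: le_trans; rewrite ler_wpM2r ?normc_ge0 // lerDl.
lra.
Qed.

Lemma circle_unif (phi : C -> C) (r0 : R) :
  (forall t, ccont phi (r0%:C%C * eit t)) ->
  forall e : R, 0 < e -> exists2 d : R, 0 < d &
    forall r t, `|r - r0| < d -> 0 <= t <= pi *+ 2 ->
      N (phi (r%:C%C * eit t) - phi (r0%:C%C * eit t)) < e.
Proof.
move=> pc e e0; apply: near_circle => t _.
have e2 : 0 < e / 2 by rewrite divr_gt0.
have /ccontP/(_ _ e2)[d1 d10 H1] := pc t.
have [d d0 Hd] := near_circleC r0 t d10.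
exists d => // r t' rr tt.
have A := H1 _ (Hd _ _ rr tt).
have B := H1 _ (Hd r0 _ _ tt); rewrite subrr normr0 in B; have {}B := B d0.
have -> : phi (r%:C%C * eit t') - phi (r0%:C%C * eit t') =
  (phi (r%:C%C * eit t') - phi (r0%:C%C * eit t)) - (phi (r0%:C%C * eit t') - phi (r0%:C%C * eit t)).
  by ring.
rewrite (le_lt_trans (normc_B _ _)) //; lra.
Qed.

Lemma near_circle_pred (P : C -> Prop) (r0 : R) :
  (forall t, exists2 e : R, 0 < e & forall z, N (z - r0%:C%C * eit t) < e -> P z) ->
  exists2 d : R, 0 < d & forall r t, `|r - r0| < d -> 0 <= t <= pi *+ 2 -> P (r%:C%C * eit t).
Proof.
move=> H; apply: near_circle => t _; have [e e0 He] := H t.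
have [d d0 Hd] := near_circleC r0 t e0.
by exists d => // r t' rr tt; apply: He; exact: Hd.
Qed.

Lemma circ_itv (t : R) : circ t -> 0 <= t <= pi *+ 2.
Proof. by rewrite /circ /= in_itv /= => /andP[-> /ltW]. Qed.

Lemma continuous_cpoly (r : R) (t : R) :
  {for t, continuous ((fun t => r%:C%C * eit t) : R -> C^o)}.
Proof.
apply: (@ccvgM R R (nbhs t) _ (fun=> r%:C%C) eit); first exact: cvg_cst.
exact: continuous_eit.
Qed.

Lemma cmeas_circle (phi : C -> C) (r : R) :
  (forall t, ccont phi (r%:C%C * eit t)) ->
  cmeas (circ : set TR) (fun t => phi (r%:C%C * eit t)).
Proof.
move=> pc; apply: cmeas_cont; first exact: measurable_circ.
move=> t _; have [pct] := pc t; move=> A /pct; exact: (continuous_cpoly (t := t)).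
Qed.

Lemma eit_mod (t : R) : exists2 t', 0 <= t' <= pi *+ 2 & eit t = eit t' :> C.
Proof.
have [t' [t't E]] := polar (eit t : C); exists t' => //.
by rewrite normc_eit mul1r in E.
Qed.

Lemma circle_bounded (phi : C -> C) (r : R) :
  (forall t, ccont phi (r%:C%C * eit t)) ->
  exists2 M : R, 0 < M & forall t, N (phi (r%:C%C * eit t)) <= M.
Proof.
move=> pc.
have [d d0 H] : exists2 d : R, 0 < d & forall x t, `|x - 0| < d -> 0 <= t <= pi *+ 2 ->
    x * N (phi (r%:C%C * eit t)) < 1.
  apply: near_circle => t _; have /ccontP/(_ 1 ltr01)[d1 d10 H1] := pc t.
  have [d d0 Hd] := near_circleC r t d10.
  pose b := N (phi (r%:C%C * eit t)) + 1.
  have b0 : 0 < b by rewrite ltr_wpDl ?normc_ge0.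
  exists (Num.min d b^-1); first by rewrite lt_min d0 invr_gt0.
  move=> x t'; rewrite subr0 !lt_min => /andP[_ xb] /andP[tt _].
  have := H1 _ (Hd r t' _ tt); rewrite subrr normr0 => /(_ d0) A.
  have B : N (phi (r%:C%C * eit t')) < b.
    have := normc_lB (phi (r%:C%C * eit t')) (phi (r%:C%C * eit t)); rewrite /b; lra.
  rewrite (le_lt_trans (ler_norm _)) // normrM [`|N _|]ger0_norm ?normc_ge0 //.
  have [x0|x0] := eqVneq `|x| 0; first by rewrite x0 mul0r ltr01.
  have x1 : 0 < `|x| by rewrite lt_def x0 /=.
  have : `|x| * N (phi (r%:C%C * eit t')) < `|x| * b by rewrite ltr_pM2l.
  have : `|x| * b < b^-1 * b by rewrite ltr_pM2r.
  rewrite mulVf ?gt_eqF //; lra.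
exists (d / 2)^-1; first by rewrite invr_gt0 divr_gt0.
move=> t; have [t' tt' ->] := eit_mod t.
have d2 : 0 < d / 2 by rewrite divr_gt0.
have A : d / 2 * N (phi (r%:C%C * eit t')) < 1.
  by apply: H => //; rewrite subr0 ger0_norm; lra.
by rewrite -(ler_pM2l d2) divff ?gt_eqF // ltW.
Qed.

Lemma cintegrable_circle (phi : C -> C) (r : R) :
  (forall t, ccont phi (r%:C%C * eit t)) ->
  cintegrable leb (circ : set TR) (fun t => phi (r%:C%C * eit t)).
Proof.
move=> pc; have [M _ HM] := circle_bounded pc.
apply: (@cintegrable_bounded _ leb circ (@measurable_circ R) _ M) => //.
- exact: leb_circ_lty.
- exact: cmeas_circle.
Qed.

Definition cmean (phi : C -> C) (r : R) : C :=
  Cint leb (circ : set TR) (fun t => phi (r%:C%C * eit t)).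

Lemma cmean_cont (phi : C -> C) (r0 : R) (a : R) : 0 < a ->
  (forall r t, `|r - r0| < a -> ccont phi (r%:C%C * eit t)) ->
  forall e : R, 0 < e -> exists2 d : R, 0 < d &
    forall r, `|r - r0| < d -> N (cmean phi r - cmean phi r0) < e.
Proof.
move=> a0 pc e e0.
have pc0 t : ccont phi (r0%:C%C * eit t) by apply: pc; rewrite subrr normr0.
have e8 : 0 < e / (4 * (pi *+ 2)) by rewrite divr_gt0 // mulr_gt0 // pi2_gt0.
have [d d0 Hd] := circle_unif pc0 e8.
exists (Num.min d a); first by rewrite lt_min d0.
move=> r; rewrite lt_min => /andP[rd ra].
rewrite /cmean -CintB; [|exact: measurable_circ|by apply: cintegrable_circle => t; exact: pc|exact: cintegrable_circle].
have := @normc_Cint_bound _ leb (circ : set TR) (@measurable_circ R)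
  (fun t => phi (r%:C%C * eit t) - phi (r0%:C%C * eit t)) (e / (4 * (pi *+ 2))) (@leb_circ_lty R).
rewrite fine_leb_circ.
have -> : 2 * (e / (4 * (pi *+ 2)) * (pi *+ 2)) = e / 2.
  by have := @pi2_gt0 R; move: (pi *+ 2) => p p0; field; rewrite gt_eqF.
move=> H; apply: (le_lt_trans (H _ _)); last by lra.
  by apply: cmeasB; apply: cmeas_circle => // t; exact: pc.
by move=> t /circ_itv tt; rewrite ltW // Hd.
Qed.

End Goursat.

Section Rectangles.
Context {R : realType}.
Local Notation C := R[i].
Local Notation TR := (measurableTypeR R).
Implicit Types (psi : C -> C) (x y t : R).

Definition pt (x y : R) : C := (x +i* y)%C.

Lemma ptB (x y x' y' : R) : N (pt x' y' - pt x y) <= `|x' - x| + `|y' - y|.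
Proof. exact: normc_ReIm. Qed.

Lemma cont_pt_l psi x y : ccont psi (pt x y) ->
  {for x, continuous ((fun x => psi (pt x y)) : R -> C^o)}.
Proof.
move=> pc; apply/ccvgP => e e0; have /ccontP/(_ e e0)[d d0 H] := pc.
apply/nbhs_ballP; exists d => // x' /=; rewrite distrC => xx.
by apply: H; rewrite (le_lt_trans (ptB _ _ _ _)) // subrr normr0 addr0.
Qed.

Lemma cont_pt_r psi x y : ccont psi (pt x y) ->
  {for y, continuous ((fun y => psi (pt x y)) : R -> C^o)}.
Proof.
move=> pc; apply/ccvgP => e e0; have /ccontP/(_ e e0)[d d0 H] := pc.
apply/nbhs_ballP; exists d => // x' /=; rewrite distrC => xx.
by apply: H; rewrite (le_lt_trans (ptB _ _ _ _)) // subrr normr0 add0r.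
Qed.

Lemma cintegrable_itv (f : R -> C) (a b : R) :
  (forall t, a <= t <= b -> {for t, continuous (f : R -> C^o)}) ->
  cintegrable leb (`[a, b[%classic : set TR) f.
Proof.
move=> fc.
have H (h : R -> R) : (forall t, a <= t <= b -> {for t, continuous h}) ->
    leb.-integrable (`[a, b[%classic : set TR) (EFin \o h).
  move=> hc; apply: (@integrableS _ _ _ _ (`[a, b]%classic : set TR)) => //.
    by move=> t /=; rewrite !in_itv /= => /andP[-> /ltW].
  apply: continuous_compact_integrable; first exact: segment_compact.
  by apply: continuous_in_subspaceT => t /[!inE] /=; rewrite in_itv => /hc.
by split; apply: H => t /fc /ccvg_ReIm[].
Qed.

Lemma Cint_itv_split (f : R -> C) (a b c : R) : a <= b -> b <= c ->
  cintegrable leb (`[a, c[%classic : set TR) f ->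
  Cint leb (`[a, c[%classic : set TR) f =
  Cint leb (`[a, b[%classic : set TR) f + Cint leb (`[b, c[%classic : set TR) f.
Proof.
move=> ab bc [fr fi].
have U : (`[a, c[%classic : set TR) = `[a, b[%classic `|` `[b, c[%classic.
  apply/seteqP; split => t /=; rewrite !in_itv /=.
    by move=> /andP[at_ tc]; case: (ltP t b) => tb; [left; rewrite at_|right; rewrite tc].
  by move=> [/andP[-> /lt_le_trans ->]|/andP[/(le_trans ab) -> ->]].
have dis : [disjoint (`[a, b[%classic : set TR) & (`[b, c[%classic : set TR)].
  apply/disj_setPS => t /= []; rewrite !in_itv /= => /andP[_ tb] /andP[bt _].
  by move: (lt_le_trans tb bt); rewrite ltxx.
rewrite U in fr fi *.
apply: complex_ext.
  by rewrite [RHS]cReD !Re_Cint Rintegral_setU.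
by rewrite [RHS]cImD !Im_Cint Rintegral_setU.
Qed.

Lemma Cint_near_cst (f : R -> C) (a b M : R) (c : C) : a <= b ->
  cintegrable leb (`[a, b[%classic : set TR) f ->
  (forall t, a <= t <= b -> N (f t - c) <= M) ->
  N (Cint leb (`[a, b[%classic : set TR) f - c * (b - a)%:C%C) <= 2 * (M * (b - a)).
Proof.
move=> ab fi fM; have mI : measurable (`[a, b[%classic : set TR) by exact: measurable_itv.
have fin : (leb (`[a, b[%classic : set TR) < +oo)%E by rewrite leb_itv // ltry.
have ci : cintegrable leb (`[a, b[%classic : set TR) (fun=> c).
  by apply: (@cintegrable_bounded _ leb _ mI _ (N c)) => //; exact: cmeas_cst.
have := @Cint_cst _ leb _ mI c; rewrite leb_itv //= => <-.
rewrite -CintB //.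
have -> : b - a = fine (leb (`[a, b[%classic : set TR)) by rewrite leb_itv.
apply: normc_Cint_bound => //; first exact: cintegrable_meas (cintegrableB mI fi ci).
by move=> t /=; rewrite in_itv /= => /andP[at_ /ltW tb]; rewrite fM // at_.
Qed.

(* The integral of [psi] over the positively oriented boundary of [x,x'] x [y,y'],
   opposite sides being combined under one integral sign. *)
Definition bd psi x y x' y' : C :=
  Cint leb (`[x, x'[%classic : set TR) (fun s => psi (pt s y) - psi (pt s y')) +
  'i%C * Cint leb (`[y, y'[%classic : set TR) (fun t => psi (pt x' t) - psi (pt x t)).

Definition cont_rect psi x y x' y' :=
  forall s t, x <= s <= x' -> y <= t <= y' -> ccont psi (pt s t).

Lemma bd_int1 psi x y x' y' : y <= y' -> cont_rect psi x y x' y' ->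
  cintegrable leb (`[x, x'[%classic : set TR) (fun s => psi (pt s y) - psi (pt s y')).
Proof.
move=> yy pc; apply: cintegrable_itv => s sx.
apply: (@ccvgB R R (nbhs s) _ (fun s => psi (pt s y)) (fun s => psi (pt s y'))).
  by apply: cont_pt_l; apply: pc => //; rewrite lexx.
by apply: cont_pt_l; apply: pc => //; rewrite lexx yy.
Qed.

Lemma bd_int2 psi x y x' y' : x <= x' -> cont_rect psi x y x' y' ->
  cintegrable leb (`[y, y'[%classic : set TR) (fun t => psi (pt x' t) - psi (pt x t)).
Proof.
move=> xx pc; apply: cintegrable_itv => s sx.
apply: (@ccvgB R R (nbhs s) _ (fun s => psi (pt x' s)) (fun s => psi (pt x s))).
  by apply: cont_pt_r; apply: pc => //; rewrite lexx ?xx.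
by apply: cont_pt_r; apply: pc => //; rewrite lexx ?xx.
Qed.

Lemma bd_split_x psi x y x1 x' y' : x <= x1 -> x1 <= x' -> y <= y' ->
  cont_rect psi x y x' y' -> bd psi x y x' y' = bd psi x y x1 y' + bd psi x1 y x' y'.
Proof.
move=> xx1 x1x' yy pc; rewrite /bd (Cint_itv_split xx1 x1x'); last exact: bd_int1.
have pc1 : cont_rect psi x y x1 y'.
  by move=> s t /andP[xs sx] ty; apply: pc; rewrite ?xs // (le_trans sx).
have pc2 : cont_rect psi x1 y x' y'.
  by move=> s t /andP[xs sx] ty; apply: pc; rewrite ?sx ?andbT // (le_trans xx1).
have mI : measurable (`[y, y'[%classic : set TR) by exact: measurable_itv.
rewrite (@Cint_ext _ leb (`[y, y'[%classic : set TR) (fun t => psi (pt x' t) - psi (pt x t))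
  (fun t => (psi (pt x1 t) - psi (pt x t)) + (psi (pt x' t) - psi (pt x1 t)))); last first.
  by move=> t _; ring.
rewrite (CintD mI (bd_int2 xx1 pc1) (bd_int2 x1x' pc2)); ring.
Qed.

Lemma bd_split_y psi x y y1 x' y' : x <= x' -> y <= y1 -> y1 <= y' ->
  cont_rect psi x y x' y' -> bd psi x y x' y' = bd psi x y x' y1 + bd psi x y1 x' y'.
Proof.
move=> xx yy1 y1y' pc; rewrite /bd (Cint_itv_split yy1 y1y'); last exact: bd_int2.
have pc1 : cont_rect psi x y x' y1.
  by move=> s t xs /andP[sx ty]; apply: pc; rewrite ?sx // (le_trans ty).
have pc2 : cont_rect psi x y1 x' y'.
  by move=> s t xs /andP[sx ty]; apply: pc; rewrite ?ty ?andbT // (le_trans yy1).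
have mI : measurable (`[x, x'[%classic : set TR) by exact: measurable_itv.
rewrite (@Cint_ext _ leb (`[x, x'[%classic : set TR) (fun t => psi (pt t y) - psi (pt t y'))
  (fun t => (psi (pt t y) - psi (pt t y1)) + (psi (pt t y1) - psi (pt t y')))); last first.
  by move=> t _; ring.
rewrite (CintD mI (bd_int1 yy1 pc1) (bd_int1 y1y' pc2)); ring.
Qed.

Lemma bd_affine psi x y x' y' (p c d : C) (M : R) : x <= x' -> y <= y' ->
  cont_rect psi x y x' y' ->
  (forall s t, x <= s <= x' -> y <= t <= y' ->
     N (psi (pt s t) - (c + d * (pt s t - p))) <= M) ->
  N (bd psi x y x' y') <= 4 * M * ((x' - x) + (y' - y)).
Proof.
move=> xx yy pc H.
have A := @Cint_near_cst _ _ _ (2 * M) (d * (pt 0 (y - y'))) xx (bd_int1 yy pc).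
have B := @Cint_near_cst _ _ _ (2 * M) (d * (pt (x' - x) 0)) yy (bd_int2 xx pc).
have {}A : N (Cint leb (`[x, x'[%classic : set TR) (fun s => psi (pt s y) - psi (pt s y'))
   - d * pt 0 (y - y') * (x' - x)%:C%C) <= 2 * (2 * M * (x' - x)).
  apply: A => t tx.
  have -> : psi (pt t y) - psi (pt t y') - d * pt 0 (y - y') =
     (psi (pt t y) - (c + d * (pt t y - p))) - (psi (pt t y') - (c + d * (pt t y' - p))).
    have -> : pt 0 (y - y') = pt t y - pt t y' by apply: complex_ext; rewrite ?cReB ?cImB //= subrr.
    ring.
  by rewrite (le_trans (normc_B _ _)) // mulr_natl mulr2n lerD // H // lexx ?yy.
have {}B : N (Cint leb (`[y, y'[%classic : set TR) (fun t => psi (pt x' t) - psi (pt x t))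
   - d * pt (x' - x) 0 * (y' - y)%:C%C) <= 2 * (2 * M * (y' - y)).
  apply: B => t ty.
  have -> : psi (pt x' t) - psi (pt x t) - d * pt (x' - x) 0 =
     (psi (pt x' t) - (c + d * (pt x' t - p))) - (psi (pt x t) - (c + d * (pt x t - p))).
    have -> : pt (x' - x) 0 = pt x' t - pt x t by apply: complex_ext; rewrite ?cReB ?cImB //= subrr.
    ring.
  by rewrite (le_trans (normc_B _ _)) // mulr_natl mulr2n lerD // H // lexx ?xx.
move: A B; rewrite /bd; set I1 := Cint _ _ _; set I2 := Cint _ _ _ => A B.
have i1 := @normc_i R.
have -> : I1 + 'i%C * I2 = (I1 - d * pt 0 (y - y') * (x' - x)%:C%C) +
    'i%C * (I2 - d * pt (x' - x) 0 * (y' - y)%:C%C).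
  have : pt 0 (y - y') * (x' - x)%:C%C = - ('i%C * (pt (x' - x) 0 * (y' - y)%:C%C)).
    by apply: complex_ext; rewrite ?(cReN, cImN, cReM, cImM) /=; ring.
  by move: (pt 0 _) (pt _ 0) => u v uv; rewrite -!mulrA uv; ring.
rewrite (le_trans (normc_D _ _)) // normc_M i1 mul1r; lra.
Qed.

End Rectangles.

Section GoursatTheorem.
Context {R : realType}.
Local Notation C := R[i].
Local Notation TR := (measurableTypeR R).
Implicit Types (psi : C -> C) (x y t : R).

Lemma nested_point (x l : nat -> R) :
  (forall n, 0 <= l n) ->
  (forall n, x n <= x n.+1) -> (forall n, x n.+1 + l n.+1 <= x n + l n) ->
  exists X, forall n, x n <= X <= x n + l n.
Proof.
move=> l0 xinc rdec.
have mono n k : x n <= x (n + k)%N.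
  by elim: k => [|k IH]; rewrite ?addn0 // addnS (le_trans IH).
have rmono n k : x (n + k)%N + l (n + k)%N <= x n + l n.
  by elim: k => [|k IH]; rewrite ?addn0 // addnS (le_trans (rdec _)).
have ub n m : x m <= x n + l n.
  have [nm|/ltnW mn] := leqP n m.
    by rewrite (le_trans _ (rmono n (m - n)%N)) // subnKC // lerDl.
  by rewrite (le_trans (mono m (n - m)%N)) // subnKC // lerDl.
exists (sup (range x)) => n; apply/andP; split.
  apply: ub_le_sup; last by exists n.
  by exists (x n + l n) => _ [m _ <-].
by apply: ge_sup; [exists (x 0%N); exists 0%N|move=> _ [m _ <-]].
Qed.

Lemma itv_dist (a l s x : R) : a <= s <= a + l -> a <= x <= a + l -> `|x - s| <= l.
Proof. by move=> /andP[? ?] /andP[? ?]; rewrite ler_norml; lra. Qed.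

Theorem goursat_rect psi (x0 y0 hx hy : R) : 0 < hx -> 0 < hy ->
  (forall s t, x0 <= s <= x0 + hx -> y0 <= t <= y0 + hy -> cdiff psi (pt s t)) ->
  bd psi x0 y0 (x0 + hx) (y0 + hy) = 0.
Proof.
move=> hx0 hy0 dpsi; apply/eqP; rewrite -normc_eq0; apply/eqP/le_anti.
rewrite normc_ge0 andbT leNgt; apply/negP => c0.
set c := N _ in c0.
pose lx n := hx / 2 ^+ n; pose ly n := hy / 2 ^+ n.
have lx0 n : 0 < lx n by rewrite divr_gt0 // exprn_gt0.
have ly0 n : 0 < ly n by rewrite divr_gt0 // exprn_gt0.
have lxS n : lx n = lx n.+1 + lx n.+1.
  by rewrite /lx exprS; field; rewrite expf_neq0.
have lyS n : ly n = ly n.+1 + ly n.+1.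
  by rewrite /ly exprS; field; rewrite expf_neq0.
pose bad n (p : R * R) := [/\ x0 <= p.1, p.1 + lx n <= x0 + hx, y0 <= p.2,
   p.2 + ly n <= y0 + hy & c / 4 ^+ n <= N (bd psi p.1 p.2 (p.1 + lx n) (p.2 + ly n))].
have step n p : bad n p -> exists q, bad n.+1 q /\
  [/\ p.1 <= q.1, q.1 + lx n.+1 <= p.1 + lx n, p.2 <= q.2 & q.2 + ly n.+1 <= p.2 + ly n].
  move: p => [x y] [/= xx xX yy yY B].
  rewrite /bad; have u0 := lx0 n.+1; have v0 := ly0 n.+1.
  rewrite (lxS n) in xX B; rewrite (lyS n) in yY B; rewrite (lxS n) (lyS n).
  move: (lx n.+1) (ly n.+1) u0 v0 xX yY B => u v u0 v0 xX yY B.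
  have pc : cont_rect psi x y (x + (u + u)) (y + (v + v)).
    move=> s t /andP[s1 s2] /andP[t1 t2]; apply/cdiff_cont/dpsi; lra.
  have pcl : cont_rect psi x y (x + u) (y + (v + v)).
    by move=> s t /andP[s1 s2] ty; apply: pc => //; lra.
  have pcr : cont_rect psi (x + u) y (x + (u + u)) (y + (v + v)).
    by move=> s t /andP[s1 s2] ty; apply: pc => //; lra.
  have E1 := @bd_split_x _ psi x y (x + u) (x + (u + u)) (y + (v + v)) ltac:(lra) ltac:(lra) ltac:(lra) pc.
  have E2 := @bd_split_y _ psi x y (y + v) (x + u) (y + (v + v)) ltac:(lra) ltac:(lra) ltac:(lra) pcl.
  have E3 := @bd_split_y _ psi (x + u) y (y + v) (x + (u + u)) (y + (v + v)) ltac:(lra) ltac:(lra) ltac:(lra) pcr.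
  rewrite E1 E2 E3 in B; clear E1 E2 E3 pc pcl pcr.
  have addu : x + u + u = x + (u + u) by rewrite addrA.
  have addv : y + v + v = y + (v + v) by rewrite addrA.
  have d0 : c / 4 ^+ n = 4 * (c / 4 ^+ n.+1) by rewrite exprS; field; rewrite expf_neq0.
  rewrite d0 in B.
  have ux : x <= x + u by rewrite lerDl ltW.
  have vy : y <= y + v by rewrite lerDl ltW.
  have uux : x + u <= x + (u + u) by rewrite -addu lerDl ltW.
  have vvy : y + v <= y + (v + v) by rewrite -addv lerDl ltW.
  have uX := le_trans uux xX; have vY := le_trans vvy yY.
  have xu := le_trans xx ux; have yv := le_trans yy vy.
  have [q1|q1] := leP (c / 4 ^+ n.+1) (N (bd psi x y (x + u) (y + v))).
    exists (x, y); rewrite /=.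
    exact: (conj (And5 xx uX yy vY q1) (And4 (lexx _) uux (lexx _) vvy)).
  have [q2|q2] := leP (c / 4 ^+ n.+1) (N (bd psi x (y + v) (x + u) (y + (v + v)))).
    exists (x, y + v); rewrite /= addv.
    exact: (conj (And5 xx uX yv yY q2) (And4 (lexx _) uux vy (lexx _))).
  have [q3|q3] := leP (c / 4 ^+ n.+1) (N (bd psi (x + u) y (x + (u + u)) (y + v))).
    exists (x + u, y); rewrite /= addu.
    exact: (conj (And5 xu xX yy vY q3) (And4 ux (lexx _) (lexx _) vvy)).
  have [q4|q4] := leP (c / 4 ^+ n.+1) (N (bd psi (x + u) (y + v) (x + (u + u)) (y + (v + v)))).
    exists (x + u, y + v); rewrite /= addu addv.
    exact: (conj (And5 xu xX yv yY q4) (And4 ux (lexx _) vy (lexx _))).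
  exfalso; move: B q1 q2 q3 q4.
  set b1 := bd _ _ _ _ _; set b2 := bd _ _ _ _ _; set b3 := bd _ _ _ _ _; set b4 := bd _ _ _ _ _.
  move: b1 b2 b3 b4 => b1 b2 b3 b4.
  clear -c; move: (c / 4 ^+ n.+1) => k.
  have := normc_D (b1 + b2) (b3 + b4); have := normc_D b1 b2; have := normc_D b3 b4; lra.
have bad0 : bad 0%N (x0, y0) by rewrite /bad /lx /ly !expr0 !divr1 /= !lexx.
pose T n := {p : R * R | bad n p}.
pose nxt n (p : T n) : T n.+1 :=
  exist _ (projT1 (cid (step n (sval p) (svalP p)))) (projT2 (cid (step n (sval p) (svalP p)))).1.
pose sq := fix sq n : T n := if n is m.+1 then nxt m (sq m) else exist _ (x0, y0) bad0.
have sqS n : [/\ (sval (sq n)).1 <= (sval (sq n.+1)).1,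
   (sval (sq n.+1)).1 + lx n.+1 <= (sval (sq n)).1 + lx n,
   (sval (sq n)).2 <= (sval (sq n.+1)).2 &
   (sval (sq n.+1)).2 + ly n.+1 <= (sval (sq n)).2 + ly n].
  exact: (projT2 (cid (step n (sval (sq n)) (svalP (sq n))))).2.
have [X HX] : exists X, forall n, (sval (sq n)).1 <= X <= (sval (sq n)).1 + lx n.
  by apply: nested_point => n; [exact: ltW|case: (sqS n)|case: (sqS n)].
have [Y HY] : exists Y, forall n, (sval (sq n)).2 <= Y <= (sval (sq n)).2 + ly n.
  by apply: nested_point => n; [exact: ltW|case: (sqS n)|case: (sqS n)].
have dXY : cdiff psi (pt X Y).
  have := HX 0%N; have := HY 0%N; rewrite /= /lx /ly !expr0 !divr1.
  by move=> HY0 HX0; exact: dpsi.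
move/cdiffP: dXY => [phi [phic [e1 e10 E1]]].
pose eta := c / (8 * ((hx + hy) * (hx + hy))).
have eta0 : 0 < eta by rewrite divr_gt0 // !mulr_gt0 // addr_gt0.
move/ccontP: phic => /(_ _ eta0) [e2 e20 E2].
have [n Hn] : exists n, (hx + hy) / 2 ^+ n < Num.min e1 e2.
  have m0 : 0 < Num.min e1 e2 by rewrite lt_min e10.
  have [n Hn] : exists n, (hx + hy) / Num.min e1 e2 < n%:R.
    exists (Num.bound ((hx + hy) / Num.min e1 e2)).
    by apply: archi_boundP; rewrite divr_ge0 ?ltW // addr_gt0.
  exists n; rewrite ltr_pdivrMr ?exprn_gt0 // mulrC -ltr_pdivrMr //.
  by rewrite (lt_le_trans Hn) // -natrX ler_nat ltnW // ltn_expl.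
have [b1 b2 b3 b4 bb] := svalP (sq n).
set p := sval (sq n) in b1 b2 b3 b4 bb.
have pX := HX n; have pY := HY n; rewrite -/p in pX pY.
have := @bd_affine _ psi p.1 p.2 (p.1 + lx n) (p.2 + ly n) (pt X Y) (psi (pt X Y)) (phi (pt X Y))
  (eta * (lx n + ly n)).
have hn : lx n + ly n = (hx + hy) / 2 ^+ n by rewrite mulrDl.
have P1 : p.1 <= p.1 + lx n by rewrite lerDl ltW.
have P2 : p.2 <= p.2 + ly n by rewrite lerDl ltW.
have P3 : cont_rect psi p.1 p.2 (p.1 + lx n) (p.2 + ly n).
  move=> s t /andP[s1 s2] /andP[t1 t2]; apply/cdiff_cont/dpsi; apply/andP; split.
  - exact: le_trans s1.
  - exact: le_trans b2.
  - exact: le_trans t1.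
  exact: le_trans b4.
move=> /(_ P1 P2 P3) H.
have {}H := H _.
have B : N (bd psi p.1 p.2 (p.1 + lx n) (p.2 + ly n)) <=
  4 * (eta * (lx n + ly n)) * ((p.1 + lx n - p.1) + (p.2 + ly n - p.2)).
  apply: H => s t sI tI.
  have dist : N (pt s t - pt X Y) <= lx n + ly n.
    by rewrite (le_trans (ptB _ _ _ _)) // lerD //; [exact: itv_dist pX _|exact: itv_dist pY _].
  have dlt : N (pt s t - pt X Y) < Num.min e1 e2 by rewrite (le_lt_trans dist) // hn.
  move: dlt; rewrite lt_min => /andP[d1 d2].
  rewrite E1 //.
  have -> : psi (pt X Y) + (pt s t - pt X Y) * phi (pt s t) -
    (psi (pt X Y) + phi (pt X Y) * (pt s t - pt X Y)) =
    (phi (pt s t) - phi (pt X Y)) * (pt s t - pt X Y) by ring.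
  rewrite normc_M ler_pM ?normc_ge0 //; exact/ltW/E2.
have := le_trans bb B.
have -> : (p.1 + lx n - p.1) + (p.2 + ly n - p.2) = lx n + ly n by ring.
have -> : 4 * (eta * (lx n + ly n)) * (lx n + ly n) = (c / 2) / 4 ^+ n.
  rewrite hn /eta; have -> : 4 ^+ n = 2 ^+ n * 2 ^+ n :> R by rewrite -exprMn -natrM.
  field; rewrite expf_neq0 //= gt_eqF // addr_gt0 //.
by rewrite ler_pM2r ?invr_gt0 ?exprn_gt0 // => cc; clear -c0 cc; lra.
Qed.

Lemma periodic_line psi (a b : R) (x x' : R) : a < x -> x < x' -> x' < b ->
  (forall z : C, a < Re z < b -> cdiff psi z) ->
  (forall s t, psi (pt s (t + pi *+ 2)) = psi (pt s t)) ->
  Cint leb (circ : set TR) (fun t => psi (pt x t)) = Cint leb (circ : set TR) (fun t => psi (pt x' t)).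
Proof.
move=> ax xx xb dpsi per; have hx : 0 < x' - x by rewrite subr_gt0.
have cd s t : x <= s <= x' -> cdiff psi (pt s t).
  by move=> /andP[s1 s2]; apply: dpsi; rewrite /=; lra.
have := @goursat_rect psi x 0 (x' - x) (pi *+ 2) hx (@pi2_gt0 R).
rewrite add0r [x + _]addrC subrK => /(_ (fun s t sx _ => cd s t sx)).
rewrite /bd (@Cint_ext _ leb _ _ (fun=> 0)); last first.
  by move=> s _; rewrite -[pi *+ 2]add0r per subrr.
have i0 : 'i%C != 0 :> C by rewrite -normc_eq0 normc_i oner_eq0.
rewrite Cint_cst ?mul0r ?add0r; last exact: measurable_itv.
move/eqP; rewrite mulf_eq0 (negbTE i0) /= CintB.
- by rewrite subr_eq0 => /eqP <-.
- exact: measurable_circ.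
- apply: cintegrable_itv => t _; apply: cont_pt_r; apply/cdiff_cont/cd; lra.
- apply: cintegrable_itv => t _; apply: cont_pt_r; apply/cdiff_cont/cd; lra.
Qed.

(* [phi (cexp s)] is analytic in a strip and 2 pi i periodic, so Goursat's theorem on a
   rectangle of height 2 pi equates the integrals over its two vertical sides. *)
Theorem cmean_const_annulus (phi : C -> C) (a b r r' : R) : 0 <= a ->
  a < r < b -> a < r' < b ->
  (forall z : C, a < N z < b -> cdiff phi z) -> cmean phi r = cmean phi r'.
Proof.
move=> a0; wlog rr : r r' / r < r'.
  move=> W; have [rr|rr|->//] := ltgtP r r'; first exact: W.
  by move=> H1 H2 H3; symmetry; exact: W.
move=> /andP[ar rb] /andP[ar' rb'] dphi.
have r0 : 0 < r by rewrite (le_lt_trans a0).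
have r'0 : 0 < r' by rewrite (lt_trans r0).
have [a' [aa' a'r a'0]] : exists a', [/\ a <= a', a' < r & 0 < a'].
  by exists ((a + r) / 2); split; lra.
have cE s t : cexp (pt s t) = (expR s)%:C%C * eit t by rewrite cexpE.
have := @periodic_line (fun z => phi (cexp z)) (ln a') (ln b) (ln r) (ln r').
have b0 : 0 < b by rewrite (lt_trans r'0).
rewrite (ltr_ln a'0 r0) (ltr_ln r0 r'0) (ltr_ln r'0 b0) => /(_ a'r rr rb') H.
have -> : cmean phi r = Cint leb (circ : set TR) (fun t => phi (cexp (pt (ln r) t))).
  by apply: Cint_ext => t _; rewrite cE lnK.
have -> : cmean phi r' = Cint leb (circ : set TR) (fun t => phi (cexp (pt (ln r') t))).
  by apply: Cint_ext => t _; rewrite cE lnK.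
apply: H => [z /andP[z1 z2]|s t].
  apply: cdiff_comp; first exact: cdiff_cexp.
  apply: dphi; rewrite normc_cexp; apply/andP; split.
    by rewrite (le_lt_trans aa') // -ltr_ln ?posrE ?expR_gt0 // expRK.
  by rewrite -ltr_ln ?posrE ?expR_gt0 ?expRK // (lt_trans r'0).
by rewrite !cE eitD eit2pi mulr1.
Qed.

End GoursatTheorem.

Section CauchyFormula.
Context {R : realType}.
Local Notation C := R[i].
Local Notation TR := (measurableTypeR R).
Implicit Types (f phi : C -> C) (z : C) (r b : R).

Definition twopi : C := (pi *+ 2 : R)%:C%C.

Lemma twopi_neq0 : twopi != 0.
Proof. by rewrite realC_eq0 gt_eqF // pi2_gt0. Qed.

Lemma normc_small (z : C) : (forall e : R, 0 < e -> N z < e) -> z = 0.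
Proof.
move=> H; apply/eqP; rewrite -normc_eq0; apply/eqP/le_anti; rewrite normc_ge0 andbT.
by rewrite leNgt; apply/negP => /[dup] /H; rewrite ltxx.
Qed.

Lemma limit_eq (F : R -> C) r0 (v : C) :
  (forall e : R, 0 < e -> exists2 d : R, 0 < d &
     forall r, `|r - r0| < d -> N (F r - F r0) < e) ->
  (forall d : R, 0 < d -> exists2 r, `|r - r0| < d & F r = v) -> F r0 = v.
Proof.
move=> Fc H; apply/eqP; rewrite -subr_eq0; apply/eqP/normc_small => e /Fc[d d0 Hd].
by have [r rd <-] := H d d0; rewrite normcBC Hd.
Qed.

Lemma cmean_cst (c : C) r : cmean (fun=> c) r = c * twopi.
Proof. by rewrite /cmean Cint_cst ?fine_leb_circ //; exact: measurable_circ. Qed.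

Lemma cmean0 phi : cmean phi 0 = phi 0 * twopi.
Proof.
rewrite -(cmean_cst (phi 0) 0) /cmean; apply: Cint_ext => t _.
by rewrite mul0r.
Qed.

Lemma normc_circle r t : N (r%:C%C * eit t : C) = `|r|.
Proof. by rewrite normc_M normc_eit mulr1 normc_real. Qed.

Lemma normc_circle_pos r t : 0 <= r -> N (r%:C%C * eit t : C) = r.
Proof. by move=> r0; rewrite normc_circle ger0_norm. Qed.

Lemma cmeanD f phi r : (forall t, ccont f (r%:C%C * eit t)) ->
  (forall t, ccont phi (r%:C%C * eit t)) ->
  cmean (fun z => f z + phi z) r = cmean f r + cmean phi r.
Proof.
move=> fc pc; rewrite /cmean CintD //; [exact: measurable_circ| |];
  exact: cintegrable_circle.
Qed.

Lemma cmeanB f phi r : (forall t, ccont f (r%:C%C * eit t)) ->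
  (forall t, ccont phi (r%:C%C * eit t)) ->
  cmean (fun z => f z - phi z) r = cmean f r - cmean phi r.
Proof.
move=> fc pc; rewrite /cmean CintB //; [exact: measurable_circ| |];
  exact: cintegrable_circle.
Qed.

Lemma cmeanZ (c : C) f r : (forall t, ccont f (r%:C%C * eit t)) ->
  cmean (fun z => c * f z) r = c * cmean f r.
Proof.
move=> fc; rewrite /cmean CintZ //; [exact: measurable_circ|].
exact: cintegrable_circle.
Qed.

Lemma cmean_ext f phi r : (forall t, f (r%:C%C * eit t) = phi (r%:C%C * eit t)) ->
  cmean f r = cmean phi r.
Proof. by move=> fp; apply: Cint_ext => t _. Qed.

Lemma cmean_const_except phi (a b rho : R) r r' : 0 <= a ->
  a < r < b -> a < r' < b ->
  (forall z : C, a < N z < b -> ccont phi z) ->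
  (forall z : C, a < N z < b -> N z != rho -> cdiff phi z) ->
  cmean phi r = cmean phi r'.
Proof.
move=> a0 rab r'ab pc pd.
have [rhoab|rhoab] := boolP (a < rho < b); last first.
  apply: (cmean_const_annulus a0 rab r'ab) => z zab; apply: pd => //.
  by apply: contra rhoab => /eqP <-.
have /andP[ar rb] := rhoab.
have cont : forall e : R, 0 < e -> exists2 d : R, 0 < d &
     forall r, `|r - rho| < d -> N (cmean phi r - cmean phi rho) < e.
  apply: (@cmean_cont _ _ _ (Num.min (rho - a) (b - rho))).
    by rewrite lt_min !subr_gt0 ar.
  move=> x t; rewrite lt_min !ltr_norml => /andP[/andP[x1 x2] /andP[x3 x4]].
  by apply: pc; rewrite normc_circle_pos; lra.
have key x : a < x < b -> cmean phi x = cmean phi rho.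
  move=> /andP[ax xb]; have [xr|xr|->//] := ltgtP x rho.
    symmetry; apply: (limit_eq cont) => d d0.
    pose y := Num.max x (rho - d / 2).
    have yr : y < rho by rewrite gt_max xr /=; lra.
    have ya : a < y by rewrite lt_max ax.
    have yd : rho - d / 2 <= y by rewrite le_max lexx orbT.
    exists y; first by rewrite ltr_norml; lra.
    apply: (@cmean_const_annulus _ _ a rho) => //; rewrite ?ya ?yr ?ax ?xr //.
    by move=> z /andP[z1 z2]; apply: pd; [rewrite z1 (lt_trans z2)|rewrite lt_eqF].
  symmetry; apply: (limit_eq cont) => d d0.
  pose y := Num.min x (rho + d / 2).
  have yr : rho < y by rewrite lt_min xr /=; lra.
  have ya : y < b by rewrite gt_min xb.
  have yd : y <= rho + d / 2 by rewrite ge_min lexx orbT.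
  exists y; first by rewrite ltr_norml; lra.
  apply: (@cmean_const_annulus _ _ rho b); rewrite ?ya ?yr ?xb ?xr //; first by rewrite ltW // (le_lt_trans a0).
  by move=> z /andP[z1 z2]; apply: pd; [rewrite z2 (lt_trans ar)|rewrite gt_eqF].
by rewrite (key r) // (key r').
Qed.

Lemma cmean_ball phi (b rho : R) r : 0 <= r < b ->
  (forall z : C, N z < b -> ccont phi z) ->
  (forall z : C, N z < b -> z != 0 -> N z != rho -> cdiff phi z) ->
  cmean phi r = phi 0 * twopi.
Proof.
move=> /andP[r0 rb] pc pd; rewrite -cmean0.
have [->//|rn0] := eqVneq r 0.
have {}r0 : 0 < r by rewrite lt_def rn0.
have b0 : 0 < b by rewrite (lt_trans r0).
symmetry; apply: limit_eq => [|d d0].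
  apply: (@cmean_cont _ _ _ b) => // x t; rewrite subr0 => xb.
  by apply: pc; rewrite normc_circle.
pose y := Num.min r (d / 2).
have y0 : 0 < y by rewrite lt_min r0 divr_gt0.
have yr : y <= r by rewrite ge_min lexx.
have yd : y <= d / 2 by rewrite ge_min lexx orbT.
exists y; first by rewrite subr0 ger0_norm; lra.
apply: (@cmean_const_except _ 0 b rho) => //.
- by rewrite y0 /= (le_lt_trans yr).
- by rewrite r0.
- by move=> z /andP[_ zb]; exact: pc.
- by move=> z /andP[z0 zb]; apply: pd => //; rewrite -normc_gt0.
Qed.

Lemma mean_value f (b : R) r : 0 <= r < b ->
  (forall z : C, N z < b -> cdiff f z) -> cmean f r = f 0 * twopi.
Proof.
move=> rb fd; apply: (@cmean_ball _ b (-1)) => // z zb; first exact/cdiff_cont/fd.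
by move=> _ _; exact: fd.
Qed.

Lemma circle_ne r t z : 0 <= r -> N z != r -> r%:C%C * eit t - z != 0.
Proof.
move=> r0; apply: contra; rewrite subr_eq0 => /eqP <-.
by rewrite normc_circle_pos.
Qed.

Lemma cdiff_subl z y : cdiff (fun y => y - z) y.
Proof. by apply: cdiffB; [exact: cdiff_id|exact: cdiff_cst]. Qed.

Lemma cmean_cauchy_kernel r z : N z < r -> cmean (fun y => y / (y - z)) r = twopi.
Proof.
move=> zr; have r0 : 0 < r by rewrite (le_lt_trans _ zr) // normc_ge0.
have rC : r%:C%C != 0 :> C by rewrite realC_eq0 gt_eqF.
pose phi y := (1 - (z^* / r%:C%C) * y)^-1.
pose b := (r *+ 2) / (r + N z).
have rz : 0 < r + N z by rewrite ltr_pwDl // normc_ge0.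
have b1 : 1 < b by rewrite ltr_pdivlMr // mul1r mulr2n ltrD2l.
have phid y : N y < b -> cdiff phi y.
  move=> yb; apply: cdiffV; last first.
    by apply: cdiffB; [exact: cdiff_cst|apply: cdiffM; [exact: cdiff_cst|exact: cdiff_id]].
  rewrite subr_eq0; apply/negP => /eqP /(congr1 (fun x => N x)).
  rewrite normc_1 !normc_M normc_conj normc_V normc_real ger0_norm ?ltW // => E.
  have : N z / r * N y < 1; last by rewrite -E ltxx.
  have [z0|z0] := eqVneq (N z) 0; first by rewrite z0 !mul0r ltr01.
  have z1 : 0 < N z by rewrite lt_def z0 normc_ge0.
  apply: (@lt_le_trans _ _ (N z / r * b)); first by rewrite ltr_pM2l // divr_gt0.
  have -> : N z / r * b = (N z *+ 2) / (r + N z) by rewrite /b; field; rewrite !gt_eqF.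
  by rewrite ler_pdivrMr // mul1r mulr2n lerD2r ltW.
have := @mean_value phi b 1; rewrite ler01 b1 => /(_ isT phid).
rewrite /phi mulr0 subr0 invr1 mul1r => E.
rewrite -[LHS]conjCK -[RHS]conjCK; congr (_^*).
have -> : twopi^* = twopi by rewrite conj_realC.
have ci : cintegrable leb (circ : set TR) (fun t => r%:C%C * eit t / (r%:C%C * eit t - z)).
  apply: (@cintegrable_circle _ (fun y => y / (y - z))) => t; apply: ccontM; first exact: ccont_id.
  apply: ccontV; last by exact/cdiff_cont/cdiff_subl.
  by apply: circle_ne; [exact: ltW|rewrite lt_eqF].
rewrite -E /cmean -(Cint_conj (@measurable_circ R) ci).
apply: Cint_ext => t _; rewrite mul1r.
rewrite rmorphM fmorphV rmorphB rmorphM /= conj_realC eit_conj.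
have e0 := @eit_neq0 R t.
have H1 : r%:C%C - z^* * eit t != 0.
  rewrite subr_eq0; apply/negP => /eqP /(congr1 (fun x => N x)).
  by rewrite normc_M normc_eit mulr1 normc_conj normc_real ger0_norm ?ltW // => E2; rewrite E2 ltxx in zr.
have H2 : r%:C%C * (eit t)^-1 - z^* != 0.
  have -> : r%:C%C * (eit t)^-1 - z^* = (r%:C%C - z^* * eit t) / eit t by field.
  by rewrite mulf_neq0 // invr_neq0.
have H3 : 1 - z^* / r%:C%C * eit t != 0.
  have -> : 1 - z^* / r%:C%C * eit t = (r%:C%C - z^* * eit t) / r%:C%C by field.
  by rewrite mulf_neq0 // invr_neq0.
have -> : r%:C%C * (eit t)^-1 - z^* = (r%:C%C - z^* * eit t) / eit t by field.
have -> : 1 - z^* / r%:C%C * eit t = (r%:C%C - z^* * eit t) / r%:C%C by field.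
by field; rewrite H1 rC e0.
Qed.

Definition dquot f z y : C :=
  if y == z then 'D_1 (f : C^o -> C^o) z else (f y - f z) / (y - z).

Lemma dquotE f z y : f y = f z + (y - z) * dquot f z y.
Proof.
rewrite /dquot; case: eqVneq => [->|yz]; first by rewrite subrr mul0r addr0.
by rewrite mulrCA divff ?mulr1 ?subr_eq0 // addrC subrK.
Qed.

Lemma dquot_ne f z y : y != z -> dquot f z y = (f y - f z) / (y - z).
Proof. by rewrite /dquot => /negbTE ->. Qed.

Lemma cdiff_dquot f z y : y != z -> cdiff f y -> cdiff (dquot f z) y.
Proof.
move=> yz fd.
have yz0 : 0 < N (y - z) by rewrite normc_gt0 subr_eq0.
apply: (@cdiff_near _ (fun y => (f y - f z) / (y - z)) _ _ _ yz0).
  move=> x xy; rewrite dquot_ne //; apply: contraTneq xy => ->.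
  by rewrite normcBC ltxx.
apply: cdiff_div; [by rewrite subr_eq0|exact: (cdiffB fd (cdiff_cst _ _))|exact: cdiff_subl].
Qed.

Lemma ccont_dquot f z : cdiff f z -> ccont (dquot f z) z.
Proof. by move=> /cdiff_derive[l E]; rewrite /dquot E. Qed.

Lemma ccont_dquot_all f z y : cdiff f z -> cdiff f y -> ccont (dquot f z) y.
Proof.
move=> fz fy; have [->|yz] := eqVneq y z; first exact: ccont_dquot.
exact/cdiff_cont/cdiff_dquot.
Qed.

Theorem cauchy_formula f b r z : N z < r -> r < b ->
  (forall y : C, N y < b -> cdiff f y) ->
  cmean (fun y => y / (y - z) * f y) r = f z * twopi.
Proof.
move=> zr rb fd; have r0 : 0 <= r by rewrite (le_trans _ (ltW zr)) // normc_ge0.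
have zb : N z < b by rewrite (lt_trans zr).
have H : cmean (fun y => dquot f z y * y) r = 0.
  rewrite (@cmean_ball _ b (N z)) ?r0 ?mulr0 ?mul0r // => y yb.
    by apply: ccontM; [exact: ccont_dquot_all (fd _ zb) (fd _ yb)|exact: ccont_id].
  move=> _ yz; apply: cdiffM; last exact: cdiff_id.
  by apply: cdiff_dquot; [apply: contra yz => /eqP ->|exact: fd].
have kc t : ccont (fun y => y / (y - z)) (r%:C%C * eit t).
  apply: ccontM; first exact: ccont_id.
  apply: ccontV; last exact/cdiff_cont/cdiff_subl.
  by apply: circle_ne => //; rewrite lt_eqF.
have fc t : ccont f (r%:C%C * eit t) by apply/cdiff_cont/fd; rewrite normc_circle_pos.
rewrite (@cmean_ext _ (fun y => dquot f z y * y + f z * (y / (y - z)))).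
  rewrite cmeanD.
  - by rewrite H cmeanZ // cmean_cauchy_kernel // add0r.
  - move=> t; apply: ccontM; last exact: ccont_id.
    by apply: ccont_dquot_all; apply: fd; rewrite ?normc_circle_pos.
  - by move=> t; apply: ccontM (kc t); exact: ccont_cst.
move=> t; have := @circle_ne r t z r0; rewrite (lt_eqF zr) => /(_ isT) ne.
rewrite [in LHS](dquotE f z); move: (dquot f z _) => q; field => //.
Qed.

Lemma residue_circle (v : C -> C) (a b : R) r1 r2 z : 0 <= a -> a < r1 -> r1 < N z ->
  N z < r2 -> r2 < b -> (forall y : C, a < N y < b -> cdiff v y) ->
  cmean (fun y => (y + z) / (y - z) * v y) r2 =
  cmean (fun y => (y + z) / (y - z) * v y) r1 + 2 * twopi * v z.
Proof.
move=> a0 ar1 r1z zr2 r2b vd.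
have r10 : 0 < r1 by rewrite (le_lt_trans a0).
have r20 : 0 < r2 by rewrite (lt_trans r10) // (lt_trans r1z).
have z0 : z != 0 by rewrite -normc_gt0 (lt_trans r10).
have vz : cdiff v z by apply: vd; rewrite (lt_trans ar1) //= (lt_trans zr2).
have kd (y : C) : y - z != 0 -> cdiff (fun y => (y + z) / (y - z)) y.
  by move=> yz; exact: (@cdiff_div _ (fun y => y + z) (fun y => y - z) y yz (cdiffD (cdiff_id _) (cdiff_cst _ _)) (cdiff_subl _ _)).
have split r : a < r < b -> r != N z ->
   cmean (fun y => (y + z) / (y - z) * v y) r = cmean (fun y => (y + z) * dquot v z y) r
     + v z * cmean (fun y => (y + z) / (y - z)) r.
  move=> /andP[ar rb] rz; have r0 : 0 <= r by rewrite (le_trans a0) // ltW.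
  have ne t : r%:C%C * eit t - z != 0 by apply: circle_ne => //; rewrite eq_sym.
  have kc t : ccont (fun y => (y + z) / (y - z)) (r%:C%C * eit t) by exact/cdiff_cont/kd.
  rewrite -cmeanZ // -cmeanD.
  - apply: cmean_ext => t.
    by rewrite [in LHS](dquotE v z); move: (dquot v z _) => q; field.
  - move=> t; apply: ccontM; last first.
      by apply: ccont_dquot_all => //; apply: vd; rewrite normc_circle_pos // ar.
    by apply: ccontD; [exact: ccont_id|exact: ccont_cst].
  - by move=> t; apply: ccontM (kc t); exact: ccont_cst.
rewrite !split; first last.
- by rewrite gt_eqF.
- by rewrite r2b andbT (lt_trans ar1) // (lt_trans r1z).
- by rewrite lt_eqF.
- by rewrite ar1 /= (lt_trans r1z) // (lt_trans zr2).
have -> : cmean (fun y => (y + z) / (y - z)) r1 = - twopi.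
  rewrite (@mean_value _ (N z)) ?r1z ?(ltW r10) //.
    by rewrite add0r sub0r invrN mulrN divff // mulN1r.
  by move=> y yz; apply: kd; rewrite subr_eq0; apply: contraTneq yz => ->; rewrite ltxx.
have -> : cmean (fun y => (y + z) / (y - z)) r2 = twopi.
  have ne t : r2%:C%C * eit t - z != 0.
    by apply: circle_ne; [exact: ltW|rewrite lt_eqF].
  rewrite (@cmean_ext _ (fun y => 2 * (y / (y - z)) - 1)); last by move=> t; field.
  have kc t : ccont (fun y => y / (y - z)) (r2%:C%C * eit t).
    apply: ccontM; first exact: ccont_id.
    by apply: ccontV => //; exact/cdiff_cont/cdiff_subl.
  rewrite cmeanB; first last.
  - by move=> t; exact: ccont_cst.
  - by move=> t; apply: ccontM (kc t); exact: ccont_cst.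
  by rewrite cmeanZ // cmean_cauchy_kernel // cmean_cst; ring.
have H : cmean (fun y => (y + z) * dquot v z y) r2 = cmean (fun y => (y + z) * dquot v z y) r1.
  apply: (@cmean_const_except _ a b (N z)) => //.
  - by rewrite r2b andbT (lt_trans ar1) // (lt_trans r1z).
  - by rewrite ar1 /= (lt_trans r1z) // (lt_trans zr2).
  - move=> y yab; apply: ccontM; last by apply: ccont_dquot_all => //; exact: vd.
    by apply: ccontD; [exact: ccont_id|exact: ccont_cst].
  - move=> y yab yz; apply: cdiffM.
      by apply: cdiffD; [exact: cdiff_id|exact: cdiff_cst].
    by apply: cdiff_dquot; [apply: contra yz => /eqP ->|exact: vd].
by rewrite H; ring.
Qed.

Lemma circle_dist r t z : 0 <= r -> `|r - N z| <= N (r%:C%C * eit t - z).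
Proof.
by move=> r0; rewrite -{1}(@normc_circle_pos r t) //; exact: normc_lB_abs.
Qed.

Lemma cmeas_kernel r z : 0 <= r -> N z != r ->
  cmeas (circ : set TR) (fun t => (r%:C%C * eit t - z)^-1).
Proof.
move=> r0 zr; apply: (@cmeas_circle _ (fun y => (y - z)^-1)) => t.
by apply: ccontV; [exact: circle_ne|exact/cdiff_cont/cdiff_subl].
Qed.

Lemma cdiff_cauchy_int (mu : {measure set TR -> \bar R}) (h : R -> C) r z :
  cintegrable mu (circ : set TR) h -> 0 <= r -> N z != r ->
  cdiff (fun z => Cint mu (circ : set TR) (fun t => (r%:C%C * eit t - z)^-1 * h t)) z.
Proof.
move=> hi r0 zr; pose d := `|r - N z| / 2.
have d0 : 0 < d by rewrite divr_gt0 // normr_gt0 subr_eq0 eq_sym.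
have near y : N (y - z) < d -> forall t, d <= N (r%:C%C * eit t - y).
  move=> yz t; have := circle_dist t z r0.
  have := normc_lB (r%:C%C * eit t - z) (y - z).
  have -> : r%:C%C * eit t - z - (y - z) = r%:C%C * eit t - y by ring.
  by rewrite /d in yz *; lra.
have dz t : d <= N (r%:C%C * eit t - z) by apply: near; rewrite subrr normc_0.
have kb y : N (y - z) < d -> forall t, circ t -> N ((r%:C%C * eit t - y)^-1) <= d^-1.
  move=> yz t _; rewrite normc_V lef_pV2 ?posrE //; first exact: near.
  by rewrite (lt_le_trans d0) // near.
have kbz : forall t, circ t -> N ((r%:C%C * eit t - z)^-1) <= d^-1.
  by apply: kb; rewrite subrr normc_0.
have yr y : N (y - z) < d -> N y != r.
  move=> yz; apply: contraTneq (d0) => E; rewrite -leNgt.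
  have [t [_ yE]] := polar y; have := near y yz t.
  by rewrite {1}yE E subrr normc_0.
have ne y t : N (y - z) < d -> r%:C%C * eit t - y != 0.
  by move=> yz; rewrite circle_ne // yr.
have mC := @measurable_circ R.
have ki y : N (y - z) < d -> cintegrable mu (circ : set TR) (fun t => (r%:C%C * eit t - y)^-1 * h t).
  by move=> yz; apply: (cintegrable_mulb mC hi (cmeas_kernel r0 (yr _ yz)) (kb _ yz)).
have zd : N (z - z) < d by rewrite subrr normc_0.
have kki y : N (y - z) < d -> cintegrable mu (circ : set TR)
    (fun t => (r%:C%C * eit t - y)^-1 * ((r%:C%C * eit t - z)^-1 * h t)).
  by move=> yz; apply: (cintegrable_mulb mC (ki _ zd) (cmeas_kernel r0 (yr _ yz)) (kb _ yz)).
apply/cdiffP; exists (fun y => Cint mu (circ : set TR)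
  (fun t => (r%:C%C * eit t - y)^-1 * ((r%:C%C * eit t - z)^-1 * h t))); split; last first.
  exists d => // y yd; rewrite -CintZ //; last exact: kki.
  rewrite -CintD //; [|exact: ki|exact/cintegrableZ/kki].
  apply: Cint_ext => t _.
  have n1 := ne _ t yd; have n2 := ne _ t zd.
  by field; rewrite n1 n2.
pose I := 2 * \int[mu]_(t in circ) N ((r%:C%C * eit t - z)^-1 * ((r%:C%C * eit t - z)^-1 * h t)).
have I0 : 0 <= I.
  by rewrite mulr_ge0 //; apply: Rintegral_ge0 => t _; exact: normc_ge0.
apply/ccontP => e e0; exists (Num.min d (e / (d^-1 * I + 1))).
  by rewrite lt_min d0 divr_gt0 // ltr_wpDl // mulr_ge0 // invr_ge0 ltW.
move=> y; rewrite lt_min => /andP[yd ye].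
rewrite -CintB //; [|exact: kki|exact: kki].
rewrite (@Cint_ext _ _ _ _ (fun t => (y - z) * ((r%:C%C * eit t - y)^-1 *
   ((r%:C%C * eit t - z)^-1 * ((r%:C%C * eit t - z)^-1 * h t))))); last first.
  move=> t _; have n1 := ne _ t yd; have n2 := ne _ t zd.
  by field; rewrite n1 n2.
rewrite CintZ //; last first.
  by apply: (cintegrable_mulb mC (kki _ zd) (cmeas_kernel r0 (yr _ yd)) (kb _ yd)).
rewrite normc_M.
have := normc_Cint_mul mC (kki _ zd) (cmeas_kernel r0 (yr _ yd)) (kb _ yd).
rewrite -/I => B.
have A0 : 0 <= d^-1 * I by rewrite mulr_ge0 // invr_ge0 ltW.
apply: (@le_lt_trans _ _ (N (y - z) * (d^-1 * I + 1))).
  by rewrite ler_wpM2l ?normc_ge0 // (le_trans B) // lerDl.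
by rewrite -ltr_pdivlMr // ltr_wpDl.
Qed.

Lemma cdiff_kernel_int (mu : {measure set TR -> \bar R}) (h : R -> C) r z :
  cintegrable mu (circ : set TR) h -> 0 <= r -> N z != r ->
  cdiff (fun z => Cint mu (circ : set TR)
     (fun t => (r%:C%C * eit t + z) / (r%:C%C * eit t - z) * h t)) z.
Proof.
move=> hi r0 zr; have mC := @measurable_circ R.
have ei : cintegrable mu (circ : set TR) (fun t => r%:C%C * eit t * h t).
  apply: (@cintegrable_mulb _ mu circ mC _ _ r hi).
    by apply: (@cmeas_circle _ id) => t; exact: ccont_id.
  by move=> t _; rewrite normc_circle_pos.
have d0 : 0 < `|r - N z| by rewrite normr_gt0 subr_eq0 eq_sym.
have E y : N (y - z) < `|r - N z| -> 2 * Cint mu (circ : set TR)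
     (fun t => (r%:C%C * eit t - y)^-1 * (r%:C%C * eit t * h t)) - Cint mu (circ : set TR) h =
   Cint mu (circ : set TR) (fun t => (r%:C%C * eit t + y) / (r%:C%C * eit t - y) * h t).
  move=> yz; have yr : N y != r.
    apply: contraTneq yz => <-; rewrite -leNgt; exact: normc_lB_abs.
  have dy0 : 0 < `|r - N y| by rewrite normr_gt0 subr_eq0 eq_sym.
  have ki : cintegrable mu (circ : set TR)
     (fun t => (r%:C%C * eit t - y)^-1 * (r%:C%C * eit t * h t)).
    apply: (@cintegrable_mulb _ mu circ mC _ _ (`|r - N y|^-1) ei (cmeas_kernel r0 yr)).
    move=> t _; rewrite normc_V lef_pV2 ?posrE ?circle_dist //.
    by rewrite (lt_le_trans dy0) // circle_dist.
  rewrite -CintZ // -CintB //; last exact: cintegrableZ.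
  by apply: Cint_ext => t _; have ne := circle_ne t r0 yr; field.
apply: (cdiff_near d0 E).
apply: cdiffB; last exact: cdiff_cst.
by apply: cdiffM; [exact: cdiff_cst|exact: cdiff_cauchy_int].
Qed.

End CauchyFormula.

Section Consequences.
Context {R : realType}.
Local Notation C := R[i].
Local Notation TR := (measurableTypeR R).
Implicit Types (f g phi : C -> C) (z : C) (r b : R).

Lemma bernoulli (x : R) n : 0 <= x -> 1 + n%:R * x <= (1 + x) ^+ n.
Proof.
move=> x0; elim: n => [|n IH]; first by rewrite mul0r addr0 expr0.
rewrite exprS (le_trans _ (ler_wpM2l _ IH)) ?addr_ge0 //.
have : 0 <= n%:R * x * x by rewrite !mulr_ge0.
by rewrite -[n.+1]addn1 natrD; lra.
Qed.

Lemma expr_large (q K : R) : 1 < q -> exists n, K < q ^+ n.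
Proof.
move=> q1; have q0 : 0 < q - 1 by rewrite subr_gt0.
exists (Num.bound (`|K| / (q - 1))).
have := @bernoulli (q - 1) (Num.bound (`|K| / (q - 1))) (ltW q0).
have -> : 1 + (q - 1) = q by ring.
apply: lt_le_trans; have : `|K| / (q - 1) < (Num.bound (`|K| / (q - 1)))%:R.
  by apply: archi_boundP; rewrite divr_ge0 // ltW.
rewrite ltr_pdivrMr // => H; have := ler_norm K; lra.
Qed.

Lemma expr_small (q K e : R) : 0 <= q -> q < 1 -> 0 < e -> exists n, K * q ^+ n < e.
Proof.
move=> q0 q1 e0; have [->|qn0] := eqVneq q 0.
  by exists 1%N; rewrite expr1 mulr0.
have {}q0 : 0 < q by rewrite lt_def qn0.
have [n Hn] := @expr_large q^-1 (K / e) (ltac:(by rewrite invf_gt1)).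
exists n; move: Hn; rewrite exprVn ltr_pdivrMr // => Hn.
by rewrite -ltr_pdivlMr ?exprn_gt0 // mulrC.
Qed.

Lemma ccont_kernel z r t : 0 <= r -> N z != r ->
  ccont (fun y => y / (y - z)) (r%:C%C * eit t).
Proof.
move=> r0 zr; apply: ccontM; first exact: ccont_id.
by apply: ccontV; [exact: circle_ne|exact/cdiff_cont/cdiff_subl].
Qed.

Lemma ball_circle f b r : 0 <= r -> r < b -> (forall y : C, N y < b -> cdiff f y) ->
  forall t, ccont f (r%:C%C * eit t).
Proof. by move=> r0 rb fd t; apply/cdiff_cont/fd; rewrite normc_circle_pos. Qed.

Theorem max_modulus f b r (M : R) z : N z < r -> r < b ->
  (forall y : C, N y < b -> cdiff f y) ->
  (forall t, N (f (r%:C%C * eit t)) <= M) -> N (f z) <= M.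
Proof.
move=> zr rb fd fM; have r0 : 0 <= r by rewrite (le_trans _ (ltW zr)) // normc_ge0.
have M0 : 0 <= M by rewrite (le_trans _ (fM 0)) // normc_ge0.
rewrite leNgt; apply/negP => Mf.
pose M' := (N (f z) + M) / 2.
have M'0 : 0 < M' by rewrite divr_gt0 //; lra.
have MM' : M <= M' by rewrite /M'; lra.
have rz0 : 0 < r - N z by rewrite subr_gt0.
pose K := 2 * (r / (r - N z)).
have bound n : N (f z) ^+ n <= K * M' ^+ n.
  have fnd y : N y < b -> cdiff (fun y => f y ^+ n) y by move=> /fd; exact: cdiffX.
  have := cauchy_formula zr rb fnd => /(congr1 (fun x => N x)).
  have tp : N (@twopi R) = pi *+ 2 by rewrite normc_real ger0_norm // ltW // pi2_gt0.
  rewrite normc_M normc_X tp => E.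
  rewrite -(@ler_pM2r _ (pi *+ 2)) ?pi2_gt0 // -E.
  have := @normc_Cint_bound _ leb (circ : set TR) (@measurable_circ R)
    (fun t => (fun y => y / (y - z) * f y ^+ n) (r%:C%C * eit t)) (r / (r - N z) * M' ^+ n) (@leb_circ_lty R).
  rewrite fine_leb_circ => H; rewrite (le_trans (H _ _)) //; last by rewrite /K; lra.
    apply: (@cmeas_circle _ (fun y => y / (y - z) * f y ^+ n)) => t; apply: ccontM.
      by apply: ccont_kernel => //; rewrite lt_eqF.
    exact: (ball_circle r0 rb fnd).
  move=> t _; rewrite !normc_M normc_X normc_V; apply: ler_pM.
  - by rewrite mulr_ge0 ?invr_ge0 // ?mulr_ge0 ?normc_ge0.
  - by rewrite exprn_ge0 // normc_ge0.
  - rewrite -normc_M normc_circle_pos // ler_wpM2l // lef_pV2 ?posrE //.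
      have := @circle_dist _ r t z r0; rewrite gtr0_norm //.
    by have := @circle_dist _ r t z r0; rewrite gtr0_norm //; apply: lt_le_trans.
  - by rewrite lerXn2r ?nnegrE ?normc_ge0 ?(ltW M'0) // (le_trans (fM t)).
have q1 : 1 < N (f z) / M' by rewrite ltr_pdivlMr // mul1r /M'; lra.
have [n Hn] := @expr_large _ K q1.
move: Hn; rewrite expr_div_n ltr_pdivlMr ?exprn_gt0 // ltNge.
by rewrite bound.
Qed.

Theorem cdiff_dquot_ball f b p y : (forall y : C, N y < b -> cdiff f y) ->
  N p < b -> N y < b -> cdiff (dquot f p) y.
Proof.
move=> fd pb yb; have [->|yp] := eqVneq y p; last by apply: cdiff_dquot => //; exact: fd.
have [r [pr rb]] : exists r, N p < r /\ r < b by exists ((N p + b) / 2); split; lra.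
have r0 : 0 <= r by rewrite (le_trans _ (ltW pr)) // normc_ge0.
have mC := @measurable_circ R.
have fc := ball_circle r0 rb fd.
have pr' : N p != r by rewrite lt_eqF.
pose h t := (r%:C%C * eit t) / (r%:C%C * eit t - p) * f (r%:C%C * eit t).
have hi : cintegrable leb (circ : set TR) h.
  apply: (@cintegrable_circle _ (fun y => y / (y - p) * f y)) => t.
  by apply: ccontM => //; exact: ccont_kernel.
pose Q y := Cint leb (circ : set TR) (fun t => (r%:C%C * eit t - y)^-1 * h t) / twopi.
have Qd : cdiff Q p.
  by apply: cdiffM; [exact: cdiff_cauchy_int|exact: cdiff_cst].
have QE x : N x < r -> x != p -> Q x = dquot f p x.
  move=> xr xp; rewrite dquot_ne // /Q.
  have xr' : N x != r by rewrite lt_eqF.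
  have := cauchy_formula pr rb fd; have := cauchy_formula xr rb fd.
  set A := cmean _ r; set B := cmean _ r => EA EB.
  have xp0 : x - p != 0 by rewrite subr_eq0.
  have -> : Cint leb (circ : set TR) (fun t => (r%:C%C * eit t - x)^-1 * h t) = (A - B) / (x - p).
    rewrite /A /B -cmeanB; first last.
    - by move=> t; apply: ccontM => //; exact: ccont_kernel.
    - by move=> t; apply: ccontM => //; exact: ccont_kernel.
    rewrite mulrC -cmeanZ; last first.
      by move=> t; apply: ccontB; apply: ccontM => //; exact: ccont_kernel.
    apply: Cint_ext => t _; rewrite /h.
    have n1 := circle_ne t r0 xr'; have n2 := circle_ne t r0 pr'.
    by field; rewrite n1 n2 xp0.
  by rewrite EA EB; have := @twopi_neq0 R; move: twopi => w w0; field; rewrite w0 xp0.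
have e0 : 0 < r - N p by rewrite subr_gt0.
have inr x : N (x - p) < r - N p -> N x < r.
  by move=> H; have := normc_lB x p; lra.
have Qp : Q p = dquot f p p.
  apply/eqP; rewrite -subr_eq0; apply/eqP/normc_small => e e1.
  have e2 : 0 < e / 2 by rewrite divr_gt0.
  have /ccontP/(_ _ e2)[d1 d10 H1] := cdiff_cont Qd.
  have /ccontP/(_ _ e2)[d2 d20 H2] := ccont_dquot (fd _ pb).
  pose d := Num.min (r - N p) (Num.min d1 d2) / 2.
  have m0 : 0 < Num.min (r - N p) (Num.min d1 d2) by rewrite !lt_min e0 d10.
  have dd0 : 0 < d by rewrite divr_gt0.
  have dm : d < Num.min (r - N p) (Num.min d1 d2) by rewrite /d; lra.
  have xE : N (p + d%:C%C - p) = d by rewrite addrAC subrr add0r normc_real gtr0_norm.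
  move: dm; rewrite !lt_min => /and3P[c1 c2 c3].
  have x1 := H1 (p + d%:C%C); rewrite xE in x1.
  have x2 := H2 (p + d%:C%C); rewrite xE in x2.
  have E : Q (p + d%:C%C) = dquot f p (p + d%:C%C).
    apply: QE; first by apply: inr; rewrite xE.
    by rewrite -subr_eq0 -normc_eq0 xE gt_eqF.
  have := x1 c2; have := x2 c3; rewrite E.
  move: (dquot f p (p + _)) (dquot f p p) (Q p) => u v w uv uw.
  have -> : w - v = (u - v) - (u - w) by ring.
  have := normc_B (u - v) (u - w); lra.
apply: (cdiff_near e0 _ Qd) => x /inr xr.
by have [->|/QE->] := eqVneq x p.
Qed.

Theorem zero_factor g b p : (forall y : C, N y < b -> cdiff g y) -> g 0 != 0 -> N p < b ->
  exists k h, [/\ forall y : C, N y < b -> cdiff h y, h p != 0 &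
    forall y, g y = (y - p) ^+ k * h y].
Proof.
move=> gd g0 pb.
have [r [pr rb]] : exists r, N p < r /\ r < b by exists ((N p + b) / 2); split; lra.
have r0 : 0 < r by rewrite (le_lt_trans _ pr) // normc_ge0.
apply: contrapT => /forallNP nk.
have fac k : exists h, (forall y : C, N y < b -> cdiff h y) /\ forall y, g y = (y - p) ^+ k * h y.
  elim: k => [|k [h [hd hE]]]; first by exists g; split=> // y; rewrite mul1r.
  have hp : h p = 0.
    apply/eqP; apply: contrapT => /negP hp; apply: (nk k); exists h; split => //.
  exists (dquot h p); split; first by move=> y yb; exact: (cdiff_dquot_ball hd pb yb).
  by move=> y; rewrite hE {1}(dquotE h p) hp add0r exprSr mulrA.
have [M M0 HM] := circle_bounded (ball_circle (ltW r0) rb gd).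
have rC : r%:C%C != 0 :> C by rewrite realC_eq0 gt_eqF.
have q1 : N p / r < 1 by rewrite ltr_pdivrMr // mul1r.
have q0 : 0 <= N p / r by rewrite divr_ge0 ?normc_ge0 // ltW.
have Ng0 : 0 < N (g 0) by rewrite normc_gt0.
have [k Hk] := @expr_small _ M _ q0 q1 Ng0.
have [h [hd hE]] := fac k.
(* the Blaschke factor [r (y - p) / (r^2 - conj p y)] is unimodular on [|y| = r] *)
pose u y := h y * ((r%:C%C ^+ 2 - p^* * y) / r%:C%C) ^+ k.
have ud y : N y < b -> cdiff u y.
  move=> yb; apply: cdiffM; first exact: hd.
  apply: cdiffX; apply: cdiffM; last exact: cdiff_cst.
  apply: cdiffB; first exact: cdiff_cst.
  by apply: cdiffM; [exact: cdiff_cst|exact: cdiff_id].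
have uM t : N (u (r%:C%C * eit t)) <= M.
  apply: le_trans (HM t); rewrite /u hE normc_M [in leRHS]normc_M mulrC !normc_X.
  rewrite ler_wpM2r ?normc_ge0 //.
  have -> : (r%:C%C ^+ 2 - p^* * (r%:C%C * eit t)) / r%:C%C =
      eit t * (r%:C%C * eit t - p)^*.
    rewrite rmorphB rmorphM /= conj_realC eit_conj.
    by have e0 := @eit_neq0 R t; field; rewrite rC e0.
  by rewrite normc_M normc_eit mul1r normc_conj.
have := max_modulus (z := 0) _ rb ud uM; rewrite normc_0 => /(_ r0).
rewrite /u mulr0 subr0 expr2 mulfK // normc_M normc_X normc_real gtr0_norm // => B.
move: Hk; rewrite hE sub0r normc_M normc_X normc_N expr_div_n ltNge => /negP; apply.
rewrite mulrCA ler_wpM2l ?exprn_ge0 ?normc_ge0 //.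
by rewrite ler_pdivlMr ?exprn_gt0.
Qed.

Lemma flat_zero (W : C -> C) (V : nat -> C -> C) (b : R) :
  (forall y : C, N y < b -> cdiff W y) ->
  (forall k (y : C), N y < b -> cdiff (V k) y) ->
  (forall k (y : C), N y < b -> W y = y ^+ k * V k y) ->
  forall y : C, N y < b -> W y = 0.
Proof.
move=> Wd Vd E y yb; apply/normc_small => e e0.
have [r [yr rb]] : exists r, N y < r /\ r < b by exists ((N y + b) / 2); split; lra.
have r0 : 0 < r by rewrite (le_lt_trans _ yr) // normc_ge0.
have [M M0 HM] := circle_bounded (ball_circle (ltW r0) rb Wd).
have q1 : N y / r < 1 by rewrite ltr_pdivrMr // mul1r.
have q0 : 0 <= N y / r by rewrite divr_ge0 ?normc_ge0 // ltW.
have [k Hk] := @expr_small _ M _ q0 q1 e0.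
apply: le_lt_trans Hk; rewrite (E k) // normc_M normc_X expr_div_n mulrCA.
rewrite ler_wpM2l ?exprn_ge0 ?normc_ge0 //.
apply: (max_modulus yr rb (Vd k)) => t.
rewrite ler_pdivlMr ?exprn_gt0 //.
have := HM t; rewrite (E k) ?normc_circle_pos ?(ltW r0) // normc_M normc_X normc_circle_pos ?(ltW r0) //.
by rewrite mulrC.
Qed.

Lemma cmean1 phi : cmean phi 1 = Cint leb (circ : set TR) (fun t => phi (eit t)).
Proof. by apply: Cint_ext => t _; rewrite mul1r. Qed.

Lemma cmean_conj_kernel f b z : N z < 1 -> 1 < b -> (forall y : C, N y < b -> cdiff f y) ->
  cmean (fun y => (y / (y - z))^* * f y) 1 = f 0 * twopi.
Proof.
move=> z1 b1 fd; have n1 : 1%:C%C = 1 :> C by [].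
have z2 : 0 < 1 + N z by rewrite ltr_pwDl // normc_ge0.
pose c := Num.min b (2 / (1 + N z)).
have c1 : 1 < c by rewrite lt_min b1 ltr_pdivlMr // mul1r; lra.
have ne y : N y < c -> 1 - z^* * y != 0.
  rewrite lt_min => /andP[_ yc].
  rewrite subr_eq0; apply/negP => /eqP /(congr1 (fun x => N x)).
  rewrite normc_1 normc_M normc_conj => E.
  have [z0|z0] := eqVneq (N z) 0; first by move: E; rewrite z0 mul0r => /eqP; rewrite oner_eq0.
  have z00 : 0 < N z by rewrite lt_def z0 normc_ge0.
  have : N z * N y < N z * (2 / (1 + N z)) by rewrite ltr_pM2l.
  by rewrite -E mulrA ltr_pdivlMr // mul1r; lra.
have := @mean_value _ (fun y => (1 - z^* * y)^-1 * f y) c 1.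
rewrite ler01 c1 mulr0 subr0 invr1 mul1r => <- //; last first.
  move=> y yc; apply: cdiffM; last by apply: fd; move: yc; rewrite lt_min => /andP[].
  apply: cdiffV; first exact: ne.
  by apply: cdiffB; [exact: cdiff_cst|apply: cdiffM; [exact: cdiff_cst|exact: cdiff_id]].
apply: cmean_ext => t; rewrite n1 mul1r; congr (_ * _).
have n2 := ne (eit t) (ltac:(by rewrite normc_eit)).
rewrite rmorphM fmorphV rmorphB /= eit_conj.
have e0 := @eit_neq0 R t.
have -> : (eit t)^-1 - z^* = (1 - z^* * eit t) / eit t by field.
by field; rewrite n2 e0.
Qed.

Theorem schwarz_formula f b z : N z < 1 -> 1 < b -> (forall y : C, N y < b -> cdiff f y) ->
  Cint leb (circ : set TR) (fun t => (eit t + z) / (eit t - z) * (Re (f (eit t)))%:C%C) =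
  (f z - 'i%C * (Im (f 0))%:C%C) * twopi.
Proof.
move=> z1 b1 fd.
have A := cauchy_formula z1 b1 fd; have B := cmean_conj_kernel z1 b1 fd.
have zn : N z != 1 by rewrite lt_eqF.
have kc t : ccont (fun y => y / (y - z)) (1%:C%C * eit t) by apply: ccont_kernel.
have fc t := ball_circle ler01 b1 fd t.
have D := @mean_value _ f b 1; rewrite ler01 b1 in D; have {}D := D isT fd.
have mC := @measurable_circ R.
have cfc t : ccont (fun y => (f y)^*) (1%:C%C * eit t) by exact: ccont_comp (fc t) (ccont_conj _).
have {}B : cmean (fun y => y / (y - z) * (f y)^*) 1 = (f 0)^* * twopi.
  have -> : (f 0)^* * twopi = (f 0 * twopi)^* by rewrite rmorphM /= conj_realC.
  rewrite -B /cmean -Cint_conj //; last first.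
    apply: (@cintegrable_circle _ (fun y => (y / (y - z))^* * f y)) => t.
    by apply: ccontM => //; exact: ccont_comp (kc t) (ccont_conj _).
  by apply: Cint_ext => t _; rewrite rmorphM /= conjCK.
have {}D' : cmean (fun y => (f y)^*) 1 = (f 0)^* * twopi.
  have -> : (f 0)^* * twopi = (f 0 * twopi)^* by rewrite rmorphM /= conj_realC.
  by rewrite -D /cmean -Cint_conj //; exact: cintegrable_circle.
pose G y := y / (y - z) * f y + y / (y - z) * (f y)^*.
pose H y := f y + (f y)^*.
have Gc t : ccont G (1%:C%C * eit t) by apply: ccontD; apply: ccontM.
have Hc t : ccont H (1%:C%C * eit t) by apply: ccontD.
transitivity (cmean (fun y => G y - 2^-1 * H y) 1).
  rewrite cmean1; apply: Cint_ext => t _; rewrite /G /H.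
  have ne : eit t - z != 0 by have := circle_ne t ler01 zn; rewrite mul1r.
  rewrite ReJ_add -[(f (eit t))^*%C]/((f (eit t))^*).
  by move: (f (eit t))^* => u; field.
rewrite cmeanB; [|by []|by move=> t; apply: ccontM => //; exact: ccont_cst].
rewrite cmeanZ // /G /H !cmeanD //; try by move=> t; apply: ccontM.
rewrite A B D D' {A B D D'}.
have -> : 'i%C * (Im (f 0))%:C%C = (f 0 - (f 0)^*) / 2.
  by apply: complex_ext; rewrite ?(cReJ, cImJ, cReD, cImD, cReN, cImN, cReM, cImM, cReV, cImV, normc_sqr) /=; field.
by move: (f 0)^* => u; field.
Qed.

End Consequences.

(** * Uniqueness of the Schwarz transform *)

Section FourierUniqueness.
Context {R : realType}.
Local Notation C := R[i].
Local Notation TR := (measurableTypeR R).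
Variables (k1 k2 : {measure set TR -> \bar R}) (h1 h2 : R -> R).
Hypothesis h1i : k1.-integrable (circ : set TR) (EFin \o h1).
Hypothesis h2i : k2.-integrable (circ : set TR) (EFin \o h2).

Let mC := @measurable_circ R.
Let I1 (phi : R -> C) := Cint k1 (circ : set TR) (fun t => phi t * (h1 t)%:C%C).
Let I2 (phi : R -> C) := Cint k2 (circ : set TR) (fun t => phi t * (h2 t)%:C%C).

Let bm (phi : R -> C) := cmeas (circ : set TR) phi /\
  exists M : R, forall t, circ t -> N (phi t) <= M.

Let bm_int1 phi : bm phi -> cintegrable k1 (circ : set TR) (fun t => phi t * (h1 t)%:C%C).
Proof.
move=> [mp [M pM]]; exact: (cintegrable_mulb mC (cintegrable_real h1i) mp pM).
Qed.

Let bm_int2 phi : bm phi -> cintegrable k2 (circ : set TR) (fun t => phi t * (h2 t)%:C%C).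
Proof.
move=> [mp [M pM]]; exact: (cintegrable_mulb mC (cintegrable_real h2i) mp pM).
Qed.

Let bmM phi psi : bm phi -> bm psi -> bm (fun t => phi t * psi t).
Proof.
move=> [mp [M pM]] [mq [M' qM']]; split; first exact: cmeasM.
exists (M * M') => t ct; rewrite normc_M ler_pM ?normc_ge0 ?pM ?qM' //.
Qed.

Let bmD phi psi : bm phi -> bm psi -> bm (fun t => phi t + psi t).
Proof.
move=> [mp [M pM]] [mq [M' qM']]; split; first exact: cmeasD.
by exists (M + M') => t ct; rewrite (le_trans (normc_D _ _)) // lerD ?pM ?qM'.
Qed.

Let bm_cst c : bm (fun=> c).
Proof. by split; [exact: cmeas_cst|exists (N c)]. Qed.

Let bm_circle (phi : C -> C) : (forall t, ccont phi (1%:C%C * eit t)) -> bm (fun t => phi (eit t)).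
Proof.
move=> pc; split.
  by apply: (cmeas_ext _ (cmeas_circle pc)) => t _; rewrite mul1r.
have [M _ HM] := circle_bounded pc; exists M => t _.
by have := HM t; rewrite mul1r.
Qed.

Let I1D phi psi : bm phi -> bm psi -> I1 (fun t => phi t + psi t) = I1 phi + I1 psi.
Proof.
move=> /bm_int1 p /bm_int1 q; rewrite /I1 -CintD //; apply: Cint_ext => t _.
by rewrite mulrDl.
Qed.

Let I2D phi psi : bm phi -> bm psi -> I2 (fun t => phi t + psi t) = I2 phi + I2 psi.
Proof.
move=> /bm_int2 p /bm_int2 q; rewrite /I2 -CintD //; apply: Cint_ext => t _.
by rewrite mulrDl.
Qed.

Let I1Z c phi : bm phi -> I1 (fun t => c * phi t) = c * I1 phi.
Proof.
by move=> /bm_int1 p; rewrite /I1 -CintZ //; apply: Cint_ext => t _; rewrite mulrA.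
Qed.

Let I2Z c phi : bm phi -> I2 (fun t => c * phi t) = c * I2 phi.
Proof.
by move=> /bm_int2 p; rewrite /I2 -CintZ //; apply: Cint_ext => t _; rewrite mulrA.
Qed.

Let I1_ext phi psi : (forall t, phi t = psi t) -> I1 phi = I1 psi.
Proof. by move=> E; apply: Cint_ext => t _; rewrite E. Qed.

Let I2_ext phi psi : (forall t, phi t = psi t) -> I2 phi = I2 psi.
Proof. by move=> E; apply: Cint_ext => t _; rewrite E. Qed.

Hypothesis kernel_eq : forall z : C, N z < 1 ->
  Cint k1 (circ : set TR) (fun t => (eit t + z) / (eit t - z) * (h1 t)%:C%C) =
  Cint k2 (circ : set TR) (fun t => (eit t + z) / (eit t - z) * (h2 t)%:C%C).

Let eit_ne z t : N z < 1 -> eit t - z != 0 :> C.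
Proof.
move=> z1; rewrite subr_eq0; apply: contraTneq z1 => <-.
by rewrite normc_eit ltxx.
Qed.

Let bm_eV n : bm (fun t => (eit t)^-1 ^+ n).
Proof.
apply: (@bm_circle (fun y => y^-1 ^+ n)) => t; apply/cdiff_cont/cdiffX/cdiffV.
  by rewrite mul1r eit_neq0.
exact: cdiff_id.
Qed.

Let bm_e n : bm (fun t => eit t ^+ n).
Proof.
by apply: (@bm_circle (fun y => y ^+ n)) => t; apply/cdiff_cont/cdiffX/cdiff_id.
Qed.

Let bm_k z : N z < 1 -> bm (fun t => (eit t - z)^-1).
Proof.
move=> z1; apply: (@bm_circle (fun y => (y - z)^-1)) => t; apply: ccontV.
  by rewrite mul1r eit_ne.
exact/cdiff_cont/cdiff_subl.
Qed.

Let AI n z := I1 (fun t => (eit t)^-1 ^+ n * (eit t * (eit t - z)^-1)).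
Let BI n z := I2 (fun t => (eit t)^-1 ^+ n * (eit t * (eit t - z)^-1)).

Let bm_A n z : N z < 1 -> bm (fun t => (eit t)^-1 ^+ n * (eit t * (eit t - z)^-1)).
Proof.
by move=> z1; apply: bmM (bm_eV n) (bmM _ (bm_k z1)); exact: (bm_e 1).
Qed.

Let A_rec n z : N z < 1 -> AI n z = I1 (fun t => (eit t)^-1 ^+ n) + z * AI n.+1 z.
Proof.
move=> z1; rewrite /AI -I1Z; last exact: bm_A.
rewrite -I1D; [|exact: bm_eV|by apply: bmM (bm_cst z) _; exact: bm_A].
apply: I1_ext => t; have n1 := eit_ne t z1; have e0 := @eit_neq0 R t.
by rewrite exprSr; move: (_ ^+ n) => u; field; rewrite n1 e0.
Qed.

Let B_rec n z : N z < 1 -> BI n z = I2 (fun t => (eit t)^-1 ^+ n) + z * BI n.+1 z.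
Proof.
move=> z1; rewrite /BI -I2Z; last exact: bm_A.
rewrite -I2D; [|exact: bm_eV|by apply: bmM (bm_cst z) _; exact: bm_A].
apply: I2_ext => t; have n1 := eit_ne t z1; have e0 := @eit_neq0 R t.
by rewrite exprSr; move: (_ ^+ n) => u; field; rewrite n1 e0.
Qed.

Let mom0 : I1 (fun=> 1) = I2 (fun=> 1).
Proof.
have := @kernel_eq 0; rewrite normc_0 => /(_ ltr01).
have E t : (eit t + 0) / (eit t - 0) = 1 :> C.
  by rewrite addr0 subr0 divff // eit_neq0.
move=> H; transitivity (Cint k1 (circ : set TR) (fun t => (eit t + 0) / (eit t - 0) * (h1 t)%:C%C)).
  by apply: Cint_ext => t _; rewrite E.
by rewrite H; apply: Cint_ext => t _; rewrite E.
Qed.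

Let cdiff_A n z : N z < 1 -> cdiff (AI n) z.
Proof.
move=> z1; have /bm_int1 hi := bmM (bm_eV n) (bm_e 1).
have zn : N z != 1 by rewrite lt_eqF.
apply: (cdiff_ext _ (cdiff_cauchy_int hi ler01 zn)) => y.
by apply: Cint_ext => t _; rewrite mul1r expr1; ring.
Qed.

Let cdiff_B n z : N z < 1 -> cdiff (BI n) z.
Proof.
move=> z1; have /bm_int2 hi := bmM (bm_eV n) (bm_e 1).
have zn : N z != 1 by rewrite lt_eqF.
apply: (cdiff_ext _ (cdiff_cauchy_int hi ler01 zn)) => y.
by apply: Cint_ext => t _; rewrite mul1r expr1; ring.
Qed.

Lemma cont_eq_at0 (f g : C -> C) : ccont f 0 -> ccont g 0 ->
  (forall z, z != 0 -> N z < 1 -> f z = g z) -> f 0 = g 0.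
Proof.
move=> fc gc fg; apply/eqP; rewrite -subr_eq0; apply/eqP/normc_small => e e0.
have e2 : 0 < e / 2 by rewrite divr_gt0.
have /ccontP/(_ _ e2)[d1 d10 H1] := fc; have /ccontP/(_ _ e2)[d2 d20 H2] := gc.
pose d := Num.min 1 (Num.min d1 d2) / 2.
have m0 : 0 < Num.min 1 (Num.min d1 d2) by rewrite !lt_min ltr01 d10.
have d0 : 0 < d by rewrite divr_gt0.
have : d < Num.min 1 (Num.min d1 d2) by rewrite /d; lra.
rewrite !lt_min => /and3P[c1 c2 c3].
have dE : N (d%:C%C : C) = d by rewrite normc_real gtr0_norm.
have := H1 d%:C%C; have := H2 d%:C%C; rewrite subr0 dE (fg d%:C%C) ?dE //; last first.
  by rewrite realC_eq0 gt_eqF.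
move=> /(_ c3) A /(_ c2) B.
have -> : f 0 - g 0 = (g d%:C%C - g 0) - (g d%:C%C - f 0) by ring.
rewrite (le_lt_trans (normc_B _ _)) //; lra.
Qed.

Let AB n z : N z < 1 -> AI n z = BI n z.
Proof.
elim: n z => [|n IH] z z1.
  have H := kernel_eq z1.
  have E (k : {measure set TR -> \bar R}) t (u : C) :
     (eit t + z) / (eit t - z) * u = 2 * (((eit t)^-1 ^+ 0 * (eit t * (eit t - z)^-1)) * u) - 1 * u.
    by have n1 := eit_ne t z1; rewrite expr0; field.
  have i1 := bm_int1 (bm_A 0 z1); have i2 := bm_int2 (bm_A 0 z1).
  have j1 := bm_int1 (bm_cst 1); have j2 := bm_int2 (bm_cst 1).
  have H1 : Cint k1 (circ : set TR) (fun t => (eit t + z) / (eit t - z) * (h1 t)%:C%C) =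
    2 * AI 0 z - I1 (fun=> 1).
    rewrite /AI /I1 -CintZ // -CintB //; last exact: cintegrableZ.
    by apply: Cint_ext => t _; rewrite (E k1).
  have H2 : Cint k2 (circ : set TR) (fun t => (eit t + z) / (eit t - z) * (h2 t)%:C%C) =
    2 * BI 0 z - I2 (fun=> 1).
    rewrite /BI /I2 -CintZ // -CintB //; last exact: cintegrableZ.
    by apply: Cint_ext => t _; rewrite (E k2).
  move: H; rewrite H1 H2 mom0 => /addIr /(mulfI _); apply.
  by rewrite pnatr_eq0.
have n0 : N (0 : C) < 1 by rewrite normc_0.
have ne y : y != 0 -> N y < 1 -> AI n.+1 y = BI n.+1 y.
  move=> y0 y1; have := IH y y1; have := IH 0 n0.
  rewrite (A_rec n n0) (B_rec n n0) (A_rec n y1) (B_rec n y1) !mul0r !addr0 => -> /addrI.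
  by move/(mulfI y0).
have [->|z0] := eqVneq z 0; last exact: ne.
by apply: cont_eq_at0 ne; apply/cdiff_cont; [exact: cdiff_A|exact: cdiff_B].
Qed.

Let mom n : I1 (fun t => (eit t)^-1 ^+ n) = I2 (fun t => (eit t)^-1 ^+ n).
Proof.
have n0 : N (0 : C) < 1 by rewrite normc_0.
by have := AB n n0; rewrite (A_rec n n0) (B_rec n n0) !mul0r !addr0.
Qed.

Let momP n : I1 (fun t => eit t ^+ n) = I2 (fun t => eit t ^+ n).
Proof.
have E t : eit t ^+ n = ((eit t)^-1 ^+ n)^* :> C.
  by rewrite rmorphXn fmorphV /= eit_conj invrK.
have H := congr1 Num.conj (mom n).
rewrite /I1 /I2 -!Cint_conj // in H; try exact: bm_int1; try exact: bm_int2.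
transitivity (Cint k1 (circ : set TR) (fun t => ((eit t)^-1 ^+ n * (h1 t)%:C%C)^*)).
  by apply: Cint_ext => t _; rewrite rmorphM /= conj_realC E.
rewrite H; apply: Cint_ext => t _.
by rewrite rmorphM /= conj_realC E.
Qed.

(* [trig phi] says that all Fourier coefficients of the two weighted integrals agree
   on [phi]; unlike the plain equality it is stable under products with
   trigonometric polynomials. *)
Let trig phi := bm phi /\ forall m n : nat,
  I1 (fun t => eit t ^+ m * (eit t)^-1 ^+ n * phi t) =
  I2 (fun t => eit t ^+ m * (eit t)^-1 ^+ n * phi t).

Let bm_mn m n phi : bm phi -> bm (fun t => eit t ^+ m * (eit t)^-1 ^+ n * phi t).
Proof. by apply: bmM; exact: bmM (bm_e m) (bm_eV n). Qed.

Let trig1 : trig (fun=> 1).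
Proof.
split=> // m n; have [mn|/ltnW nm] := leqP m n.
  have E t : eit t ^+ m * (eit t)^-1 ^+ n * 1 = (eit t)^-1 ^+ (n - m) :> C.
    rewrite mulr1 -{1}(subnK mn) exprD mulrCA -exprMn divff ?expr1n ?mulr1 //.
    exact: eit_neq0.
  by rewrite (I1_ext E) (I2_ext E) mom.
have E t : eit t ^+ m * (eit t)^-1 ^+ n * 1 = eit t ^+ (m - n) :> C.
  rewrite mulr1 -{1}(subnK nm) exprD -mulrA -exprMn divff ?expr1n ?mulr1 //.
  exact: eit_neq0.
by rewrite (I1_ext E) (I2_ext E) momP.
Qed.

Let trigD phi psi : trig phi -> trig psi -> trig (fun t => phi t + psi t).
Proof.
move=> [bp tp] [bq tq]; split; first exact: bmD.
move=> m n; have E t : eit t ^+ m * (eit t)^-1 ^+ n * (phi t + psi t) =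
  eit t ^+ m * (eit t)^-1 ^+ n * phi t + eit t ^+ m * (eit t)^-1 ^+ n * psi t by rewrite mulrDr.
rewrite (I1_ext E) (I2_ext E) (I1D (bm_mn m n bp) (bm_mn m n bq)).
by rewrite (I2D (bm_mn m n bp) (bm_mn m n bq)) tp tq.
Qed.

Let trigZ c phi : trig phi -> trig (fun t => c * phi t).
Proof.
move=> [bp tp]; split; first exact: bmM (bm_cst c) bp.
move=> m n; have E t : eit t ^+ m * (eit t)^-1 ^+ n * (c * phi t) =
  c * (eit t ^+ m * (eit t)^-1 ^+ n * phi t) by rewrite mulrCA.
by rewrite (I1_ext E) (I2_ext E) (I1Z _ (bm_mn m n bp)) (I2Z _ (bm_mn m n bp)) tp.
Qed.

Let trig_e phi : trig phi -> trig (fun t => eit t * phi t).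
Proof.
move=> [bp tp]; split; first exact: bmM (bm_e 1) bp.
move=> m n; have E t : eit t ^+ m * (eit t)^-1 ^+ n * (eit t * phi t) =
  eit t ^+ m.+1 * (eit t)^-1 ^+ n * phi t by rewrite exprSr; ring.
by rewrite (I1_ext E) (I2_ext E) tp.
Qed.

Let trig_eV phi : trig phi -> trig (fun t => (eit t)^-1 * phi t).
Proof.
move=> [bp tp]; split; first exact: bmM (bm_eV 1) bp.
move=> m n; have E t : eit t ^+ m * (eit t)^-1 ^+ n * ((eit t)^-1 * phi t) =
  eit t ^+ m * (eit t)^-1 ^+ n.+1 * phi t.
  by rewrite exprSr; ring.
by rewrite (I1_ext E) (I2_ext E) tp.
Qed.

Variables (c s : R).
Hypothesis s1 : -1 <= s <= 1.

Let q t : R := 2^-1 - (cos (t - c) - s) / 4.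

Let q01 t : 0 <= q t <= 1.
Proof. by have /andP[sa sb] := s1; apply/andP; have := cos_le1 (t - c); have := cos_geN1 (t - c); rewrite /q; lra. Qed.

Let trig_ext phi psi : (forall t, phi t = psi t) -> trig phi -> trig psi.
Proof. by move=> E; have -> : psi = phi by apply/funext => t; rewrite E. Qed.

Let trig_q phi : trig phi -> trig (fun t => (q t)%:C%C * phi t).
Proof.
move=> tp.
apply: (trig_ext _ (trigD (trigZ (2^-1 + s%:C%C / 4) tp)
  (trigD (trigZ (- 8^-1 * eit (- c)) (trig_e tp)) (trigZ (- 8^-1 * eit c) (trig_eV tp))))).
move=> t.
have cE : (cos (t - c))%:C%C = (eit t * eit (- c) + (eit t)^-1 * eit c) / 2 :> C.
  by rewrite -eit_conj; apply: complex_ext;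
  rewrite ?(cReJ, cImJ, cReD, cImD, cReN, cImN, cReM, cImM, cReV, cImV, normc_sqr) /= ?cosB ?sinN ?cosN; field.
have qE : (q t)%:C%C = 2^-1 - ((cos (t - c))%:C%C - s%:C%C) / 4 :> C.
  by apply: complex_ext; rewrite ?(cReD, cImD, cReN, cImN, cReM, cImM, cReV, cImV, normc_sqr) /= /q; field.
by cbv beta; rewrite qE cE; move: (eit (- c)) (eit c) (eit t)^-1 => u v w; field.
Qed.

Let trig_qn n phi : trig phi -> trig (fun t => (q t ^+ n)%:C%C * phi t).
Proof.
move=> tp; elim: n => [|n IH]; first by apply: (trig_ext _ tp) => t; rewrite expr0 mul1r.
by apply: (trig_ext _ (trig_q IH)) => t; rewrite exprS realCM mulrA.
Qed.

Let trig_p n m : trig (fun t => ((1 - q t ^+ n) ^+ m)%:C%C).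
Proof.
elim: m => [|m IH]; first by apply: (trig_ext _ trig1) => t; rewrite expr0.
apply: (trig_ext _ (trigD IH (trigZ (-1) (trig_qn n IH)))) => t.
by rewrite exprS realCM realCB; ring.
Qed.

Let p n t := (1 - q t ^+ n) ^+ (n * 2 ^ n).

Let p_eq n : \int[k1]_(t in circ) (p n t * h1 t) = \int[k2]_(t in circ) (p n t * h2 t).
Proof.
have [_ /(_ 0%N 0%N)] := trig_p n (n * 2 ^ n).
have E t : eit t ^+ 0 * (eit t)^-1 ^+ 0 * ((1 - q t ^+ n) ^+ (n * 2 ^ n))%:C%C =
  ((1 - q t ^+ n) ^+ (n * 2 ^ n))%:C%C :> C by rewrite !expr0 !mul1r.
rewrite (I1_ext E) (I2_ext E) /I1 /I2 => H.
have R1 (k : {measure set TR -> \bar R}) h : Cint k (circ : set TR)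
    (fun t => ((1 - q t ^+ n) ^+ (n * 2 ^ n))%:C%C * (h t)%:C%C) =
  (\int[k]_(t in circ) (p n t * h t))%:C%C.
  rewrite -Cint_real //; apply: Cint_ext => t _.
  by rewrite realCM.
by move: H; rewrite !R1 => /complexI.
Qed.

Let qn01 n t : 0 <= q t ^+ n <= 1.
Proof.
have /andP[a b] := q01 t; rewrite exprn_ge0 //=.
by rewrite exprn_ile1.
Qed.

Let p01 n t : 0 <= p n t <= 1.
Proof.
have /andP[a b] := qn01 n t.
have a1 : 0 <= 1 - q t ^+ n by rewrite subr_ge0.
rewrite /p exprn_ge0 //= exprn_ile1 // gerBl //.
Qed.

Lemma one_sub_expr (x : R) m : 0 <= x <= 1 -> 1 - m%:R * x <= (1 - x) ^+ m.
Proof.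
move=> /andP[x0 x1]; elim: m => [|m IH]; first by rewrite mul0r subr0 expr0.
rewrite exprS.
have : (1 - x) * (1 - m%:R * x) <= (1 - x) * (1 - x) ^+ m by rewrite ler_wpM2l // subr_ge0.
apply: le_trans.
have : 0 <= m%:R * x * x by rewrite !mulr_ge0.
by rewrite -[m.+1]addn1 natrD; lra.
Qed.

Lemma one_sub_expr_le (x : R) m : 0 <= x <= 1 -> (1 - x) ^+ m * (1 + m%:R * x) <= 1.
Proof.
move=> /andP[x0 x1]; have H := @bernoulli _ x m x0.
have x2 : 0 <= 1 - x by rewrite subr_ge0.
apply: (@le_trans _ _ ((1 - x) ^+ m * (1 + x) ^+ m)).
  by rewrite ler_wpM2l // exprn_ge0.
rewrite -exprMn exprn_ile1 //; first by rewrite mulr_ge0 // addr_ge0.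
have : 0 <= x * x by rewrite mulr_ge0.
lra.
Qed.

Lemma nat_expr_small (x : R) : 0 <= x -> x < 1 -> (fun n : nat => n%:R * x ^+ n) @ \oo --> (0 : R).
Proof.
move=> x0 x1; pose y := Num.sqrt x.
have y0 : 0 <= y by exact: sqrtr_ge0.
have yx : y ^+ 2 = x by rewrite sqr_sqrtr.
have y1 : y < 1 by rewrite -(@ltr_pXn2r _ 2) ?nnegrE // yx expr1n.
have yn : (fun n : nat => y ^+ n) @ \oo --> (0 : R).
  by apply: cvg_expr; rewrite ger0_norm.
have [yz|yz] := eqVneq y 0.
  have xz : x = 0 by rewrite -yx yz expr0n.
  apply: cvg_near_cst; exists 1%N => // n /= n1.
  by rewrite xz expr0n gtn_eqF // mulr0.
have yp : 0 < y by rewrite lt_def yz.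
have b0 : 0 < y^-1 - 1 by rewrite subr_gt0 invf_gt1.
have bnd n : n%:R * y ^+ n <= (y^-1 - 1)^-1.
  have E : 1 + (y^-1 - 1) = y^-1 by ring.
  have := @bernoulli _ (y^-1 - 1) n (ltW b0); rewrite E exprVn => H.
  have yn0 : 0 < y ^+ n by rewrite exprn_gt0.
  have : (1 + n%:R * (y^-1 - 1)) * y ^+ n <= (y ^+ n)^-1 * y ^+ n by rewrite ler_wpM2r // ltW.
  rewrite mulVf ?gt_eqF // => H2.
  rewrite -(ler_pM2r b0) mulVf ?gt_eqF //; lra.
apply: (@squeeze_cvgr _ _ _ _ (fun=> 0) (fun n : nat => (y^-1 - 1)^-1 * y ^+ n)).
- apply: nearW => n; apply/andP; split; first by rewrite mulr_ge0 // exprn_ge0.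
  rewrite -yx -exprM mul2n -addnn exprD mulrA ler_wpM2r ?exprn_ge0 //.
- exact: cvg_cst.
- by rewrite -[X in _ --> X](mulr0 (y^-1 - 1)^-1); apply: cvgM => //; exact: cvg_cst.
Qed.

Let p_cvg t : (fun n => p n t) @ \oo --> (\1_[set t | s < cos (t - c)] t : R).
Proof.
have /andP[q0 q1] := q01 t.
rewrite indicE; have [st|st] := boolP (t \in _).
  have {st}st : s < cos (t - c) by move: st; rewrite inE.
  have q2 : 2 * q t < 1 by rewrite /q; lra.
  apply: (@squeeze_cvgr _ _ _ _ (fun n : nat => 1 - n%:R * (2 * q t) ^+ n) (fun=> 1)).
  - apply: nearW => n; apply/andP; split; last by case/andP: (p01 n t).
    apply: le_trans (one_sub_expr _ (qn01 n t)); rewrite natrM natrX exprMn; lra.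
  - rewrite -[X in _ --> X]subr0; apply: cvgB; first exact: cvg_cst.
    by apply: nat_expr_small => //; rewrite mulr_ge0.
  - exact: cvg_cst.
have {st}st : cos (t - c) <= s by rewrite leNgt; apply: contra st => st; rewrite inE.
have q2 : 1 <= 2 * q t by rewrite /q; lra.
apply: (@squeeze_cvgr _ _ _ _ (fun=> 0) (fun n : nat => n.+1%:R^-1)).
- apply: nearW => n; apply/andP; split; first by case/andP: (p01 n t).
  have := one_sub_expr_le (n * 2 ^ n) (qn01 n t); rewrite -/(p n t) => H.
  rewrite -[leRHS]mul1r ler_pdivlMr // (le_trans _ H) // ler_wpM2l //; first by case/andP: (p01 n t).
  rewrite natrM natrX -[n.+1]addn1 natrD addrC lerD2l -mulrA -exprMn.
  by rewrite ler_peMr // exprn_ege1.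
- exact: cvg_cst.
- exact: cvg_harmonic.
Qed.

Let measurable_cos_shift : measurable_fun (setT : set TR) (fun t => cos (t - c)).
Proof.
apply: continuous_measurable_fun => t.
apply: (@cvg_compose _ R R _ (fun t => t - c)); first exact: continuous_cos.
by apply: cvgB; [exact: cvg_id|exact: cvg_cst].
Qed.

Let measurable_arc : measurable ([set t | s < cos (t - c)] : set TR).
Proof.
rewrite (_ : [set t | _] = setT `&` (fun t => cos (t - c)) @^-1` `]s, +oo[%classic); last first.
  by rewrite setTI; apply/seteqP; split => t /=; rewrite in_itv /= andbT.
by apply: measurable_cos_shift => //; exact: measurable_itv.
Qed.

Let measurable_p n : measurable_fun (circ : set TR) (p n).
Proof.
apply: measurable_funTS.
apply: measurable_funX; apply: measurable_funB; first exact: measurable_cst.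
apply: measurable_funX; apply: measurable_funB; first exact: measurable_cst.
apply: measurable_funM; last exact: measurable_cst.
by apply: measurable_funB; [exact: measurable_cos_shift|exact: measurable_cst].
Qed.

Let arc_limit (k : {measure set TR -> \bar R}) (h : R -> R) :
  k.-integrable (circ : set TR) (EFin \o h) ->
  (fun n => \int[k]_(t in circ) (p n t * h t)%:E)%E @ \oo -->
    (\int[k]_(t in circ) (\1_[set t | s < cos (t - c)] t * h t)%:E)%E.
Proof.
move=> hi; have mh : measurable_fun (circ : set TR) h.
  by have /measurable_int/measurable_EFinP := hi.
have [] := @dominated_convergence _ _ _ k (circ : set TR) mC
  (fun n t => (p n t * h t)%:E) (fun t => (\1_[set t | s < cos (t - c)] t * h t)%:E)
  (fun t => `|h t|%:E) => //.
- by move=> n; apply/measurable_EFinP; exact: measurable_funM.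
- by apply/measurable_EFinP; apply: measurable_funM => //.
- apply: aeW => t _; apply: cvg_EFin; first exact: nearW.
  by apply: cvgM; [exact: p_cvg|exact: cvg_cst].
- exact: integrable_norm hi.
- apply: aeW => t n _; rewrite lee_fin normrM ler_piMl //.
  by have /andP[a b] := p01 n t; rewrite ger0_norm.
Qed.

Lemma arc_eq :
  (\int[k1]_(t in circ) (\1_[set t | s < cos (t - c)] t * h1 t)%:E =
   \int[k2]_(t in circ) (\1_[set t | s < cos (t - c)] t * h2 t)%:E)%E.
Proof.
have A1 := arc_limit h1i; have A2 := arc_limit h2i.
have pi (k : {measure set TR -> \bar R}) h n : k.-integrable (circ : set TR) (EFin \o h) ->
   k.-integrable (circ : set TR) (EFin \o (fun t => p n t * h t)).
  move=> hi; apply: (rintegrable_mulb (M := 1) mC hi (measurable_p n)) => t _.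
  by have /andP[a b] := p01 n t; rewrite ger0_norm.
have E : (fun n => \int[k1]_(t in circ) (p n t * h1 t)%:E)%E =
         (fun n => \int[k2]_(t in circ) (p n t * h2 t)%:E)%E.
  apply/funext => n; have := p_eq n; rewrite /Rintegral => H.
  have f1 := integrable_fin_num mC (pi _ _ n h1i).
  have f2 := integrable_fin_num mC (pi _ _ n h2i).
  by rewrite -(fineK f1) -(fineK f2); congr EFin.
rewrite E in A1; exact: (cvg_unique _ A1 A2).
Qed.

End FourierUniqueness.

Section MeasureUniqueness.
Context {R : realType}.
Local Notation C := R[i].
Local Notation TR := (measurableTypeR R).
Variables (k1 k2 : {measure set TR -> \bar R}) (h1 h2 : R -> R).
Hypothesis h1i : k1.-integrable (circ : set TR) (EFin \o h1).
Hypothesis h2i : k2.-integrable (circ : set TR) (EFin \o h2).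
Hypothesis kernel_eq : forall z : C, N z < 1 ->
  Cint k1 (circ : set TR) (fun t => (eit t + z) / (eit t - z) * (h1 t)%:C%C) =
  Cint k2 (circ : set TR) (fun t => (eit t + z) / (eit t - z) * (h2 t)%:C%C).

Let mC := @measurable_circ R.
Let J1 (A : set TR) := (\int[k1]_(t in circ `&` A) (h1 t)%:E)%E.
Let J2 (A : set TR) := (\int[k2]_(t in circ `&` A) (h2 t)%:E)%E.

Lemma integral_indic_mul (k : {measure set TR -> \bar R}) (h : R -> R) (A : set TR) :
  (\int[k]_(t in circ) (\1_A t * h t)%:E = \int[k]_(t in circ `&` A) (h t)%:E)%E.
Proof.
rewrite integral_mkcondr; apply: eq_integral => t _.
by rewrite patchE indicE; case: (t \in A); rewrite ?mul1r ?mul0r.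
Qed.

Let JU1 (A B : set TR) : measurable A -> measurable B -> circ `&` A `&` B = set0 ->
  J1 (A `|` B) = (J1 A + J1 B)%E.
Proof.
move=> mA mB AB; rewrite /J1 setIUr integral_setU //.
- exact: measurableI.
- exact: measurableI.
- have /measurable_int := h1i; apply: measurable_funS => //.
  by move=> t [[]|[]].
- apply/disj_setPS => t [[ct At] [_ Bt]].
  by have : (circ `&` A `&` B) t by []; rewrite AB.
Qed.

Let JU2 (A B : set TR) : measurable A -> measurable B -> circ `&` A `&` B = set0 ->
  J2 (A `|` B) = (J2 A + J2 B)%E.
Proof.
move=> mA mB AB; rewrite /J2 setIUr integral_setU //.
- exact: measurableI.
- exact: measurableI.
- have /measurable_int := h2i; apply: measurable_funS => //.
  by move=> t [[]|[]].
- apply/disj_setPS => t [[ct At] [_ Bt]].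
  by have : (circ `&` A `&` B) t by []; rewrite AB.
Qed.

Let fin1 (A : set TR) : measurable A -> J1 A \is a fin_num.
Proof.
move=> mA; apply: (integrable_fin_num (measurableI _ _ mC mA)).
exact: (integrableS mC (measurableI _ _ mC mA) (@subIsetl _ _ _) h1i).
Qed.

Let fin2 (A : set TR) : measurable A -> J2 A \is a fin_num.
Proof.
move=> mA; apply: (integrable_fin_num (measurableI _ _ mC mA)).
exact: (integrableS mC (measurableI _ _ mC mA) (@subIsetl _ _ _) h2i).
Qed.

Let JT : J1 setT = J2 setT.
Proof.
have E t : (eit t + 0) / (eit t - 0) = 1 :> C.
  by rewrite addr0 subr0 divff // eit_neq0.
have := @kernel_eq 0; rewrite normc_0 => /(_ ltr01).
rewrite (@Cint_ext _ k1 circ _ (fun t => (h1 t)%:C%C)); last first.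
  by move=> t _; rewrite E mul1r.
rewrite (@Cint_ext _ k2 circ _ (fun t => (h2 t)%:C%C)); last first.
  by move=> t _; rewrite E mul1r.
rewrite !Cint_real // => /complexI H.
have f1 := fin1 measurableT; have f2 := fin2 measurableT.
rewrite -(fineK f1) -(fineK f2); congr EFin.
by rewrite /J1 /J2 !setIT.
Qed.

Let JC (A : set TR) : measurable A -> J1 A = J2 A -> J1 (~` A) = J2 (~` A).
Proof.
move=> mA EA; have mCA := measurableC mA.
have dis : circ `&` A `&` ~` A = set0 by rewrite -setIA setICr setI0.
have := JT; rewrite -(setUv A) JU1 // JU2 // EA.
have f2 := fin2 mA; rewrite -(fineK f2) -(fineK (fin1 mCA)) -(fineK (fin2 mCA)).
by rewrite -!EFinD => -[] /addrI ->.
Qed.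

Let JU (A B : set TR) : measurable A -> measurable B -> circ `&` A `&` B = set0 ->
  J1 A = J2 A -> J1 B = J2 B -> J1 (A `|` B) = J2 (A `|` B).
Proof. by move=> mA mB AB EA EB; rewrite JU1 // JU2 // EA EB. Qed.

Let Jbigcup (F : (set TR)^nat) : (forall n, measurable (F n)) ->
  trivIset [set: nat] F -> (forall n, J1 (F n) = J2 (F n)) ->
  J1 (\bigcup_k F k) = J2 (\bigcup_k F k).
Proof.
move=> mF tF EF; rewrite /J1 /J2 setI_bigcupr.
have mcF k : measurable (circ `&` F k) by exact: (measurableI _ _ mC (mF k)).
have tcF : trivIset [set: nat] (fun k => circ `&` F k).
  by apply: trivIset_setIl.
rewrite !integral_bigcup //.
- by apply: eq_eseriesr => i _; exact: EF.
- apply: (integrableS mC (bigcupT_measurable _ mcF) _ h2i).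
  by move=> t [k _ []].
- apply: (integrableS mC (bigcupT_measurable _ mcF) _ h1i).
  by move=> t [k _ []].
Qed.

Lemma arc_itv (b t : R) : 0 < b -> b <= pi *+ 2 -> 0 <= t -> t < pi *+ 2 ->
  (cos (b / 2) < cos (t - b / 2)) = (0 < t < b).
Proof.
move=> b0 b2 t0 t2; rewrite mulr2n in b2 t2; have p0 := @pi_gt0 R.
have E : cos (t - b / 2) - cos (b / 2) = 2 * (sin (t / 2) * sin ((b - t) / 2)).
  have -> : t - b / 2 = t / 2 - (b - t) / 2 by field.
  have -> : b / 2 = t / 2 + (b - t) / 2 by field.
  by rewrite cosB cosD; ring.
rewrite -subr_gt0 E pmulr_rgt0 //.
have [t00|tp] := eqVneq t 0; first by rewrite t00 mul0r sin0 mul0r ltxx.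
have {}t0 : 0 < t by rewrite lt_def tp.
rewrite t0 /= pmulr_rgt0; last by apply: sin_gt0_pi; lra.
have [tb|bt] := ltP t b; first by apply: sin_gt0_pi; lra.
apply/negbTE; rewrite -leNgt -oppr_ge0 -sinN.
by apply: sin_ge0_pi; lra.
Qed.

Let arc (b : R) : set TR := [set t | cos (b / 2) < cos (t - b / 2)].

Let measurable_arc b : measurable (arc b).
Proof.
rewrite (_ : arc b = setT `&` (fun t => cos (t - b / 2)) @^-1` `]cos (b / 2), +oo[%classic); last first.
  by rewrite setTI; apply/seteqP; split => t /=; rewrite in_itv /= andbT.
have mcos : measurable_fun (setT : set TR) (fun t => cos (t - b / 2)).
  apply: continuous_measurable_fun => t.
  apply: (@cvg_compose _ R R _ (fun t => t - b / 2)); first exact: continuous_cos.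
  by apply: cvgB; [exact: cvg_id|exact: cvg_cst].
by apply: mcos => //; exact: measurable_itv.
Qed.

Let Jarc b : J1 (arc b) = J2 (arc b).
Proof.
rewrite /J1 /J2 -!integral_indic_mul; apply: (arc_eq h1i h2i kernel_eq).
by rewrite cos_geN1 cos_le1.
Qed.

Let Jray x : J1 `]-oo, x[%classic = J2 `]-oo, x[%classic.
Proof.
have p2 := @pi2_gt0 R.
have [x0|x0] := leP x 0.
  have E : circ `&` `]-oo, x[%classic = set0 :> set TR.
    apply/seteqP; split => t //= []; rewrite /circ /= !in_itv /= => /andP[t0 _] tx.
    by move: (lt_le_trans tx x0); rewrite ltNge t0.
  by rewrite /J1 /J2 E !integral_set0.
have [xp|xp] := leP x (pi *+ 2); last first.
  have E : circ `&` `]-oo, x[%classic = circ `&` setT :> set TR.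
    apply/seteqP; split => t //= []; rewrite /circ /= !in_itv /= => /andP[t0 t2] _ //.
    by rewrite t0 t2 (lt_trans t2).
  by rewrite /J1 /J2 E; exact: JT.
have E : circ `&` `]-oo, x[%classic = circ `&` (~` (arc (pi *+ 2)) `|` arc x) :> set TR.
  apply/seteqP; split => t /= [] ct; have /andP[t0 t2] := ct;
    rewrite ?bnd_simp in t0 t2; rewrite in_itv /=.
    move=> tx; split=> //; rewrite /arc /=.
    have [->|t00] := eqVneq t 0.
      by left; rewrite arc_itv // ltxx.
    by right; rewrite arc_itv // tx lt_def t00 t0.
  rewrite /arc /=; case; rewrite arc_itv //.
    by move/negP; rewrite t2 andbT -leNgt => t00; rewrite (le_lt_trans t00).
  by case/andP.
rewrite /J1 /J2 E; apply: JU.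
- by apply: measurableC; exact: measurable_arc.
- exact: measurable_arc.
- apply/seteqP; split => t //= [[ct]]; have /andP[t0 t2] := ct.
  rewrite ?bnd_simp in t0 t2; rewrite /arc /= !arc_itv // t2 andbT => /negP.
  by rewrite -leNgt => t00 /andP[t01 _]; move: (lt_le_trans t01 t00); rewrite ltxx.
- by apply: JC; [exact: measurable_arc|exact: Jarc].
- exact: Jarc.
Qed.

Theorem kernel_unique (A : set TR) : measurable A ->
  (\int[k1]_(t in circ `&` A) (h1 t)%:E = \int[k2]_(t in circ `&` A) (h2 t)%:E)%E.
Proof.
have mE : @measurable _ TR = <<s @RGenInftyO.G R >> by exact: RGenInftyO.measurableE.
move=> mA; apply: (@dynkin_induction _ TR (@RGenInftyO.G R) (fun A => J1 A = J2 A) mE).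
- move=> _ _ [x ->] [y ->]; exists (Num.min x y).
  by apply/seteqP; split => t /=; rewrite !in_itv /= lt_min => /andP.
- exact: JT.
- by move=> _ [x ->]; exact: Jray.
- by move=> S mS; exact: JC.
- exact: Jbigcup.
- by rewrite -mE.
Qed.

End MeasureUniqueness.

(** * The Szego function *)

Section Density.
Context {R : realType}.
Local Notation C := R[i].
Local Notation TR := (measurableTypeR R).
Import HBNNSimple.

Section Fixed.
Variables (mu : {measure set TR -> \bar R}) (g : R -> R).
Hypothesis g0 : forall t, 0 <= g t.
Hypothesis mg : measurable_fun (circ : set TR) g.
Hypothesis gE : forall A : set TR, measurable A ->
  (mu (circ `&` A) = \int[leb]_(t in circ `&` A) (g t)%:E)%E.
Hypothesis mu_fin : (mu circ < +oo)%E.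

Let mC := @measurable_circ R.
Let meg : measurable_fun (circ : set TR) (EFin \o g).
Proof. exact/measurable_EFinP. Qed.

Lemma integrable_density : leb.-integrable (circ : set TR) (EFin \o g).
Proof.
apply/integrableP; split => //.
have := @gE setT measurableT; rewrite setIT => E.
have -> : (\int[leb]_(x in circ) `|(EFin \o g) x| = \int[leb]_(x in circ) (g x)%:E)%E.
  by apply: eq_integral => t _; rewrite /= ger0_norm.
by move: mu_fin; rewrite E.
Qed.

Lemma ge0_integral_density (f : R -> \bar R) : (forall x, (0 <= f x)%E) ->
  measurable_fun (circ : set TR) f ->
  (\int[leb]_(x in circ) (f x * (g x)%:E) = \int[mu]_(x in circ) f x)%E.
Proof.
move=> f0 mf.
pose h := nnsfun_approx mC mf.
have -> : (\int[mu]_(x in circ) f x =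
    lim (\int[mu]_(x in circ) (EFin \o h n) x @[n --> \oo]))%E.
  have fE x : circ x -> f x = lim ((EFin \o h n) x @[n --> \oo]).
    by move=> Ex; apply/esym/cvg_lim => //; exact: cvg_nnsfun_approx.
  under eq_integral => x /[!inE] /fE -> //.
  apply: monotone_convergence => //.
  - move=> n; apply/measurable_EFinP.
    by apply: (measurable_funS measurableT) => //; exact/measurable_funP.
  - by move=> n x Ex //=; rewrite lee_fin.
  - by move=> x Ex a b ab; rewrite lee_fin; exact/lefP/nd_nnsfun_approx.
have -> : (\int[leb]_(x in circ) (f x * (g x)%:E) =
    lim (\int[leb]_(x in circ) ((EFin \o h n) x * (g x)%:E) @[n --> \oo]))%E.
  have fg x : circ x -> (f x * (g x)%:E = lim ((EFin \o h n) x * (g x)%:E @[n --> \oo]))%E.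
    by move=> Ex; apply/esym/cvg_lim => //; apply: cvgeZr => //; exact: cvg_nnsfun_approx.
  under eq_integral => x /[!inE] /fg -> //.
  apply: monotone_convergence => [//| | |].
  - move=> n; apply/emeasurable_funM => //; apply/measurable_funTS.
    exact/measurable_EFinP.
  - by move=> n x Ex /=; rewrite mule_ge0 ?lee_fin.
  - by move=> x Ex a b ab/=; rewrite lee_wpmul2r ?lee_fin //; exact/lefP/nd_nnsfun_approx.
suff suf n : (\int[leb]_(x in circ) ((EFin \o h n) x * (g x)%:E) =
    \int[mu]_(x in circ) (EFin \o h n) x)%E.
  by under eq_fun do rewrite suf.
transitivity (\int[mu]_(x in circ)
   (\sum_(y \in range (h n)) (y * \1_(h n @^-1` [set y]) x)%:E))%E; last first.
  by apply: eq_integral => t tE; rewrite /= fimfunE -fsumEFin.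
have indich m r : measurable_fun (circ : set TR) (fun x => (r * \1_(h m @^-1` [set r]) x)%:E).
  by apply: (measurable_comp measurableT) => //; exact: measurable_funM.
rewrite ge0_integral_fsum//; last by move=> m y Ey; exact: nnfun_muleindic_ge0.
transitivity (\int[leb]_(x in circ) (\sum_(y \in range (h n))
    (y * \1_(h n @^-1` [set y]) x)%:E * (g x)%:E))%E.
  under [RHS]eq_integral => x xE.
    rewrite -ge0_mule_fsuml => [|y]; last exact: nnfun_muleindic_ge0.
    rewrite fsumEFin // -(fimfunE _ x); over.
  by [].
rewrite ge0_integral_fsum//; last 2 first.
  - by move=> y; apply: emeasurable_funM.
  - by move=> m y Ey; apply: mule_ge0; [exact: nnfun_muleindic_ge0|rewrite lee_fin].
apply: eq_fsbigr => r rhn.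
under [RHS]eq_integral do rewrite EFinM.
rewrite integralZl_indic_nnsfun => //.
under eq_integral do rewrite EFinM -muleA.
have mhr : measurable (h n @^-1` [set r] : set TR) by exact: measurable_funPTI.
have r0 : (0 <= r)%R by move: rhn; rewrite inE => -[x _ <-]; exact: fun_ge0.
rewrite ge0_integralZl//.
- congr (_ * _)%E; rewrite integral_indic// setIC gE //.
  rewrite integral_mkcondr; apply: eq_integral => x _.
  by rewrite patchE indicE; case: (x \in _); rewrite ?mul1e ?mul0e.
- apply: emeasurable_funM => //; exact/measurable_EFinP.
- by move=> x _; rewrite mule_ge0 // lee_fin.
Qed.

Lemma Rintegral_density (f : R -> R) (M : R) : measurable_fun (circ : set TR) f ->
  (forall t, `|f t| <= M) -> \int[mu]_(t in circ) f t = \int[leb]_(t in circ) (f t * g t).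
Proof.
move=> mf fM; have M0 : 0 <= M by rewrite (le_trans _ (fM 0)).
have gi := integrable_density.
have key (F : R -> R) : measurable_fun (circ : set TR) F -> (forall t, 0 <= F t) ->
    \int[mu]_(t in circ) F t = \int[leb]_(t in circ) (F t * g t).
  move=> mF F0; rewrite /Rintegral; congr fine; symmetry.
  rewrite -(@ge0_integral_density (EFin \o F)) //; last exact/measurable_EFinP.
have fi : mu.-integrable (circ : set TR) (EFin \o f).
  by apply: measurable_bounded_integrable => //; apply: (@bounded_onP _ _ _ M) => t _.
have Mi : mu.-integrable (circ : set TR) (EFin \o (fun=> M)).
  by apply: measurable_bounded_integrable => //; apply: (@bounded_onP _ _ _ M) => t _; rewrite ger0_norm.
have fgi : leb.-integrable (circ : set TR) (EFin \o (fun t => f t * g t)).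
  by apply: (@rintegrable_mulb _ leb _ mC g _ M gi).
have Mgi : leb.-integrable (circ : set TR) (EFin \o (fun t => M * g t)).
  by apply: (@rintegrable_mulb _ leb _ mC g _ M gi) => // t _; rewrite ger0_norm.
have K1 := key (fun t => f t + M) (measurable_funD mf (measurable_cst _)).
have {}K1 : \int[mu]_(t in circ) (f t + M) = \int[leb]_(t in circ) ((f t + M) * g t).
  by apply: K1 => t; have := fM t; rewrite ler_norml => /andP[a b]; lra.
have K2 := key (fun=> M) (measurable_cst _) (fun=> M0).
move: K1; rewrite RintegralD // K2.
under [X in _ = X -> _]eq_Rintegral do rewrite mulrDl.
by rewrite RintegralD // => /addIr.
Qed.

Lemma Cint_density (phi : R -> C) (M : R) : cmeas (circ : set TR) phi ->
  (forall t, N (phi t) <= M) ->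
  Cint mu circ phi = Cint leb circ (fun t => phi t * (g t)%:C%C).
Proof.
move=> [mr mi] pM; apply: complex_ext; rewrite ?Re_Cint ?Im_Cint.
  rewrite (@Rintegral_density _ M) // => [|t]; last by rewrite (le_trans (normcRe _)).
  by apply: eq_Rintegral => t _; rewrite cReM /= mulr0 subr0.
rewrite (@Rintegral_density _ M) // => [|t]; last by rewrite (le_trans (normcIm _)).
by apply: eq_Rintegral => t _; rewrite cImM /= mulr0 add0r.
Qed.

End Fixed.
End Density.

Section SzegoCondition.
Context {R : realType}.
Local Notation C := R[i].
Local Notation TR := (measurableTypeR R).

Let mC := @measurable_circ R.

Lemma circle_prob_circ (mu : {measure set TR -> \bar R}) : circle_prob mu -> mu (circ : set TR) = 1%E.
Proof.
move=> [m1 m0]; have mCc := measurableC mC.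
have := @measureU _ _ _ mu circ (~` circ) mC mCc (setICr _).
rewrite setUv => E; have {}E : (1 = mu circ + 0)%E by rewrite -m1 -m0; exact: E.
by move: E; rewrite adde0.
Qed.

Section Decomposition.
Variables (mu : {measure set TR -> \bar R}) (w : R -> R).
Hypothesis mu1 : circle_prob mu.
Hypothesis dec : lebesgue_decomp mu w mzero.

Let g t := w t / (pi *+ 2).

Lemma weight_ge0 t : 0 <= g t.
Proof. by case: dec => w0 _; rewrite divr_ge0 // ltW // pi2_gt0. Qed.

Lemma weight_meas : measurable_fun (circ : set TR) g.
Proof.
case: dec => _ [mw _]; apply: measurable_funM => //.
Qed.

Lemma weight_density (A : set TR) : measurable A ->
  (mu (circ `&` A) = \int[leb]_(t in circ `&` A) (g t)%:E)%E.
Proof.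
move=> mA; case: dec => _ [_ [_ ->]]; last exact: measurableI.
by rewrite /mzero adde0; congr integral; rewrite setIAC setIid.
Qed.

Lemma mu_circ_fin : (mu circ < +oo)%E.
Proof. by rewrite circle_prob_circ // ltry. Qed.

Lemma weight_integrable : leb.-integrable (circ : set TR) (EFin \o g).
Proof.
exact: integrable_density weight_ge0 weight_meas weight_density mu_circ_fin.
Qed.

Lemma weight_int : (\int[leb]_(t in circ) (g t)%:E = 1)%E.
Proof. by have := weight_density measurableT; rewrite setIT circle_prob_circ. Qed.

Lemma mu_to_weight (phi : R -> C) (M : R) : cmeas (circ : set TR) phi ->
  (forall t, N (phi t) <= M) ->
  Cint mu circ phi = Cint leb circ (fun t => phi t * (g t)%:C%C).
Proof.
exact: (Cint_density weight_ge0 weight_meas weight_density mu_circ_fin).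
Qed.

Hypothesis sz : szego_cond w.

Let L t := (logE (w t) * ((pi *+ 2)^-1)%:E)%E.

Let mL : measurable_fun (circ : set TR) L.
Proof.
case: dec => _ [mw _].
apply: emeasurable_funM; last exact: measurable_cst.
apply: (@measurableT_comp _ _ _ _ _ _ (@logE R)) => //.
apply: measurable_fun_ifT; last exact: measurable_cst.
  by apply: measurable_fun_ltr => //; exact: measurable_cst.
by apply/measurable_EFinP; exact: measurable_ln.
Qed.

Let L_integrable : leb.-integrable (circ : set TR) L.
Proof.
have w0 t : 0 <= w t by case: dec.
have p2 := @pi2_gt0 R.
have Lp t : (L^\+ t <= (g t)%:E)%E.
  rewrite funeposE /L /logE ge_max lee_fin weight_ge0 andbT.
  case: ifPn => wt; last by rewrite mulNyr gtr0_sg ?invr_gt0 // mul1e leNye.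
  rewrite -EFinM lee_fin /g ler_wpM2r ?invr_ge0 ?(ltW p2) //.
  exact/ltW/ln_sublinear.
have Lpoo : (\int[leb]_(t in circ) L^\+ t < +oo)%E.
  apply: (@le_lt_trans _ _ 1%E); last exact: ltry.
  rewrite -weight_int; apply: ge0_le_integral => //.
  - exact: measurable_funepos.
  - by apply/measurable_EFinP; exact: weight_meas.
have Lp0 : (0 <= \int[leb]_(t in circ) L^\+ t)%E by apply: integral_ge0.
have Ln0 : (0 <= \int[leb]_(t in circ) L^\- t)%E by apply: integral_ge0.
have Lnoo : (\int[leb]_(t in circ) L^\- t < +oo)%E.
  have : (-oo < \int[leb]_(t in circ) L t)%E := sz.
  rewrite integralE; case: (\int[leb]_(t in circ) L^\- t)%E => [r _||//].
    by rewrite ltry.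
  by rewrite addeNy // ltxx.
apply/integrableP; split => //.
have -> : (\int[leb]_(t in circ) `|L t| = \int[leb]_(t in circ) (L^\+ t + L^\- t))%E.
  by apply: eq_integral => t _; have := congr1 (fun f => f t) (fune_abse L).
rewrite ge0_integralD //.
- by rewrite lte_add_pinfty.
- exact: measurable_funepos.
- exact: measurable_funeneg.
Qed.

Lemma weight_pos_ae : {ae leb, forall t, circ t -> 0 < w t}.
Proof.
apply: filterS (integrable_ae mC L_integrable) => t H /H.
rewrite /L /logE; case: ifPn => // _.
by rewrite mulNyr gtr0_sg ?mul1e // invr_gt0 pi2_gt0.
Qed.

Lemma measurable_ln_weight : measurable_fun (circ : set TR) (fun t => ln (w t)).
Proof.
by case: dec => _ [mw _]; apply: (@measurableT_comp _ _ _ _ _ _ (@ln R)).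
Qed.

Lemma ln_weight_integrable : leb.-integrable (circ : set TR) (EFin \o (fun t => ln (w t))).
Proof.
have p2 := @pi2_gt0 R.
have Li := integrableZl mC (pi *+ 2) L_integrable.
apply: (le_integrable mC _ _ Li); first by apply/measurable_EFinP; exact: measurable_ln_weight.
move=> t _; rewrite /L /logE /=; case: ifPn => wt.
  by rewrite -!EFinM lee_fin mulrCA mulfV ?gt_eqF // mulr1.
by rewrite ln0 ?normr0; [exact: abse_ge0|rewrite leNgt].
Qed.

End Decomposition.

Lemma kernel_Re (z : C) t : N z < 1 -> 0 < Re ((eit t + z) / (eit t - z)).
Proof.
move=> z1; have ne : eit t - z != 0.
  by rewrite subr_eq0; apply: contraTneq z1 => <-; rewrite normc_eit ltxx.
have E : Re ((eit t + z) / (eit t - z)) = (1 - N z ^+ 2) / N (eit t - z) ^+ 2.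
  rewrite cReM cReV cImV cReD cImD cReB cImB.
  have cs := cos2Dsin2 t; rewrite normc_sqr cReB cImB normc_sqr /=.
  rewrite -cs; field.
  have : N (eit t - z) ^+ 2 != 0 by rewrite expf_neq0 // normc_eq0.
  by rewrite normc_sqr cReB cImB.
rewrite E divr_gt0 ?exprn_gt0 ?normc_gt0 // subr_gt0.
by rewrite expr_lt1 // normc_ge0.
Qed.

Lemma kernel_norm (z : C) t : N z < 1 -> N ((eit t + z) / (eit t - z)) <= 2 / (1 - N z).
Proof.
move=> z1; have d0 : 0 < 1 - N z by rewrite subr_gt0.
have H := normc_lB (eit t) z; rewrite normc_eit in H.
rewrite normc_M normc_V ler_pM ?normc_ge0 ?invr_ge0 ?normc_ge0 //.
  by rewrite (le_trans (normc_D _ _)) // normc_eit; lra.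
by rewrite lef_pV2 ?posrE // (lt_le_trans d0).
Qed.

Lemma kernel_Re_ge (z : C) t : N z < 1 ->
  (1 - N z ^+ 2) / 4 <= Re ((eit t + z) / (eit t - z)).
Proof.
move=> z1; have ne : eit t - z != 0.
  by rewrite subr_eq0; apply: contraTneq z1 => <-; rewrite normc_eit ltxx.
have E : Re ((eit t + z) / (eit t - z)) = (1 - N z ^+ 2) / N (eit t - z) ^+ 2.
  rewrite cReM cReV cImV cReD cImD cReB cImB.
  have cs := cos2Dsin2 t; rewrite normc_sqr cReB cImB normc_sqr /=.
  rewrite -cs; field.
  have : N (eit t - z) ^+ 2 != 0 by rewrite expf_neq0 // normc_eq0.
  by rewrite normc_sqr cReB cImB.
have z2 : N z ^+ 2 < 1 by rewrite expr_lt1 // normc_ge0.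
rewrite E ler_wpM2l ?subr_ge0 ?(ltW z2) // lef_pV2 ?posrE ?exprn_gt0 ?normc_gt0 //.
have : N (eit t - z) <= 2.
  by rewrite (le_trans (normc_B _ _)) // normc_eit; lra.
have -> : (4 : R) = 2 ^+ 2 by ring.
by move=> H; rewrite ler_pXn2r ?nnegrE ?normc_ge0.
Qed.

Lemma cmeas_szego_kernel (z : C) : N z < 1 ->
  cmeas (circ : set TR) (fun t => (eit t + z) / (eit t - z)).
Proof.
move=> z1; have zn : N z != 1 by rewrite lt_eqF.
apply: (cmeas_ext _ (@cmeas_circle _ (fun y => (y + z) / (y - z)) 1 _)) => t.
  by rewrite mul1r.
apply: ccontM; first by apply: ccontD; [exact: ccont_id|exact: ccont_cst].
by apply: ccontV; [exact: circle_ne|exact/cdiff_cont/cdiff_subl].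
Qed.

Lemma kernel_int (z : C) : N z < 1 ->
  Cint leb (circ : set TR) (fun t => (eit t + z) / (eit t - z)) = twopi.
Proof.
move=> z1; have H := @schwarz_formula _ (fun=> 1) 2 z z1.
rewrite /= mulr0 subr0 mul1r in H; rewrite -H ?ltr1n => [||y _]; last exact: cdiff_cst.
  by apply: Cint_ext => t _; rewrite mulr1.
by [].
Qed.

Section Caratheodory.
Variable mu : {measure set TR -> \bar R}.
Hypothesis mu1 : circle_prob mu.

Let mufin : (mu circ < +oo)%E.
Proof. by rewrite circle_prob_circ // ltry. Qed.

Lemma cintegrable_cst (c : C) : cintegrable mu (circ : set TR) (fun=> c).
Proof. by apply: (@cintegrable_bounded _ mu _ mC _ (N c)) => //; exact: cmeas_cst. Qed.

Lemma cdiff_carath z : N z < 1 -> cdiff (carath mu) z.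
Proof.
move=> z1; have zn : N z != 1 by rewrite lt_eqF.
apply: (cdiff_ext _ (cdiff_kernel_int (cintegrable_cst 1) ler01 zn)) => y.
by rewrite /carath cintE; apply: Cint_ext => t _; rewrite mul1r mulr1.
Qed.

Lemma carath0 : carath mu 0 = 1.
Proof.
rewrite /carath cintE (@Cint_ext _ mu _ _ (fun=> 1)).
  by rewrite Cint_cst // circle_prob_circ // mulr1.
by move=> t _; rewrite addr0 subr0 divff // eit_neq0.
Qed.

Lemma carath_Re_gt0 z : N z < 1 -> 0 < Re (carath mu z).
Proof.
move=> z1; have z2 : N z ^+ 2 < 1 by rewrite expr_lt1 // normc_ge0.
apply: (@lt_le_trans _ _ ((1 - N z ^+ 2) / 4)); first by rewrite divr_gt0 // subr_gt0.
rewrite /carath cintE Re_Cint.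
have ki : cintegrable mu (circ : set TR) (fun t => (eit t + z) / (eit t - z)).
  apply: (@cintegrable_bounded _ mu _ mC _ (2 / (1 - N z))) => //.
    exact: cmeas_szego_kernel.
  by move=> t _; exact: kernel_norm.
have -> : (1 - N z ^+ 2) / 4 = \int[mu]_(t in circ) ((1 - N z ^+ 2) / 4).
  by rewrite Rintegral_cst // circle_prob_circ // mulr1.
apply: le_Rintegral => //.
- by have [] := cintegrable_cst ((1 - N z ^+ 2) / 4)%:C%C.
- by case: ki.
- by move=> t _; exact: kernel_Re_ge.
Qed.

Lemma carath_add1_neq0 z : N z < 1 -> carath mu z + 1 != 0.
Proof.
move=> z1; have := carath_Re_gt0 z1; apply: contraTneq => E.
have -> : carath mu z = -1 by apply/eqP; rewrite -addr_eq0 E.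
by rewrite /= ltNge oppr_le0 ler01.
Qed.

End Caratheodory.

Definition szego_log (w : R -> R) (z : C) : C :=
  cint leb (fun t => (eit t + z) / (eit t - z) * (ln (w t))%:C%C / (pi *+ 4)%:C%C).

Lemma szegoE w z : szego w z = cexp (szego_log w z).
Proof. by []. Qed.

Section SzegoLog.
Variable w : R -> R.
Hypothesis lw : leb.-integrable (circ : set TR) (EFin \o (fun t => ln (w t))).

Let fourpi : C := (pi *+ 4 : R)%:C%C.
Let fourpi0 : fourpi != 0.
Proof. by rewrite realC_eq0 gt_eqF // mulrn_wgt0 // pi_gt0. Qed.

Lemma kernel_ln_integrable z : N z < 1 ->
  cintegrable leb (circ : set TR) (fun t => (eit t + z) / (eit t - z) * (ln (w t))%:C%C).
Proof.
move=> z1; apply: (@cintegrable_mulb _ leb _ mC _ _ (2 / (1 - N z))).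
- exact: cintegrable_real.
- exact: cmeas_szego_kernel.
- by move=> t _; exact: kernel_norm.
Qed.

Lemma szego_logE z : N z < 1 -> szego_log w z =
  Cint leb (circ : set TR) (fun t => (eit t + z) / (eit t - z) * (ln (w t))%:C%C) / fourpi.
Proof.
move=> z1; rewrite /szego_log cintE mulrC -CintZ //; last exact: kernel_ln_integrable.
by apply: Cint_ext => t _; rewrite mulrC.
Qed.

Lemma cdiff_szego_log z : N z < 1 -> cdiff (szego_log w) z.
Proof.
move=> z1; have zn : N z != 1 by rewrite lt_eqF.
have d0 : 0 < 1 - N z by rewrite subr_gt0.
pose G (z : C) := Cint leb (circ : set TR) (fun t => (1%:C%C * eit t + z) / (1%:C%C * eit t - z) * (ln (w t))%:C%C) / fourpi.
apply: (@cdiff_near _ G _ _ _ d0) => [y yz|].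
  have y1 : N y < 1 by have := normc_lB y z; lra.
  rewrite /G (szego_logE y1); congr (_ / _); apply: Cint_ext => t _.
  by rewrite mul1r.
apply: cdiffM; last exact: cdiff_cst.
exact: (cdiff_kernel_int (cintegrable_real lw) ler01 zn).
Qed.

Lemma Im_szego_log0 : Im (szego_log w 0) = 0.
Proof.
have n0 : N (0 : C) < 1 by rewrite normc_0.
rewrite szego_logE // (@Cint_ext _ _ _ _ (fun t => (ln (w t))%:C%C)).
  by rewrite Cint_real // -realCV -realCM.
by move=> t _; rewrite addr0 subr0 divff ?mul1r // eit_neq0.
Qed.

End SzegoLog.

Section Jensen.
Variables (mu : {measure set TR -> \bar R}) (w : R -> R).
Hypothesis mu1 : circle_prob mu.
Hypothesis dec : lebesgue_decomp mu w mzero.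
Hypothesis sz : szego_cond w.

(* Jensen's inequality for the Poisson kernel, via the tangent line
   [ln x <= ln c + x / c - 1] at a suitable [c]; the factor [expR 1] makes the
   inequality true also where [w] vanishes (there [ln] is [0]). *)
Lemma szego_growth z : N z < 1 ->
  N (szego w z) ^+ 2 <= expR 1 * (2 / (1 - N z)).
Proof.
move=> z1; have d0 : 0 < 1 - N z by rewrite subr_gt0.
have w0 t : 0 <= w t by case: dec.
have lw := ln_weight_integrable mu1 dec sz.
have p2 := @pi2_gt0 R; have p0 := @pi_gt0 R.
pose c := expR 1 * (2 / (1 - N z)).
have k2 : 1 <= 2 / (1 - N z) by rewrite ler_pdivlMr // mul1r; have := normc_ge0 z; lra.
have c0 : 0 < c by rewrite mulr_gt0 ?expR_gt0 // divr_gt0.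
have lnc : 1 <= ln c.
  rewrite lnM ?posrE ?expR_gt0 ?divr_gt0 // expRK lerDl.
  exact: ln_ge0.
have tangent t : ln (w t) <= ln c - 1 + w t / c.
  have := w0 t; rewrite le_eqVlt => /predU1P[<-|wt].
    by rewrite ln0 // mul0r addr0 subr_ge0.
  have := @le_ln1Dx _ (w t / c - 1).
  have -> : 1 + (w t / c - 1) = w t / c by ring.
  rewrite ln_div ?posrE // => H.
  have wc : 0 < w t / c by rewrite divr_gt0.
  have {}H := H ltac:(lra); lra.
pose P t := Re ((eit t + z) / (eit t - z)).
have P0 t : 0 <= P t by exact/ltW/kernel_Re.
have PM t : `|P t| <= 2 / (1 - N z).
  by rewrite (le_trans (normcRe _)) // kernel_norm.
have [mP _] := cmeas_szego_kernel z1.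
have kl := kernel_ln_integrable lw z1.
have RE : Re (szego_log w z) = (\int[leb]_(t in circ) (P t * ln (w t))) / (pi *+ 4).
  rewrite szego_logE //; set I := Cint _ _ _.
  have RI : Re I = \int[leb]_(t in circ) Re ((eit t + z) / (eit t - z) * (ln (w t))%:C%C).
    by rewrite Re_Cint.
  move: I RI => I RI; rewrite -realCV cReM Rereal Imreal mulr0 subr0 RI; congr (_ / _).
  by apply: eq_Rintegral => t _; rewrite cReM /= mulr0 subr0.
have Pi : leb.-integrable (circ : set TR) (EFin \o P).
  by apply: measurable_bounded_integrable => //; [exact: leb_circ_lty|apply: bounded_onP => t _; exact: PM].
have Pint : \int[leb]_(t in circ) P t = pi *+ 2.
  by have := congr1 (fun x => Re x) (kernel_int z1); rewrite Re_Cint.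
have gi := weight_integrable mu1 dec.
have Pw : leb.-integrable (circ : set TR) (EFin \o (fun t => P t * (w t / (pi *+ 2)))).
  exact: (@rintegrable_mulb _ leb _ mC _ P _ gi mP (fun t _ => PM t)).
have Pl : leb.-integrable (circ : set TR) (EFin \o (fun t => P t * ln (w t))).
  exact: (@rintegrable_mulb _ leb _ mC _ P _ lw mP (fun t _ => PM t)).
have PwM : \int[leb]_(t in circ) (P t * (w t / (pi *+ 2))) <= 2 / (1 - N z).
  apply: (@le_trans _ _ (\int[leb]_(t in circ) (2 / (1 - N z) * (w t / (pi *+ 2))))).
    apply: le_Rintegral => //; first exact: (eq_integrable mC _ _ _ (integrableZl mC _ gi)).
    move=> t _; rewrite ler_wpM2r //; first exact: weight_ge0 dec t.
    by have := PM t; rewrite ger0_norm.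
  rewrite RintegralZl // /Rintegral (weight_int mu1 dec) /= mulr1 //.
have bound : \int[leb]_(t in circ) (P t * ln (w t)) <=
   (ln c - 1) * (pi *+ 2) + (pi *+ 2) / c * (2 / (1 - N z)).
  apply: (@le_trans _ _ (\int[leb]_(t in circ) ((ln c - 1) * P t + (pi *+ 2) / c * (P t * (w t / (pi *+ 2)))))).
    have I1 : leb.-integrable (circ : set TR) (EFin \o (fun t => (ln c - 1) * P t)).
      exact: (eq_integrable mC _ _ _ (integrableZl mC _ Pi)).
    have I2 : leb.-integrable (circ : set TR) (EFin \o (fun t => (pi *+ 2) / c * (P t * (w t / (pi *+ 2))))).
      exact: (eq_integrable mC _ _ _ (integrableZl mC _ Pw)).
    apply: le_Rintegral => //; first exact: rintegrableD.
    move=> t _; have -> : (ln c - 1) * P t + (pi *+ 2) / c * (P t * (w t / (pi *+ 2))) = P t * (ln c - 1 + w t / c).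
      by move: (pi *+ 2) p2 => p2 p20; field; rewrite !gt_eqF.
    by rewrite ler_wpM2l.
  rewrite RintegralD ?RintegralZl ?Pint //; last 2 first.
  - exact: (eq_integrable mC _ _ _ (integrableZl mC _ Pi)).
  - exact: (eq_integrable mC _ _ _ (integrableZl mC _ Pw)).
  by rewrite lerD2l ler_wpM2l // divr_ge0 ?ltW.
have final : 2 * Re (szego_log w z) <= ln c.
  rewrite RE; have -> : 2 * ((\int[leb]_(t in circ) (P t * ln (w t))) / (pi *+ 4)) =
    (\int[leb]_(t in circ) (P t * ln (w t))) / (pi *+ 2).
    have -> : pi *+ 4 = 2 * (pi *+ 2) :> R by rewrite -[LHS]mulr_natl -[pi *+ 2]mulr_natl mulrA -natrM.
    by rewrite mulrCA invfM mulVKf // pnatr_eq0.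
  rewrite ler_pdivrMr //; apply: (le_trans bound).
  have -> : (pi *+ 2) / c * (2 / (1 - N z)) = (pi *+ 2) / expR 1.
    by rewrite /c; field; rewrite !gt_eqF ?expR_gt0.
  have : (pi *+ 2) / expR 1 <= pi *+ 2 :> R.
    by rewrite ler_pdivrMr ?expR_gt0 // ler_pMr // -expR0 ler_expR.
  lra.
rewrite szegoE normc_cexp -expRM_natl -/c -[leRHS](@lnK _ c) ?posrE //.
by rewrite ler_expR.
Qed.

End Jensen.
End SzegoCondition.

Section Logarithm.
Context {R : realType}.
Local Notation C := R[i].
Local Notation TR := (measurableTypeR R).
Let mC := @measurable_circ R.

Definition clog (z : C) : C := (ln (N z) +i* atan (Im z / Re z))%C.

Lemma cexp_clog z : 0 < Re z -> cexp (clog z) = z.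
Proof.
move=> z0; have zn : z != 0 by apply: contraTneq z0 => ->; rewrite ltxx.
have Nz : 0 < N z by rewrite normc_gt0.
rewrite cexpE /= lnK ?posrE // /eit.
set q := Im z / Re z.
have c0 : cos (atan q) = Re z / N z.
  rewrite cos_atan; have -> : 1 + q ^+ 2 = (N z / Re z) ^+ 2.
    by rewrite !expr_div_n normc_sqr; field; rewrite gt_eqF.
  by rewrite sqrtr_sqr ger0_norm ?invf_div // divr_ge0 ?ltW.
have s0 : sin (atan q) = Im z / N z.
  have := atanK q; rewrite /tan c0 => /(canRL (divfK _)) ->.
    by rewrite /q; field; rewrite !gt_eqF.
  by rewrite mulf_neq0 // ?invr_neq0 // gt_eqF.
by rewrite c0 s0; apply: complex_ext; rewrite ?cReM ?cImM /=; field; rewrite gt_eqF.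
Qed.

Lemma ccont_clog z : 0 < Re z -> ccont clog z.
Proof.
move=> z0; have zn : z != 0 by apply: contraTneq z0 => ->; rewrite ltxx.
have idc : (id : C^o -> C^o) @ (z : C^o) --> (z : C^o) by exact: cvg_id.
have FF := nbhs_filter (z : C^o).
split; apply/(@ccvg_ReIm R C^o (nbhs (z : C^o)) FF); split => /=.
  apply: (@cvg_compose C^o R R (nbhs (z : C^o)) (fun y => N y) (@ln R) (N z)).
    by apply: continuous_ln; rewrite normc_gt0.
  exact: (@ccvg_norm R C^o (nbhs (z : C^o)) FF id z idc).
apply: (@cvg_compose C^o R R (nbhs (z : C^o)) (fun y => Im y / Re y) (@atan R) (Im z / Re z)).
  exact: continuous_atan.
apply: (@cvgM R).
  exact: (@ccvg_Im R C^o (nbhs (z : C^o)) FF id z idc).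
apply: (@cvgV R); first by rewrite gt_eqF.
exact: (@ccvg_Re R C^o (nbhs (z : C^o)) FF id z idc).
Qed.

Lemma cdiff_clog z : 0 < Re z -> cdiff clog z.
Proof.
move=> z0; have [E [Ec Ez EE]] := cexp_quotient (clog z).
have lc := ccont_clog z0.
have En : E (clog z) != 0 by rewrite Ez cexp_neq0.
apply/cdiffP; exists (fun y => (E (clog y))^-1); split.
  by apply: ccontV => //; exact: ccont_comp lc Ec.
exists (Re z) => // y yz.
have y0 : 0 < Re y by have := normcRe (y - z); rewrite cReB ler_norml => /andP[a b]; lra.
have H := EE (clog y); rewrite !cexp_clog // in H.
have [Ey|Ey] := eqVneq (E (clog y)) 0; last by rewrite {2}H; field.
have yz' : y = z by rewrite H Ey mulr0 addr0.
by rewrite yz' subrr mul0r addr0.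
Qed.

Lemma zero_free_larger (v : C -> C) b : 1 < b -> (forall y : C, N y < b -> ccont v y) ->
  (forall y : C, N y <= 1 -> v y != 0) ->
  exists b', [/\ 1 < b', b' <= b & forall y : C, N y < b' -> v y != 0].
Proof.
move=> b1 vc v0.
have H t : exists2 e : R, 0 < e & forall z : C, N (z - 1%:C%C * eit t) < e -> v z != 0.
  have n1 : N (1%:C%C * eit t : C) = 1 by rewrite normc_circle_pos.
  have vt : 0 < N (v (1%:C%C * eit t)) by rewrite normc_gt0 v0 // n1.
  have /ccontP/(_ _ vt)[d d0 Hd] := vc (1%:C%C * eit t) ltac:(by rewrite n1).
  exists d => // z /Hd zd; apply: contraTneq zd => ->.
  by rewrite sub0r normc_N ltxx.
have [d d0 Hd] := near_circle_pred H.
exists (Num.min b (1 + d)); split.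
- by rewrite lt_min b1 ltrDl.
- by rewrite ge_min lexx.
move=> y; rewrite lt_min => /andP[yb yd]; have [y1|y1] := leP (N y) 1; first exact: v0.
have [t [tt yE]] := polar y; rewrite yE; apply: Hd => //.
by rewrite ger0_norm; lra.
Qed.

Lemma circle_sup_lt1 (v : C -> C) : (forall t, ccont v (1%:C%C * eit t)) ->
  (forall t, N (v (1%:C%C * eit t)) < 1) ->
  exists2 M : R, M < 1 & forall t, N (v (1%:C%C * eit t)) <= M.
Proof.
move=> vc v1.
have [d d0 H] : exists2 d : R, 0 < d & forall x t, `|x - 0| < d -> 0 <= t <= pi *+ 2 ->
    N (v (1%:C%C * eit t)) < 1 - x.
  apply: near_circle => t _.
  have g0 : 0 < (1 - N (v (1%:C%C * eit t))) / 2 by rewrite divr_gt0 // subr_gt0.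
  have /ccontP/(_ _ g0)[d1 d10 H1] := vc t.
  have [d d0 Hd] := near_circleC 1 t d10.
  exists (Num.min d ((1 - N (v (1%:C%C * eit t))) / 2)); first by rewrite lt_min d0.
  move=> x t'; rewrite subr0 !lt_min => /andP[_ x2] /andP[tt _].
  have := H1 _ (Hd 1 t' _ tt); rewrite subrr normr0 => /(_ d0) A.
  have B := normc_lB (v (1%:C%C * eit t')) (v (1%:C%C * eit t)).
  have := ler_norm x; lra.
exists (1 - d / 2) => [|t]; first lra.
have [t' tt' ->] := eit_mod t; apply/ltW/H => //.
by rewrite subr0 ger0_norm; lra.
Qed.

Lemma unimodular_ball (T U : C -> C) b : 1 < b -> (forall y : C, N y < b -> cdiff T y) ->
  (forall y : C, N y < b -> cdiff U y) -> (forall y : C, N y <= 1 -> T y != 0) ->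
  (forall y : C, N y = 1 -> N (U y) < N (T y)) ->
  forall y : C, N y <= 1 -> N (U y) < N (T y).
Proof.
move=> b1 Td Ud T0 TU y y1.
have [b' [b'1 b'b Tb]] := zero_free_larger b1 (fun y yb => cdiff_cont (Td y yb)) T0.
pose v y := U y / T y.
have vd y' : N y' < b' -> cdiff v y'.
  move=> yb; apply: cdiff_div; [exact: Tb|apply: Ud|apply: Td]; exact: lt_le_trans yb b'b.
have n1 t : N (1%:C%C * eit t : C) = 1 by rewrite normc_circle_pos.
have vc t : ccont v (1%:C%C * eit t) by apply/cdiff_cont/vd; rewrite n1.
have [|M M1 HM] := circle_sup_lt1 vc.
  move=> t; have Tt : 0 < N (T (1%:C%C * eit t)) by rewrite normc_gt0 T0 // n1.
  have -> : N (v (1%:C%C * eit t)) = N (U (1%:C%C * eit t)) / N (T (1%:C%C * eit t)).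
    by rewrite -normc_V -normc_M.
  by rewrite ltr_pdivrMr // [ltRHS]mul1r; apply: TU.
have [y1'|y1'] := ltP (N y) 1; last by apply: TU; apply/le_anti; rewrite y1.
have := max_modulus y1' b'1 vd HM; rewrite normc_M normc_V => H.
have Ty : 0 < N (T y) by rewrite normc_gt0 T0.
by have := le_lt_trans H M1; rewrite ltr_pdivrMr // mul1r.
Qed.

Lemma ccont_ln_norm (v : C -> C) y : ccont v y -> v y != 0 ->
  ccont (fun y => (ln (N (v y)))%:C%C) y.
Proof.
move=> vy v0; split; apply: (@ccvg_real R C^o (nbhs (y : C^o)) (nbhs_filter (y : C^o))).
apply: (@cvg_compose C^o R R (nbhs (y : C^o)) (fun y => N (v y)) (@ln R) (N (v y))).
  by apply: continuous_ln; rewrite normc_gt0.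
exact: (@ccvg_norm R C^o (nbhs (y : C^o)) (nbhs_filter (y : C^o)) v (v y) (ccont_cvg vy)).
Qed.

Theorem log_schwarz (v lam : C -> C) b z : 1 < b -> (forall y : C, N y < b -> ccont v y) ->
  (forall y : C, N y <= 1 -> v y != 0) -> (forall y : C, N y < 1 -> cdiff lam y) ->
  (forall y : C, N y < 1 -> cexp (lam y) = v y) -> N z < 1 ->
  Cint leb (circ : set TR) (fun t => (eit t + z) / (eit t - z) * (ln (N (v (eit t))))%:C%C) =
  (lam z - 'i%C * (Im (lam 0))%:C%C) * twopi.
Proof.
move=> b1 vc v0 ld lv z1.
pose phi (y : C) : C := (ln (N (v y)))%:C%C.
have n1 t : N (1%:C%C * eit t : C) = 1 by rewrite normc_circle_pos.
have phic (y : C) : N y <= 1 -> ccont phi y.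
  by move=> y1; apply: ccont_ln_norm; [exact/vc/le_lt_trans/b1|exact: v0].
have zn : N z != 1 by rewrite lt_eqF.
have d0 : 0 < 1 - N z by rewrite subr_gt0.
pose K (y : C) := (y + z) / (y - z).
have Kc t : ccont K (1%:C%C * eit t).
  apply: ccontM; first by apply: ccontD; [exact: ccont_id|exact: ccont_cst].
  by apply: ccontV; [exact: circle_ne|exact/cdiff_cont/cdiff_subl].
apply/eqP; rewrite -subr_eq0; apply/eqP/normc_small => e e0.
have p2 := @pi2_gt0 R.
pose B := 2 * (2 / (1 - N z) * (pi *+ 2)).
have B0 : 0 < B by rewrite !mulr_gt0 // invr_gt0.
have eB : 0 < e / (2 * B) by rewrite divr_gt0 // mulr_gt0.
have [d1 d10 H1] := circle_unif (fun t => phic _ (eq_ind_r (fun x => x <= 1) (lexx 1) (n1 t))) eB.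
have e4 : 0 < e / (2 * (pi *+ 2)) by rewrite divr_gt0 // mulr_gt0.
have /ccontP/(_ _ e4)[d2 d20 H2] := cdiff_cont (ld z z1).
pose m := Num.min 1 (Num.min d1 d2).
have m0 : 0 < m by rewrite !lt_min ltr01 d10.
have [m1 md1 md2] : [/\ m <= 1, m <= d1 & m <= d2].
  by split; rewrite /m !ge_min lexx ?orbT.
pose rho := 1 - m / 2.
have rho01 : 0 < rho < 1 by rewrite /rho; apply/andP; split; lra.
have /andP[rho0 rho1] := rho01.
have lrd y : N y < rho^-1 -> cdiff (fun y => lam (rho%:C%C * y)) y.
  move=> yr; apply: cdiff_comp.
    by apply: cdiffM; [exact: cdiff_cst|exact: cdiff_id].
  apply: ld; rewrite normc_M normc_real gtr0_norm //.
  by rewrite -(divff (lt0r_neq0 rho0)) ltr_pM2l.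
have rinv : 1 < rho^-1 by rewrite invf_gt1.
have S := schwarz_formula z1 rinv lrd; rewrite mulr0 in S.
have Sphi : Cint leb (circ : set TR) (fun t => (eit t + z) / (eit t - z) *
     (Re (lam (rho%:C%C * eit t)))%:C%C) =
   cmean (fun y => K y * phi (rho%:C%C * y)) 1.
  rewrite cmean1; apply: Cint_ext => t _; congr (_ * _); rewrite /phi -lv.
    by rewrite normc_cexp expRK.
  by rewrite normc_circle_pos // ltW.
have rn t : N (rho%:C%C * (1%:C%C * eit t) : C) <= 1.
  by rewrite normc_M normc_real n1 mulr1 gtr0_norm // ltW.
have c1 t : ccont (fun y => K y * phi (rho%:C%C * y)) (1%:C%C * eit t).
  apply: ccontM (Kc t) _; apply: (@ccont_comp _ (fun y => rho%:C%C * y)).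
    by apply: ccontM; [exact: ccont_cst|exact: ccont_id].
  exact: phic (rn t).
have c2 t : ccont (fun y => K y * phi y) (1%:C%C * eit t).
  by apply: ccontM (Kc t) _; apply: phic; rewrite n1.
have D : N (cmean (fun y => K y * phi y - K y * phi (rho%:C%C * y)) 1) <= e / 2.
  have := @normc_Cint_bound _ leb (circ : set TR) mC
    (fun t => (fun y => K y * phi y - K y * phi (rho%:C%C * y)) (1%:C%C * eit t))
    (2 / (1 - N z) * (e / (2 * B))) (@leb_circ_lty R).
  rewrite fine_leb_circ => H; apply: (le_trans (H _ _)).
  - by apply: (@cmeas_circle _ (fun y => K y * phi y - K y * phi (rho%:C%C * y))) => t; exact: ccontB.
  - move=> t ct; rewrite -mulrBr normc_M ler_pM ?normc_ge0 //.
      by rewrite /K mul1r kernel_norm.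
    rewrite normcBC mulrA -realCM mulr1 ltW // H1 //; last exact: circ_itv.
    rewrite /rho; have -> : 1 - m / 2 - 1 = - (m / 2) by ring.
    by rewrite normrN ger0_norm; [lra|rewrite divr_ge0 // ltW].
  have -> : 2 * (2 / (1 - N z) * (e / (2 * B)) * (pi *+ 2)) = B * (e / (2 * B)) by rewrite /B; ring.
  by rewrite le_eqVlt; apply/orP; left; apply/eqP; field; rewrite gt_eqF.
rewrite cmeanB // -Sphi S !cmean1 in D.
have E : N (lam (rho%:C%C * z) - lam z) < e / (2 * (pi *+ 2)).
  apply: H2; have -> : rho%:C%C * z - z = - (m / 2)%:C%C * z.
    by rewrite /rho realCB; ring.
  rewrite normc_M normc_N normc_real ger0_norm; last lra.
  apply: (@le_lt_trans _ _ (m / 2)); last lra.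
  by rewrite ler_piMr // ltW //; lra.
have tp : N (@twopi R) = pi *+ 2 by rewrite normc_real ger0_norm // ltW.
rewrite /K in D; move: D E.
set X := Cint _ _ _; set a := lam (rho%:C%C * z); set c := lam z; set i0 := 'i%C * _ => D E.
have -> : X - (c - i0) * twopi = (X - (a - i0) * twopi) + (a - c) * twopi by ring.
rewrite (le_lt_trans (normc_D _ _)) // normc_M tp.
have : N (a - c) * (pi *+ 2) < e / (2 * (pi *+ 2)) * (pi *+ 2) by rewrite ltr_pM2r.
have -> : e / (2 * (pi *+ 2)) * (pi *+ 2) = e / 2.
  by move: (pi *+ 2) p2 => q q0; field; rewrite gt_eqF.
lra.
Qed.

End Logarithm.

Section BoundaryWeight.
Context {R : realType}.
Local Notation C := R[i].
Local Notation TR := (measurableTypeR R).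
Let mC := @measurable_circ R.

Lemma ae_imply (mu : {measure set TR -> \bar R}) (P Q : R -> Prop) : (forall t, P t -> Q t) ->
  {ae mu, forall t, P t} -> {ae mu, forall t, Q t}.
Proof. move=> PQ H; apply: (@filterS _ _ (ae_filter_ringOfSetsType mu) _ _ _ H). exact: PQ. Qed.

Lemma ae_and (mu : {measure set TR -> \bar R}) (P Q : R -> Prop) : {ae mu, forall t, P t} ->
  {ae mu, forall t, Q t} -> {ae mu, forall t, P t /\ Q t}.
Proof. exact: (@filterI _ _ (ae_filter_ringOfSetsType mu)). Qed.

Lemma Cint_ae (mu : {measure set TR -> \bar R}) (D : set TR) (f g : R -> C) : measurable D ->
  cmeas D f -> cmeas D g -> {ae mu, forall t, D t -> f t = g t} -> Cint mu D f = Cint mu D g.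
Proof.
move=> mD [f1 f2] [g1 g2] fg.
have E (a : C -> R) : measurable_fun D (fun t => a (f t)) -> measurable_fun D (fun t => a (g t)) ->
    \int[mu]_(t in D) a (f t) = \int[mu]_(t in D) a (g t).
  move=> fa ga; rewrite /Rintegral; congr fine; apply: ae_eq_integral => //.
  - exact/measurable_EFinP.
  - exact/measurable_EFinP.
  by apply: filterS fg => t H /H ->.
by rewrite /Cint (E (fun x => Re x)) // (E (fun x => Im x)).
Qed.

Lemma kernel_unique_ae (h1 h2 : R -> R) :
  leb.-integrable (circ : set TR) (EFin \o h1) -> leb.-integrable (circ : set TR) (EFin \o h2) ->
  (forall z : C, N z < 1 ->
    Cint leb (circ : set TR) (fun t => (eit t + z) / (eit t - z) * (h1 t)%:C%C) =
    Cint leb (circ : set TR) (fun t => (eit t + z) / (eit t - z) * (h2 t)%:C%C)) ->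
  {ae leb, forall t, circ t -> h1 t = h2 t}.
Proof.
move=> i1 i2 H.
have := @integral_ae_eq _ _ _ leb _ mC (EFin \o h2) (EFin \o h1) i1 (measurable_int _ i2).
move=> /(_ _)/wrap[E EC mE|].
  have -> : E = circ `&` E by rewrite setIC; apply/esym/setIidPl.
  exact: kernel_unique i1 i2 H E mE.
by apply: filterS => t H' /H' [].
Qed.

Lemma measurable_ln_norm (v : C -> C) : (forall y : C, N y = 1 -> ccont v y) ->
  (forall y : C, N y = 1 -> v y != 0) ->
  cmeas (circ : set TR) (fun t => (ln (N (v (eit t))))%:C%C).
Proof.
move=> vc v0.
have n1 t : N (1%:C%C * eit t : C) = 1 by rewrite normc_circle_pos.
have := @cmeas_circle _ (fun y => (ln (N (v y)))%:C%C) 1.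
move=> /(_ _)/wrap[t|]; first by apply: ccont_ln_norm; [exact: vc|exact: v0].
by apply: cmeas_ext => t _; rewrite mul1r.
Qed.

Lemma fourpiE : (pi *+ 4 : R)%:C%C = 2 * twopi :> C.
Proof. by rewrite /twopi !rmorphMn /=; ring. Qed.

Lemma szego_of_modulus (v lam : C -> C) b (w : R -> R) z : 1 < b ->
  (forall y : C, N y < b -> ccont v y) -> (forall y : C, N y <= 1 -> v y != 0) ->
  (forall y : C, N y < 1 -> cdiff lam y) -> (forall y : C, N y < 1 -> cexp (lam y) = v y) ->
  Im (lam 0) = 0 -> measurable_fun (circ : set TR) w ->
  {ae leb, forall t, circ t -> w t = N (v (eit t)) ^- 2} -> N z < 1 ->
  szego w z = (v z)^-1.
Proof.
move=> b1 vc v0 ld lv l0 mw wv z1.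
have S := log_schwarz b1 vc v0 ld lv z1; rewrite l0 mulr0 subr0 in S.
have mlv : cmeas (circ : set TR) (fun t => (ln (N (v (eit t))))%:C%C).
  by apply: measurable_ln_norm => y y1; [apply: vc|apply: v0]; rewrite y1.
have mk := cmeas_szego_kernel z1.
have mlw : cmeas (circ : set TR) (fun t => (ln (w t))%:C%C).
  by apply: cmeas_real; apply: (@measurableT_comp _ _ _ _ _ _ (@ln R)).
rewrite szegoE; have -> : szego_log w z = - lam z; last by rewrite cexpN lv.
pose c : C := (pi *+ 4 : R)%:C%C.
have mpl : cmeas (circ : set TR) (fun t => (eit t + z) / (eit t - z) * (ln (N (v (eit t))))%:C%C).
  exact: cmeasM.
have c4 : c = 2 * twopi := fourpiE.
have -> : szego_log w z =
    Cint leb (circ : set TR) (fun t => (- 2 / c) * ((eit t + z) / (eit t - z) * (ln (N (v (eit t))))%:C%C)).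
  rewrite /szego_log cintE; apply: (Cint_ae mC).
  - by apply: cmeasM; [exact: cmeasM|exact: cmeas_cst].
  - by apply: cmeasM; [exact: cmeas_cst|exact: mpl].
  apply: ae_imply wv => t H ct; rewrite (H ct).
  have Nv : 0 < N (v (eit t)) by rewrite normc_gt0 v0 // normc_eit.
  rewrite lnV ?posrE ?exprn_gt0 // lnXn // rmorphN rmorphMn /=.
  by rewrite -/c; ring.
rewrite CintZ //; last first.
  have [M M0 HM] := @circle_bounded _ (fun y => (ln (N (v y)))%:C%C) 1
    (fun t => ccont_ln_norm (vc _ (eq_ind_r (fun x => x < b) b1 (normc_circle_pos t ler01)))
       (v0 _ (eq_ind_r (fun x => x <= 1) (lexx 1) (normc_circle_pos t ler01)))).
  apply: (@cintegrable_bounded _ leb _ mC _ (2 / (1 - N z) * M)) => //; first exact: leb_circ_lty.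
  move=> t _; rewrite normc_M ler_pM ?normc_ge0 ?kernel_norm //.
  by have := HM t; rewrite mul1r.
rewrite S c4; have := @twopi_neq0 R.
by move: (lam z) twopi => l c' c0; field.
Qed.

End BoundaryWeight.

(** * Continuation of the Caratheodory function *)

Section Continuation.
Context {R : realType}.
Local Notation C := R[i].
Local Notation TR := (measurableTypeR R).
Let mC := @measurable_circ R.

Lemma ccont_eq0_outside (E : C -> C) r p : 1 < r -> N p = 1 -> ccont E p ->
  (forall y : C, 1 < N y < r -> E y = 0) -> E p = 0.
Proof.
move=> r1 p1 Ec E0; apply: normc_small => e e0.
have /ccontP/(_ _ e0)[d d0 H] := Ec.
pose s := Num.min (d / 2) ((r - 1) / 2).
have [s0 sd sr] : [/\ 0 < s, s <= d / 2 & s <= (r - 1) / 2].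
  split; last 2 first.
  - by rewrite ge_min lexx.
  - by rewrite ge_min lexx orbT.
  by rewrite lt_min !divr_gt0 // subr_gt0.
pose y := (1 + s)%:C%C * p.
have Ny : N y = 1 + s by rewrite normc_M p1 mulr1 normc_real ger0_norm; lra.
have yp : N (y - p) < d.
  have -> : y - p = s%:C%C * p by rewrite /y realCD; ring.
  by rewrite normc_M p1 mulr1 normc_real ger0_norm; lra.
have := H y yp; rewrite E0; first by rewrite sub0r normc_N.
by rewrite Ny; apply/andP; split; lra.
Qed.

Variables (mu : {measure set TR -> \bar R}) (w : R -> R) (Rad : R) (g : C -> C).
Hypothesis mu1 : circle_prob mu.
Hypothesis dec : lebesgue_decomp mu w mzero.
Hypothesis sz : szego_cond w.
Hypothesis Rad1 : 1 < Rad.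
Hypothesis gd : forall y : C, N y < Rad -> cdiff g y.
Hypothesis gE : forall y : C, N y < 1 -> g y = (szego w y)^-1.

(* At a zero of [g] on the circle, [|g|^2] would decay quadratically along the radius,
   but [szego_growth] only allows linear decay. *)
Lemma szego_inv_neq0 y : N y <= 1 -> g y != 0.
Proof.
rewrite le_eqVlt => /predU1P[y1|y1]; last by rewrite gE // invr_eq0 szegoE cexp_neq0.
apply/eqP => gy0.
have /cdiffP[phi [phic [e e0 gphi]]] := gd (eq_ind_r (fun x => x < Rad) Rad1 y1).
have /ccontP/(_ _ ltr01)[d d0 Hd] := phic.
pose M := N (phi y) + 1.
have M0 : 0 < M by rewrite /M; have := normc_ge0 (phi y); lra.
pose K := 2 * expR 1 * M ^+ 2 : R.
have K0 : 0 < K by rewrite !mulr_gt0 ?exprn_gt0 ?expR_gt0.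
pose s := Num.min 2^-1 (Num.min (Num.min (d / 2) (e / 2)) (K^-1 / 2)).
have [s0 s1 sd se sK] : [/\ 0 < s, s <= 2^-1, s <= d / 2, s <= e / 2 & s <= K^-1 / 2].
  split; last 4 first.
  - by rewrite ge_min lexx.
  - by rewrite !ge_min lexx !orbT.
  - by rewrite !ge_min lexx !orbT.
  - by rewrite !ge_min lexx !orbT.
  by rewrite !lt_min invr_gt0 ltr0n !divr_gt0 ?invr_gt0 //.
pose z := (1 - s)%:C%C * y.
have Nz : N z = 1 - s by rewrite normc_M y1 mulr1 normc_real ger0_norm; lra.
have zy : N (z - y) = s.
  have -> : z - y = - s%:C%C * y by rewrite /z realCB; ring.
  by rewrite normc_M y1 mulr1 normc_N normc_real ger0_norm; lra.
have z1 : N z < 1 by lra.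
have gz : N (g z) <= s * M.
  rewrite gphi ?zy; last lra.
  rewrite gy0 add0r normc_M zy ler_wpM2l ?ltW //.
  have := Hd z; rewrite zy => /(_ ltac:(lra)) H.
  by have := normc_lB (phi z) (phi y); rewrite /M; lra.
have gz0 : 0 < N (g z) by rewrite normc_gt0 gE // invr_eq0 szegoE cexp_neq0.
have G := szego_growth mu1 dec sz z1.
have Ng : N (szego w z) = (N (g z))^-1 by rewrite gE // normc_V invrK.
rewrite Ng Nz exprVn in G; have e1 : 1 - (1 - s) = s by ring.
rewrite e1 in G.
have G2 : s <= K / M ^+ 2 * N (g z) ^+ 2.
  move: G; rewrite -[_ ^-1]mul1r ler_pdivrMr ?exprn_gt0 // => G.
  have -> : K / M ^+ 2 = 2 * expR 1 by rewrite /K mulfK // gt_eqF // exprn_gt0.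
  have := ler_wpM2l (ltW s0) G; rewrite mulr1.
  suff -> : s * (expR 1 * (2 / s) * N (g z) ^+ 2) = 2 * expR 1 * N (g z) ^+ 2 by [].
  by move: (expR 1) (N (g z)) => u v; field; rewrite gt_eqF.
have G3 : s <= K * s ^+ 2.
  apply: (le_trans G2); have -> : K * s ^+ 2 = K / M ^+ 2 * (s * M) ^+ 2.
    by field; rewrite gt_eqF.
  rewrite ler_wpM2l //; first by rewrite divr_ge0 // ltW // exprn_gt0.
  by rewrite lerXn2r // nnegrE ltW // mulr_gt0.
have : 1 <= K * s by rewrite -(ler_pM2l s0) mulr1 mulrCA -expr2.
have : K * s <= K * (K^-1 / 2) by rewrite ler_wpM2l // ltW.
by rewrite mulrA divff ?gt_eqF //; lra.
Qed.

Lemma weight_modulus : {ae leb, forall t, circ t -> w t = N (g (eit t)) ^- 2}.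
Proof.
have lw := ln_weight_integrable mu1 dec sz.
have gc y : N y = 1 -> ccont g y by move=> y1; apply/cdiff_cont/gd; rewrite y1.
have g0 y : N y = 1 -> g y != 0 by move=> y1; apply: szego_inv_neq0; rewrite y1.
have [mlg _] := measurable_ln_norm gc g0.
have n1 t : N (1%:C%C * eit t : C) = 1 by rewrite normc_circle_pos.
have [M M0 HM] := @circle_bounded _ (fun y => (ln (N (g y)))%:C%C) 1
    (fun t => ccont_ln_norm (gc _ (n1 t)) (g0 _ (n1 t))).
have lg : leb.-integrable (circ : set TR) (EFin \o (fun t => - 2 * ln (N (g (eit t))))).
  apply: measurable_bounded_integrable => //; first exact: leb_circ_lty.
    by apply: measurable_funM => //; exact: mlg.
  apply: (@bounded_onP _ _ _ (2 * M)) => t _; rewrite normrM normrN [X in X * _]ger0_norm // ler_wpM2l //.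
  by have := HM t; rewrite mul1r normc_real.
have := kernel_unique_ae lw lg.
move=> /(_ _)/wrap[z z1|AE].
  have S := @log_schwarz _ g (fun y => - szego_log w y) Rad z Rad1
    (fun y yR => cdiff_cont (gd yR)) szego_inv_neq0
    (fun y y1 => cdiffN (cdiff_szego_log lw y1)) _ z1.
  rewrite cImN Im_szego_log0 // oppr0 mulr0 subr0 szego_logE // in S.
  transitivity (Cint leb (circ : set TR) (fun t => - 2 *
     ((eit t + z) / (eit t - z) * (ln (N (g (eit t))))%:C%C))); last first.
    by apply: Cint_ext => t _; rewrite realCM; ring.
  rewrite CintZ //; last first.
    apply: (@cintegrable_mulb _ leb _ mC _ _ (2 / (1 - N z))).
    - apply: cintegrable_real; apply: measurable_bounded_integrable => //.
      + exact: leb_circ_lty.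
      apply: (@bounded_onP _ _ _ M) => t _.
      by have := HM t; rewrite mul1r normc_real.
    - exact: cmeas_szego_kernel.
    - by move=> t _; exact: kernel_norm.
  rewrite S; last first.
    by move=> y y1; rewrite cexpN -szegoE gE.
  rewrite fourpiE; have := @twopi_neq0 R.
  by move: (Cint _ _ _) twopi => I p p0; field.
apply: (ae_imply _ (ae_and AE (weight_pos_ae mu1 dec sz))) => t [H1 H2] ct.
have wt := H2 ct; rewrite -[LHS]lnK ?posrE // H1 // mulNr expRN expRM_natl lnK //.
by rewrite posrE normc_gt0 g0 // normc_eit.
Qed.

Lemma carath_modulus z : N z < 1 -> carath mu z =
  Cint leb (circ : set TR) (fun t => (eit t + z) / (eit t - z) * (N (g (eit t)) ^- 2)%:C%C) / twopi.
Proof.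
move=> z1; rewrite /carath cintE.
rewrite (@mu_to_weight _ _ _ mu1 dec _ (2 / (1 - N z))) //; last 2 first.
- exact: cmeas_szego_kernel.
- by move=> t; exact: kernel_norm.
have [mw _] : measurable_fun (circ : set TR) w /\ True by case: dec => _ [].
have gc y : N y = 1 -> ccont g y by move=> y1; apply/cdiff_cont/gd; rewrite y1.
have g0 y : N y = 1 -> g y != 0 by move=> y1; apply: szego_inv_neq0; rewrite y1.
have n1 t : N (1%:C%C * eit t : C) = 1 by rewrite normc_circle_pos.
have vc t : ccont (fun y => (g y)^-1 * ((g y)^-1)^* ) (1%:C%C * eit t).
  have gVc : ccont (fun y => (g y)^-1) (1%:C%C * eit t).
    by apply: ccontV; [exact: g0|exact: gc].
  by apply: (ccontM gVc); apply: (ccont_comp gVc); exact: ccont_conj.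
have vE t : (N (g (eit t)) ^- 2)%:C%C = (g (1%:C%C * eit t))^-1 * ((g (1%:C%C * eit t))^-1)^*.
  by rewrite mulc_conj normc_V mul1r exprVn.
have mv : cmeas (circ : set TR) (fun t => (N (g (eit t)) ^- 2)%:C%C).
  by apply: cmeas_ext (cmeas_circle vc) => t _; rewrite vE.
have mk := cmeas_szego_kernel z1.
transitivity (Cint leb (circ : set TR) (fun t => twopi^-1 *
  ((eit t + z) / (eit t - z) * (N (g (eit t)) ^- 2)%:C%C))).
  apply: (Cint_ae mC).
  - by apply: cmeasM => //; apply: cmeas_real; exact: weight_meas dec.
  - by apply: cmeasM; [exact: cmeas_cst|exact: cmeasM].
  apply: ae_imply weight_modulus => t H ct; rewrite (H ct) realCM.
  by rewrite (_ : ((pi *+ 2)^-1)%:C%C = twopi^-1) ?realCV //; ring.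
rewrite CintZ // 1?mulrC //.
have [M M0 HM] := circle_bounded vc.
apply: (@cintegrable_bounded _ leb _ mC _ (2 / (1 - N z) * M)) => //; first exact: leb_circ_lty.
  exact: cmeasM.
move=> t _; rewrite normc_M ler_pM ?normc_ge0 ?kernel_norm //.
by rewrite vE; exact: HM.
Qed.

End Continuation.

Section Extension.
Context {R : realType}.
Local Notation C := R[i].
Local Notation TR := (measurableTypeR R).
Let mC := @measurable_circ R.

Definition creflect (f : C -> C) (z : C) : C := (f (z^*)^-1)^*.

Lemma cdiff_creflect f z : z != 0 -> cdiff f (z^*)^-1 -> cdiff (creflect f) z.
Proof.
move=> z0 fd; have z0' : z^* != 0 by rewrite conjC_eq0.
apply: (cdiff_conj (f := fun y => f y^-1)).
apply: (@cdiff_comp _ (fun y => y^-1)) fd.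
by apply: cdiffV => //; exact: cdiff_id.
Qed.

Lemma normc_reflect (z : C) : N (z^*)^-1 = (N z)^-1.
Proof. by rewrite normc_V normc_conj. Qed.

Lemma creflect_circle f z : N z = 1 -> creflect f z = (f z)^*.
Proof. by move=> z1; rewrite /creflect (invc_conj z1) invrK. Qed.

Lemma kernel_reflect (z : C) t : z != 0 ->
  ((eit t + (z^*)^-1) / (eit t - (z^*)^-1))^* = - ((eit t + z) / (eit t - z)) :> C.
Proof.
move=> z0; have e0 := @eit_neq0 R t.
rewrite rmorphM fmorphV rmorphB rmorphD fmorphV /= conjCK eit_conj.
have [->|ez] := eqVneq (eit t) z; first by rewrite !subrr invr0 !mulr0 oppr0.
have ez' : eit t - z != 0 by rewrite subr_eq0.
have ze : z - eit t != 0 by rewrite subr_eq0 eq_sym.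
have -> : (eit t)^-1 + z^-1 = (z + eit t) / (eit t * z) by field; rewrite ?e0 ?z0.
have -> : (eit t)^-1 - z^-1 = (z - eit t) / (eit t * z) by field; rewrite ?e0 ?z0.
field; by rewrite e0 ze z0 ez'.
Qed.

Variables (mu : {measure set TR -> \bar R}) (w : R -> R) (Rad : R) (g : C -> C).
Hypothesis mu1 : circle_prob mu.
Hypothesis dec : lebesgue_decomp mu w mzero.
Hypothesis sz : szego_cond w.
Hypothesis Rad1 : 1 < Rad.
Hypothesis gd : forall y : C, N y < Rad -> cdiff g y.
Hypothesis gE : forall y : C, N y < 1 -> g y = (szego w y)^-1.

Let g0 y : N y <= 1 -> g y != 0.
Proof. exact: szego_inv_neq0 mu1 dec sz Rad1 gd gE y. Qed.

Let gs := creflect g.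

Let gsd z : 1 < N z -> cdiff gs z /\ gs z != 0.
Proof.
move=> z1; have z0 : z != 0 by rewrite -normc_gt0 (lt_trans _ z1).
have z1' : N (z^*)^-1 < 1 by rewrite normc_reflect invf_lt1 // (lt_trans _ z1).
split; last by rewrite conjC_eq0 g0 // ltW.
by apply: cdiff_creflect => //; apply: gd; exact: lt_trans Rad1.
Qed.

Let Fs := creflect (carath mu).

Let Fsd z : 1 < N z -> cdiff Fs z.
Proof.
move=> z1; have z0 : z != 0 by rewrite -normc_gt0 (lt_trans _ z1).
have z1' : N (z^*)^-1 < 1 by rewrite normc_reflect invf_lt1 // (lt_trans _ z1).
by apply: cdiff_creflect => //; exact: cdiff_carath.
Qed.

Let v z := (g z * gs z)^-1.

Let v_circle z : N z = 1 -> v z = (N (g z) ^- 2)%:C%C.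
Proof.
by move=> z1; rewrite /v /gs creflect_circle // mulc_conj realCV.
Qed.

Variable r0 : R.
Hypothesis r01 : 1 < r0.
Hypothesis r0Rad : r0 <= Rad.
Hypothesis gr0 : forall y, N y < r0 -> g y != 0.

Let r0V : 0 <= r0^-1. Proof. by rewrite invr_ge0 ltW // (lt_trans _ r01). Qed.
Let r0V1 : r0^-1 < 1. Proof. by rewrite invf_lt1 // (lt_trans _ r01). Qed.

Let vd y : r0^-1 < N y < r0 -> cdiff v y.
Proof.
move=> /andP[y1 y2]; have Ny : 0 < N y by exact: le_lt_trans y1.
have y0 : y != 0 by rewrite -normc_gt0.
have yR : N (y^*)^-1 < r0.
  by rewrite normc_reflect -[r0]invrK ltf_pV2 // posrE ?invr_gt0 // (lt_trans _ r01).
apply: cdiffV; first by rewrite mulf_neq0 ?gr0 // conjC_eq0 gr0.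
apply: cdiffM; first by apply: gd; exact: lt_le_trans r0Rad.
by apply: cdiff_creflect => //; apply: gd; exact: lt_le_trans r0Rad.
Qed.

Let r1 := (1 + r0) / 2.
Let r11 : 1 < r1. Proof. by have [] := midf_lt r01. Qed.
Let r1r0 : r1 < r0. Proof. by have [] := midf_lt r01. Qed.

Let F z := cmean (fun y => (y + z) / (y - z) * v y) r1 / twopi.

Let Fd z : N z < r1 -> cdiff F z.
Proof.
move=> zr; have r10 : 0 <= r1 := ltW (lt_trans ltr01 r11).
have vi : cintegrable leb (circ : set TR) (fun t => v (r1%:C%C * eit t)).
  apply: cintegrable_circle => t; apply/cdiff_cont/vd.
  by rewrite normc_circle_pos // r1r0 (lt_trans r0V1).
apply: cdiffM; last exact: cdiff_cst.
exact: cdiff_kernel_int vi r10 (negbT (lt_eqF zr)).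
Qed.

Let mean_one z : N z != 1 -> cmean (fun y => (y + z) / (y - z) * v y) 1 =
  Cint leb (circ : set TR) (fun t => (eit t + z) / (eit t - z) * (N (g (eit t)) ^- 2)%:C%C).
Proof.
move=> z1; rewrite cmean1; apply: Cint_ext => t _.
by rewrite v_circle // normc_eit.
Qed.

Let F_inside z : N z < 1 -> F z = carath mu z.
Proof.
move=> z1; rewrite (carath_modulus mu1 dec sz Rad1 gd gE) // /F; congr (_ / _).
rewrite -(mean_one (negbT (lt_eqF z1))).
apply: (@cmean_const_annulus _ _ (Num.max r0^-1 (N z)) r0).
- by rewrite le_max r0V.
- by rewrite gt_max r1r0 (lt_trans r0V1) //= (lt_trans z1).
- by rewrite gt_max r0V1 z1.
move=> y; rewrite gt_max -andbA => /and3P[y1 y2 y3].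
apply: cdiffM; last by apply: vd; rewrite y1.
apply: cdiff_div; last exact: cdiff_subl.
  by rewrite subr_eq0; apply: contraTneq y2 => ->; rewrite ltxx.
by apply: cdiffD; [exact: cdiff_id|exact: cdiff_cst].
Qed.

Let F_outside z : 1 < N z < r1 -> F z = 2 * v z - Fs z.
Proof.
move=> /andP[z1 zr]; have z0 : z != 0 by rewrite -normc_gt0 (lt_trans _ z1).
have z1' : N (z^*)^-1 < 1 by rewrite normc_reflect invf_lt1 // (lt_trans _ z1).
have zn : N z != 1 by rewrite gt_eqF.
pose I := cmean (fun y => (y + z) / (y - z) * v y) 1.
have E1 : cmean (fun y => (y + z) / (y - z) * v y) r1 = I + 2 * twopi * v z.
  by apply: (residue_circle r0V r0V1) r1r0 vd.
have E2 : Fs z = - I / twopi.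
  have c2 : twopi^* = twopi :> C by rewrite conj_realC.
  rewrite /Fs /creflect (carath_modulus mu1 dec sz Rad1 gd gE) // rmorphM fmorphV /= c2.
  congr (_ / _); have ig : cintegrable leb (circ : set TR)
      (fun t => (eit t + (z^*)^-1) / (eit t - (z^*)^-1) * (N (g (eit t)) ^- 2)%:C%C).
    have := @cintegrable_circle _ (fun y => (y + (z^*)^-1) / (y - (z^*)^-1) * v y) 1.
    move=> /(_ _)/wrap[t|].
      have n1 : N (1%:C%C * eit t : C) = 1 by rewrite normc_circle_pos.
      apply/cdiff_cont/cdiffM; last by apply: vd; rewrite n1 r0V1.
      apply: cdiff_div; last exact: cdiff_subl.
        by apply: circle_ne => //; rewrite lt_eqF.
      by apply: cdiffD; [exact: cdiff_id|exact: cdiff_cst].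
    by apply: (@cintegrable_ext _ leb _ mC) => t _; rewrite mul1r v_circle // normc_eit.
  rewrite -(Cint_conj mC ig) /I mean_one // -[RHS]mulN1r -CintZ //; last first.
    have := @cintegrable_conj _ _ _ mC _ ig.
    move/(@cintegrableZ _ _ _ mC _ (-1)).
    apply: (@cintegrable_ext _ leb _ mC) => t _.
    by rewrite rmorphM /= kernel_reflect // conj_realC; ring.
  apply: Cint_ext => t _.
  by rewrite rmorphM /= kernel_reflect // conj_realC; ring.
rewrite /F E1 E2; clear E1 E2; have := @twopi_neq0 R.
by move: twopi I (v z) => p I' v' p0; field.
Qed.

Let F_circle z : N z = 1 -> F z + (F z)^* = 2 * v z.
Proof.
move=> z1; have z0 : z != 0 by rewrite -normc_gt0 z1.
apply/eqP; rewrite -subr_eq0 -(creflect_circle F z1); apply/eqP.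
have Fz : cdiff F z by apply: Fd; rewrite z1.
apply: (@ccont_eq0_outside _ (fun y => F y + creflect F y - 2 * v y) r1 z r11 z1).
  apply/cdiff_cont/cdiffB; last first.
    by apply: cdiffM; [exact: cdiff_cst|apply: vd; rewrite z1 r0V1].
  apply: (cdiffD Fz); apply: (cdiff_creflect z0).
  by rewrite (invc_conj z1) invrK.
move=> y /andP[y1 yr]; rewrite F_outside ?y1 // /creflect F_inside.
  by rewrite -/(creflect _ _) -/(Fs y); ring.
by rewrite normc_reflect invf_lt1 // (lt_trans _ y1).
Qed.

(* [P] continues [g F]; the last item says [Re F = |g|^-2] on the circle. *)
Theorem carath_numerator_aux : exists P : C -> C,
  [/\ forall y, N y < Rad -> cdiff P y,
      forall y, N y < 1 -> P y = g y * carath mu y,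
      forall y, N y < Rad -> g y = 0 -> P y != 0 &
      forall y, N y = 1 -> P y * (g y)^* + (P y * (g y)^*)^* = 2].
Proof.
pose P y := if N y < r1 then g y * F y else 2 / gs y - g y * Fs y.
have PE y : 1 < N y -> P y = 2 / gs y - g y * Fs y.
  move=> y1; rewrite /P; case: ltP => // yr.
  rewrite F_outside ?y1 // /v; have [_ gs0] := gsd y1.
  have gy := gr0 (lt_trans yr r1r0).
  by field; rewrite gs0.
exists P; split.
- move=> y yR; have [yr|yr] := ltP (N y) r1.
    apply: (@cdiff_near _ (fun y => g y * F y) _ _ (r1 - N y)); first by rewrite subr_gt0.
      move=> z zy; rewrite /P ifT //.
      by have := normc_lB z y; lra.
    by apply: cdiffM; [exact: gd|exact: Fd].
  have y1 : 1 < N y by exact: lt_le_trans r11 yr.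
  apply: (@cdiff_near _ (fun y => 2 / gs y - g y * Fs y) _ _ (N y - 1)); first by rewrite subr_gt0.
    move=> z zy; rewrite PE //.
    by have := normc_lB y z; rewrite normcBC; lra.
  have [gsy gs0] := gsd y1.
  apply: cdiffB; first by apply: cdiff_div => //; exact: cdiff_cst.
  by apply: cdiffM; [exact: gd|exact: Fsd].
- by move=> y y1; rewrite /P ifT ?F_inside // (lt_trans y1).
- move=> y yR gy; have y1 : 1 < N y.
    by rewrite ltNge; apply/negP => /g0; rewrite gy eqxx.
  have [_ gs0] := gsd y1.
  by rewrite PE // gy mul0r subr0 mulf_neq0 ?invr_eq0 // pnatr_eq0.
move=> y y1; rewrite /P y1 r11.
rewrite mulrAC mulc_conj; set c := (_ ^+ 2)%:C%C.
have cc : c^* = c by exact: conj_realC.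
rewrite rmorphM /= cc -mulrDr F_circle // v_circle // mulrCA /c -realCM divff ?mulr1 //.
by rewrite expf_neq0 // gt_eqF // normc_gt0 g0 // y1.
Qed.

End Extension.

Section Numerator.
Context {R : realType}.
Local Notation C := R[i].
Local Notation TR := (measurableTypeR R).

Theorem carath_numerator (mu : {measure set TR -> \bar R}) (w : R -> R) (Rad : R) (g : C -> C) :
  circle_prob mu -> lebesgue_decomp mu w mzero -> szego_cond w -> 1 < Rad ->
  (forall y : C, N y < Rad -> cdiff g y) ->
  (forall y : C, N y < 1 -> g y = (szego w y)^-1) ->
  exists P : C -> C,
  [/\ forall y, N y < Rad -> cdiff P y,
      forall y, N y < 1 -> P y = g y * carath mu y,
      forall y, N y < Rad -> g y = 0 -> P y != 0 &
      forall y, N y = 1 -> P y * (g y)^* + (P y * (g y)^*)^* = 2].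
Proof.
move=> mu1 dec sz Rad1 gd gE.
have [r0 [r01 r0R gr0]] := zero_free_larger Rad1 (fun y yR => cdiff_cont (gd y yR))
  (szego_inv_neq0 mu1 dec sz Rad1 gd gE).
exact: (carath_numerator_aux mu1 dec sz Rad1 gd gE r01 r0R gr0).
Qed.

End Numerator.

(** * Verblunsky coefficients and shifted measures *)

Section Geronimus.
Context {R : realType}.
Local Notation C := R[i].
Local Notation TR := (measurableTypeR R).
Let mC := @measurable_circ R.
Implicit Types (p : {poly C}) (a : nat -> C).

Lemma cdiff_horner p z : cdiff (fun y => p.[y]) z.
Proof.
elim/poly_ind: p => [|p c IH].
  by apply: (@cdiff_ext _ (fun=> 0)); [move=> y; rewrite horner0|exact: cdiff_cst].
apply: (@cdiff_ext _ (fun y => p.[y] * y + c)); first by move=> y; rewrite hornerMXaddC.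
by apply: cdiffD; [apply: cdiffM => //; exact: cdiff_id|exact: cdiff_cst].
Qed.

Lemma horner_pstar n p z : N z = 1 -> (size p <= n.+1)%N ->
  (pstar n p).[z] = z ^+ n * (p.[z])^*.
Proof.
move=> z1 sp; have z0 : z != 0 by rewrite -normc_eq0 z1 oner_eq0.
rewrite horner_poly (horner_coef_wide _ sp) rmorph_sum mulr_sumr /=.
rewrite (reindex_inj rev_ord_inj) /=; apply: eq_bigr => i _.
have iN : (i <= n)%N by rewrite -ltnS.
rewrite subSS subKn // rmorphM rmorphXn /= (invc_conj z1) [RHS]mulrCA exprVn.
have -> : z ^+ n = z ^+ (n - i) * z ^+ i by rewrite -exprD subnK.
by rewrite mulfK // expf_neq0.
Qed.

Lemma size_opuc a n : (size (opuc a n) <= n.+1)%N.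
Proof.
elim: n => [|n IH] /=; first by rewrite size_poly1.
rewrite (leq_trans (size_polyD _ _)) // geq_max size_polyN; apply/andP; split.
  by rewrite (leq_trans (size_polyMleq _ _)) // size_polyX.
rewrite mul_polyC (leq_trans (size_scale_leq _ _)) //.
by rewrite (leq_trans (size_poly _ _)).
Qed.

Let phi a n t := (opuc a n).[eit t].
Let psi a n t := (pstar n (opuc a n)).[eit t].

Let psiE a n t : psi a n t = eit t ^+ n * (phi a n t)^*.
Proof. by apply: horner_pstar; [exact: normc_eit|exact: size_opuc]. Qed.

Let phiS a n t : phi a n.+1 t = eit t * phi a n t - (a n)^* * psi a n t.
Proof. by rewrite /phi /= hornerD hornerN !hornerM hornerX hornerC. Qed.

Let psiS a n t : psi a n.+1 t = psi a n t - a n * (eit t * phi a n t).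
Proof.
have e0 := @eit_neq0 R t.
rewrite psiE phiS rmorphB !rmorphM /= conjCK !psiE rmorphM rmorphXn /= conjCK.
rewrite eit_conj exprS exprVn.
have en : eit t ^+ n != 0 :> C by rewrite expf_neq0.
by move: (eit t ^+ n) (phi a n t) ((phi a n t)^*) en => en f fc en0; field; rewrite ?e0 ?en0.
Qed.

Variables (mu : {measure set TR -> \bar R}) (a : nat -> C).
Hypothesis mu1 : circle_prob mu.
Hypothesis va : verblunsky mu a.

Let mufin : (mu (circ : set TR) < +oo)%E.
Proof. by rewrite circle_prob_circ // ltry. Qed.

Let cintegrable_cont (f : C -> C) : (forall y, N y = 1 -> ccont f y) ->
  cintegrable mu (circ : set TR) (fun t => f (eit t)).
Proof.
move=> fc; have n1 t : N (1%:C%C * eit t : C) = 1 by rewrite normc_circle_pos.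
have fc' t : ccont f (1%:C%C * eit t) by exact: fc.
have [M M0 HM] := circle_bounded fc'.
apply: (@cintegrable_bounded _ mu _ mC _ M) => //.
  by apply: cmeas_ext (cmeas_circle fc') => t _; rewrite mul1r.
by move=> t _; have := HM t; rewrite mul1r.
Qed.

Let eVn n (y : C) : N y = 1 -> cdiff (fun y => y ^- n) y.
Proof.
move=> y1; have y0 : y != 0 by rewrite -normc_eq0 y1 oner_eq0.
by apply: cdiffV; [rewrite expf_neq0|exact/cdiffX/cdiff_id].
Qed.

Let T n y := 2 * y * y ^- n * (opuc a n).[y].
Let U n y := 2 * y ^- n * (pstar n (opuc a n)).[y].

Let Td n y : N y = 1 -> cdiff (T n) y.
Proof.
move=> y1; apply: cdiffM; last exact: cdiff_horner.
apply: cdiffM; last exact: eVn.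
by apply: cdiffM; [exact: cdiff_cst|exact: cdiff_id].
Qed.

Let Ud n y : N y = 1 -> cdiff (U n) y.
Proof.
move=> y1; apply: cdiffM; last exact: cdiff_horner.
by apply: cdiffM; [exact: cdiff_cst|exact: eVn].
Qed.

Definition geronimus_t n z := Cint mu (circ : set TR)
  (fun t => (1%:C%C * eit t - z)^-1 * (2 * eit t * eit t ^- n * (opuc a n).[eit t])).
Definition geronimus_u n z := Cint mu (circ : set TR)
  (fun t => (1%:C%C * eit t - z)^-1 * (2 * eit t ^- n * (pstar n (opuc a n)).[eit t])).

Lemma cdiff_geronimus_t n z : N z < 1 -> cdiff (geronimus_t n) z.
Proof.
move=> z1; apply: cdiff_cauchy_int => //; last by rewrite lt_eqF.
by apply: (cintegrable_cont (f := T n)) => y y1; exact/cdiff_cont/Td.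
Qed.

Lemma cdiff_geronimus_u n z : N z < 1 -> cdiff (geronimus_u n) z.
Proof.
move=> z1; apply: cdiff_cauchy_int => //; last by rewrite lt_eqF.
by apply: (cintegrable_cont (f := U n)) => y y1; exact/cdiff_cont/Ud.
Qed.

Let kint (f : C -> C) z : N z < 1 -> (forall y, N y = 1 -> cdiff f y) ->
  cintegrable mu (circ : set TR) (fun t => (1%:C%C * eit t - z)^-1 * f (eit t)).
Proof.
move=> z1 fd; have H (y : C) : N y = 1 -> ccont (fun y => (1%:C%C * y - z)^-1 * f y) y.
  move=> y1; apply/cdiff_cont/cdiffM; last exact: fd.
  apply: cdiffV.
    by rewrite mul1r subr_eq0; apply: contraTneq z1 => <-; rewrite y1 ltxx.
  apply: cdiffB; last exact: cdiff_cst.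
  by apply: cdiffM; [exact: cdiff_cst|exact: cdiff_id].
exact: (cintegrable_cont H).
Qed.

Lemma geronimus_tS n z : N z < 1 ->
  geronimus_t n.+1 z = geronimus_t n z - (a n)^* * geronimus_u n z.
Proof.
move=> z1; rewrite /geronimus_t /geronimus_u -(CintZ mC _ (kint z1 (@Ud n))).
rewrite -(CintB mC (kint z1 (@Td n)) (cintegrableZ mC _ (kint z1 (@Ud n)))).
apply: Cint_ext => t _; have e0 := @eit_neq0 R t.
rewrite /T /U -/(phi a n.+1 t) -/(phi a n t) -/(psi a n t) phiS.
have -> : eit t ^- n.+1 = eit t ^- n / eit t :> C by rewrite exprS invfM mulrC.
move: ((_ - z)^-1) (eit t ^- n) => k en.
by field.
Qed.

Lemma geronimus_uS n z : N z < 1 ->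
  z * geronimus_u n.+1 z = geronimus_u n z - a n * geronimus_t n z.
Proof.
move=> z1; rewrite /geronimus_t /geronimus_u.
have orth : Cint mu (circ : set TR) (fun t => 2 * (phi a n.+1 t)^*) = 0.
  have fi : cintegrable mu (circ : set TR) (phi a n.+1).
    by apply: (@cintegrable_cont (fun y => (opuc a n.+1).[y])) => y _; exact/cdiff_cont/cdiff_horner.
  rewrite CintZ //; last exact: cintegrable_conj.
  rewrite Cint_conj //; have := va (ltn0Sn n); rewrite cintE => H.
  rewrite (_ : Cint _ _ _ = 0) ?rmorph0 ?mulr0 // -[RHS]H; apply: Cint_ext => t _.
  by rewrite expr0 rmorph1 mul1r.
rewrite -[LHS]addr0 -orth -(CintZ mC _ (kint z1 (@Ud n.+1))).
rewrite -(CintZ mC _ (kint z1 (@Td n))).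
rewrite -(CintB mC (kint z1 (@Ud n)) (cintegrableZ mC _ (kint z1 (@Td n)))).
rewrite -(CintD mC (cintegrableZ mC _ (kint z1 (@Ud n.+1)))); last first.
  apply: cintegrableZ => //; apply: cintegrable_conj => //.
  by apply: (@cintegrable_cont (fun y => (opuc a n.+1).[y])) => y _; exact/cdiff_cont/cdiff_horner.
apply: Cint_ext => t _; have e0 := @eit_neq0 R t.
have k0 : 1%:C%C * eit t - z != 0 by apply: circle_ne => //; rewrite lt_eqF.
have -> : (phi a n.+1 t)^* = eit t ^- n.+1 * psi a n.+1 t.
  by rewrite psiE mulKf // expf_neq0.
rewrite /T /U -/(phi a n t) -/(psi a n t) -/(psi a n.+1 t) psiS.
have -> : eit t ^- n.+1 = eit t ^- n / eit t :> C by rewrite exprS invfM mulrC.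
rewrite mul1r in k0 *.
move: (eit t ^- n) (psi a n t) (phi a n t) => en ps ph.
by field; rewrite e0 k0.
Qed.

Let mass1 : Cint mu (circ : set TR) (fun=> 1) = 1.
Proof.
by rewrite (Cint_cst mu mC) [X in fine X](circle_prob_circ mu1) mul1r.
Qed.

Let kernel_addz z : N z < 1 ->
  cintegrable mu (circ : set TR) (fun t => (eit t + z) / (eit t - z)).
Proof.
move=> z1; have := kint z1 (f := fun y => y + z).
move=> /(_ _)/wrap[y _|]; first by apply: cdiffD; [exact: cdiff_id|exact: cdiff_cst].
by apply: (@cintegrable_ext _ mu _ mC) => t _; rewrite mul1r mulrC.
Qed.

Lemma geronimus_t0 z : N z < 1 -> geronimus_t 0 z = carath mu z + 1.
Proof.
move=> z1; rewrite /carath cintE -[in RHS]mass1.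
rewrite -(CintD mC (kernel_addz z1) (cintegrable_cst mu1 1)).
apply: Cint_ext => t _.
have k0 : 1%:C%C * eit t - z != 0 by apply: circle_ne => //; rewrite lt_eqF.
rewrite /= hornerC expr0 invr1; rewrite mul1r in k0 *.
by field.
Qed.

Lemma geronimus_u0 z : N z < 1 -> z * geronimus_u 0 z = carath mu z - 1.
Proof.
move=> z1; rewrite /carath cintE -[in RHS]mass1.
rewrite -(CintB mC (kernel_addz z1) (cintegrable_cst mu1 1)).
rewrite /geronimus_u -(CintZ mC _ (kint z1 (@Ud 0%N))).
apply: Cint_ext => t _.
have k0 : 1%:C%C * eit t - z != 0 by apply: circle_ne => //; rewrite lt_eqF.
rewrite /U horner_pstar ?normc_eit ?size_poly1 //= hornerC rmorph1 expr0 invr1.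
rewrite mul1r in k0 *.
by field.
Qed.

End Geronimus.

Section SzegoIteration.
Context {R : realType}.
Local Notation C := R[i].

Lemma Re_gt0_of_lt1 (q : C) : N q < 1 -> 0 < Re (1 - q).
Proof.
by move=> q1; rewrite cReB /=; have := normcRe q; rewrite ler_norml => /andP[]; lra.
Qed.

Lemma Im_clog_real (x : R) : Im (clog x%:C%C) = 0.
Proof. by rewrite /clog /= mul0r atan0. Qed.

Lemma normc_szego_step (a T U : C) :
  N (T - a^* * U) ^+ 2 - N (U - a * T) ^+ 2 = (1 - N a ^+ 2) * (N T ^+ 2 - N U ^+ 2).
Proof.
rewrite !normc_sqr !cReB !cImB !cReM !cImM cReJ cImJ.
by move: (Re a) (Im a) (Re T) (Im T) (Re U) (Im U) => *; ring.
Qed.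

Variables (g P : C -> C) (Rad : R) (a : nat -> C) (t u : nat -> C -> C) (F lam0 : C -> C).
Hypothesis Rad1 : 1 < Rad.
Hypothesis gd : forall y, N y < Rad -> cdiff g y.
Hypothesis Pd : forall y, N y < Rad -> cdiff P y.
Hypothesis g0 : forall y, N y <= 1 -> g y != 0.
Hypothesis Pcirc : forall y, N y = 1 -> P y * (g y)^* + (P y * (g y)^*)^* = 2.
Hypothesis PE : forall y, N y < 1 -> P y = g y * F y.
Hypothesis F1 : F 0 = 1.
Hypothesis FRe : forall y, N y < 1 -> 0 < Re (F y).
Hypothesis Fd : forall y, N y < 1 -> cdiff F y.
Hypothesis lamd : forall y, N y < 1 -> cdiff lam0 y.
Hypothesis lamE : forall y, N y < 1 -> cexp (lam0 y) = g y.
Hypothesis lam00 : Im (lam0 0) = 0.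
Hypothesis ud : forall n y, N y < 1 -> cdiff (u n) y.
Hypothesis t0E : forall y, N y < 1 -> t 0%N y = F y + 1.
Hypothesis u0E : forall y, N y < 1 -> y * u 0%N y = F y - 1.
Hypothesis tS : forall n y, N y < 1 -> t n.+1 y = t n y - (a n)^* * u n y.
Hypothesis uS : forall n y, N y < 1 -> y * u n.+1 y = u n y - a n * t n y.

(* Continues the pair [g t_n, g u_n]; the division by [z] in the recursion is a
   difference quotient at [0]. *)
Fixpoint szTU n : (C -> C) * (C -> C) :=
  if n is k.+1 then
    (fun y => (szTU k).1 y - (a k)^* * (szTU k).2 y,
     dquot (fun y => (szTU k).2 y - a k * (szTU k).1 y) 0)
  else (fun y => P y + g y, dquot (fun y => P y - g y) 0).

Let T n := (szTU n).1.
Let U n := (szTU n).2.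

Let n0 : N (0 : C) < 1. Proof. by rewrite normc_0. Qed.
Let n0R : N (0 : C) < Rad. Proof. by rewrite normc_0 (lt_trans _ Rad1). Qed.

Let U_eq (V u' : C -> C) : (forall y, N y < Rad -> cdiff V y) ->
  (forall y, N y < 1 -> cdiff u' y) -> (forall y, N y < 1 -> V y = g y * (y * u' y)) ->
  [/\ forall y, N y < Rad -> cdiff (dquot V 0) y,
      forall y, N y < 1 -> dquot V 0 y = g y * u' y &
      forall y, y * dquot V 0 y = V y].
Proof.
move=> Vd u'd VE; have V0 : V 0 = 0 by rewrite VE // mul0r mulr0.
have E y : y * dquot V 0 y = V y by rewrite [RHS](dquotE V 0) V0 subr0 add0r.
have D y : N y < Rad -> cdiff (dquot V 0) y by exact: cdiff_dquot_ball.
have B y : y != 0 -> N y < 1 -> dquot V 0 y = g y * u' y.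
  by move=> y0 y1; apply: (mulfI y0); rewrite E VE // mulrCA.
split=> // y y1; have [->|y0] := eqVneq y 0; last exact: B.
apply: (@cont_eq_at0 _ (dquot V 0) (fun y => g y * u' y)) => //; first exact/cdiff_cont/D.
by apply/cdiff_cont/cdiffM; [exact: gd|exact: u'd].
Qed.

Let TU n : [/\ forall y, N y < Rad -> cdiff (T n) y,
  forall y, N y < Rad -> cdiff (U n) y,
  forall y, N y < 1 -> T n y = g y * t n y &
  forall y, N y < 1 -> U n y = g y * u n y].
Proof.
elim: n => [|n [Td Ud TE UE]].
  have [| | |Ud UE _] := @U_eq (fun y => P y - g y) (u 0%N).
  - by move=> y yR; apply: cdiffB; [exact: Pd|exact: gd].
  - exact: ud.
  - by move=> y y1; rewrite PE // u0E //; ring.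
  split=> //; first by move=> y yR; apply: cdiffD; [exact: Pd|exact: gd].
  by move=> y y1; rewrite /T /= PE // t0E //; ring.
have [| | |Ud' UE' _] := @U_eq (fun y => U n y - a n * T n y) (u n.+1).
- move=> y yR; apply: cdiffB; first exact: Ud.
  by apply: cdiffM; [exact: cdiff_cst|exact: Td].
- exact: ud.
- by move=> y y1; rewrite UE // TE // uS //; ring.
split=> //.
- move=> y yR; apply: cdiffB; first exact: Td.
  by apply: cdiffM; [exact: cdiff_cst|exact: Ud].
by move=> y y1; rewrite /T /= -/(T n) -/(U n) TE // UE // tS //; ring.
Qed.

Let U0E y : y * U 0 y = P y - g y.
Proof.
have [| | |_ _ ->//] := @U_eq (fun y => P y - g y) (u 0%N).
- by move=> z zR; apply: cdiffB; [exact: Pd|exact: gd].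
- exact: ud.
- by move=> z z1; rewrite PE // u0E //; ring.
Qed.

Let USE n y : y * U n.+1 y = U n y - a n * T n y.
Proof.
have [Td Ud TE UE] := TU n.
have [| | |_ _ ->//] := @U_eq (fun y => U n y - a n * T n y) (u n.+1).
- move=> z zR; apply: cdiffB; first exact: Ud.
  by apply: cdiffM; [exact: cdiff_cst|exact: Td].
- exact: ud.
- by move=> z z1; rewrite UE // TE // uS //; ring.
Qed.

Let c n : R := \prod_(j < n) (1 - N (a j) ^+ 2).

Let circ_id n y : N y = 1 -> N (T n y) ^+ 2 - N (U n y) ^+ 2 = 4 * c n.
Proof.
move=> y1; elim: n => [|n IH].
  have -> : N (U 0 y) = N (P y - g y) by rewrite -U0E normc_M y1 mul1r.
  rewrite /c big_ord0 mulr1 /T /=.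
  have := congr1 (fun x => Re x) (Pcirc y1).
  rewrite cReD cReJ cReM cReJ cImJ => H.
  have {}H : (Re (P y) * Re (g y) + Im (P y) * Im (g y)) *+ 2 = 2.
    by rewrite -[RHS]H; ring.
  rewrite !normc_sqr !cReB !cImB !cReD !cImD.
  move: (Re (P y)) (Im (P y)) (Re (g y)) (Im (g y)) H => *; lra.
have -> : N (U n.+1 y) = N (U n y - a n * T n y) by rewrite -USE normc_M y1 mul1r.
by rewrite /T /= -/(T n) -/(U n) normc_szego_step IH /c big_ord_recr /=; ring.
Qed.

Definition szego_good n :=
  [/\ forall y, N y <= 1 -> T n y != 0,
      forall y, N y <= 1 -> N (U n y) < N (T n y),
      0 < c n &
      exists lam, [/\ forall y, N y < 1 -> cdiff lam y,
        forall y, N y < 1 -> cexp (lam y) = T n y & Im (lam 0) = 0]].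

Let circ_lt n y : 0 < c n -> N y = 1 -> N (U n y) < N (T n y).
Proof.
move=> cn y1; rewrite -(@ltr_pXn2r _ 2) ?nnegrE ?normc_ge0 // -subr_gt0 circ_id //.
by rewrite mulr_gt0.
Qed.

Let good0 : szego_good 0.
Proof.
have c0 : 0 < c 0 by rewrite /c big_ord0.
have [Td Ud TE UE] := TU 0.
have F1Re y : N y < 1 -> 0 < Re (F y + 1) by move=> y1; rewrite cReD addr_gt0 // FRe.
have T0 y : N y <= 1 -> T 0 y != 0.
  rewrite le_eqVlt => /predU1P[y1|y1].
    by rewrite -normc_gt0; apply: le_lt_trans (circ_lt c0 y1); exact: normc_ge0.
  rewrite TE // t0E // mulf_neq0 ?g0 ?ltW //.
  by apply: contraTneq (F1Re y y1) => ->; rewrite ltxx.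
split=> //.
  by apply: (unimodular_ball Rad1) => // y; exact: circ_lt.
exists (fun y => lam0 y + clog (F y + 1)); split.
- move=> y y1; apply: cdiffD; first exact: lamd.
  apply: (@cdiff_comp _ (fun y => F y + 1)); last exact/cdiff_clog/F1Re.
  by apply: cdiffD; [exact: Fd|exact: cdiff_cst].
- by move=> y y1; rewrite cexpD lamE // cexp_clog ?F1Re // TE // t0E.
have -> : F 0 + 1 = (2 : R)%:C%C by rewrite F1 -(realCD 1 1).
by rewrite cImD lam00 Im_clog_real addr0.
Qed.

Let U_at0 n : U n 0 = a n * T n 0.
Proof. by apply/eqP; rewrite -subr_eq0 -USE mul0r. Qed.

Let a_lt1 n : szego_good n -> N (a n) < 1.
Proof.
move=> [T0 UT _ _]; have := UT 0 (ltW n0).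
by rewrite U_at0 normc_M gtr_pMl // normc_gt0 T0 // ltW.
Qed.

Let goodS n : szego_good n -> szego_good n.+1.
Proof.
move=> G; have an := a_lt1 G; have [T0 UT cn [lam [ld le l0]]] := G.
have [Td Ud TE UE] := TU n.
have [Td' Ud' _ _] := TU n.+1.
have cn1 : 0 < c n.+1.
  by rewrite /c big_ord_recr /= mulr_gt0 // subr_gt0 expr_lt1 // normc_ge0.
have aUT y : N y <= 1 -> N ((a n)^* * (U n y / T n y)) < 1.
  move=> y1; rewrite normc_M normc_conj normc_M normc_V.
  have TT : 0 < N (T n y) by rewrite normc_gt0 T0.
  have q1 : N (U n y) / N (T n y) <= 1 by rewrite ler_pdivrMr // mul1r ltW // UT.
  have q0 : 0 <= N (U n y) / N (T n y) by rewrite divr_ge0 ?normc_ge0.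
  by rewrite (le_lt_trans _ an) // ler_piMr // normc_ge0.
have TF y : N y <= 1 -> T n.+1 y = T n y * (1 - (a n)^* * (U n y / T n y)).
  move=> y1; have Ty := T0 y y1.
  by rewrite /T /= -/(T n) -/(U n); field.
have QRe y : N y <= 1 -> 0 < Re (1 - (a n)^* * (U n y / T n y)).
  by move=> y1; apply: Re_gt0_of_lt1; exact: aUT.
have T0' y : N y <= 1 -> T n.+1 y != 0.
  move=> y1; rewrite TF // mulf_neq0 ?T0 //.
  by apply: contraTneq (QRe y y1) => ->; rewrite ltxx.
split=> //.
  by apply: (unimodular_ball Rad1) => // y; exact: circ_lt.
exists (fun y => lam y + clog (1 - (a n)^* * (U n y / T n y))); split.
- move=> y y1; have yR := lt_trans y1 Rad1.
  apply: cdiffD; first exact: ld.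
  apply: (@cdiff_comp _ (fun y => 1 - (a n)^* * (U n y / T n y))); last exact/cdiff_clog/QRe/ltW.
  apply: cdiffB; first exact: cdiff_cst.
  apply: cdiffM; first exact: cdiff_cst.
  by apply: cdiff_div; [rewrite T0 // ltW|exact: Ud|exact: Td].
- by move=> y y1; rewrite cexpD le // cexp_clog ?QRe 1?ltW // TF // ltW.
have -> : 1 - (a n)^* * (U n 0 / T n 0) = (1 - N (a n) ^+ 2)%:C%C.
  by rewrite U_at0 mulfK ?T0 1?ltW // mulrC mulc_conj realCB.
by rewrite cImD l0 Im_clog_real addr0.
Qed.

Let good n : szego_good n. Proof. by elim: n => [|n /goodS]; [exact: good0|]. Qed.

Lemma verblunsky_lt1 n : N (a n) < 1. Proof. exact/a_lt1/good. Qed.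

Theorem szego_iteration n : let T := (szTU n).1 in let U := (szTU n).2 in
  [/\ forall y, N y < Rad -> cdiff T y /\ cdiff U y,
      forall y, N y < 1 -> T y = g y * t n y /\ U y = g y * u n y,
      forall y, N y <= 1 -> N (U y) < N (T y),
      forall y, N y = 1 -> N (T y) ^+ 2 - N (U y) ^+ 2 = 4 * \prod_(j < n) (1 - N (a j) ^+ 2) &
      exists lam, [/\ forall y, N y < 1 -> cdiff lam y,
        forall y, N y < 1 -> cexp (lam y) = T y & Im (lam 0) = 0]].
Proof.
have [Td Ud TE UE] := TU n; have [T0 UT cn L] := good n.
split=> //; last exact: circ_id.
- by move=> y yR; split; [exact: Td|exact: Ud].
- by move=> y y1; split; [exact: TE|exact: UE].
Qed.

Lemma szTU1 y : y * ((szTU 1).1 y - y * (szTU 1).2 y) =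
  y * ((1 + a 0%N) * (P y + g y)) - (1 + (a 0%N)^*) * (P y - g y).
Proof.
have -> : (szTU 1).1 y = P y + g y - (a 0%N)^* * U 0 y by [].
rewrite -/(U 1) USE -U0E (_ : T 0 y = P y + g y) //.
by move: (U 0 y) ((a 0%N)^*) (P y + g y) => *; ring.
Qed.

End SzegoIteration.

Section PolesAndShift.
Context {R : realType}.
Local Notation C := R[i].
Local Notation TR := (measurableTypeR R).
Let mC := @measurable_circ R.

Lemma ccont_neq0 (h : C -> C) p : ccont h p -> h p != 0 ->
  exists2 e : R, 0 < e & forall y, N (y - p) < e -> h y != 0.
Proof.
move=> hc hp; have h0 : 0 < N (h p) by rewrite normc_gt0.
have /ccontP/(_ _ h0)[d d0 Hd] := hc.
exists d => // y /Hd; apply: contraTneq => ->.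
by rewrite sub0r normc_N ltxx.
Qed.

Lemma quotient_pole (g Q : C -> C) b p : (forall y : C, N y < b -> cdiff g y) ->
  (forall y : C, N y < b -> cdiff Q y) -> g 0 != 0 -> N p < b -> g p = 0 -> Q p != 0 ->
  exists k, zero_order g p k /\ pole_order (fun y => Q y / g y) p k.
Proof.
move=> gd Qd g0 pb gp Qp; have [k [h [hd hp gE]]] := zero_factor gd g0 pb.
have [e1 e10 he] := ccont_neq0 (cdiff_cont (hd p pb)) hp.
pose e := Num.min e1 (b - N p).
have e0 : 0 < e by rewrite lt_min e10 subr_gt0.
have yb y : cball p e y -> N y < b /\ h y != 0.
  rewrite cballE lt_min => /andP[y1 y2]; split; last exact: he.
  by have := normc_lB y p; lra.
exists k; split.
  exists e; split=> //; exists h; split; last by split.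
  by apply/holoP => y /yb[yb' _]; exact: hd.
split.
  by rewrite lt0n; apply: contraNneq hp => k0; have := gE p; rewrite gp k0 expr0 mul1r => <-.
exists e; split=> //; exists (fun y => Q y / h y); split.
  by apply/holoP => y /yb[y1 y2]; apply: cdiff_div => //; [exact: Qd|exact: hd].
split; first by rewrite mulf_neq0 // invr_eq0.
move=> y /yb[y1 y2] yp; rewrite gE; have yp' : y - p != 0 by rewrite subr_eq0.
by field; rewrite y2 expf_neq0.
Qed.

Section Shift.
Variables (mu nu : {measure set TR -> \bar R}) (a : nat -> C) (n : nat).
Hypothesis mu1 : circle_prob mu.
Hypothesis nu1 : circle_prob nu.
Hypothesis va : verblunsky mu a.
Hypothesis vn : verblunsky nu (fun k => a (n + k)%N).
Hypothesis a1 : forall k, N (a k) < 1.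

(* The Casoratian [W_k] of the two solutions of the recursion satisfies
   [z W_(k+1) = (1 - |b_k|^2) W_k], so [W_0] vanishes at [0] to infinite order. *)
Lemma geronimus_shift z : N z < 1 ->
  geronimus_u mu a n z * geronimus_t nu (fun k => a (n + k)%N) 0 z =
  geronimus_u nu (fun k => a (n + k)%N) 0 z * geronimus_t mu a n z.
Proof.
move=> z1; set b := fun k => a (n + k)%N.
pose W k z := geronimus_u mu a (n + k) z * geronimus_t nu b k z -
  geronimus_u nu b k z * geronimus_t mu a (n + k) z.
have Wd k y : N y < 1 -> cdiff (W k) y.
  move=> y1; apply: cdiffB.
    by apply: cdiffM; [exact: cdiff_geronimus_u|exact: cdiff_geronimus_t].
  by apply: cdiffM; [exact: cdiff_geronimus_u|exact: cdiff_geronimus_t].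
have WS k y : N y < 1 -> y * W k.+1 y = (1 - N (b k) ^+ 2)%:C%C * W k y.
  move=> y1; rewrite /W addnS.
  have u1 := geronimus_uS mu1 va (n + k) y1; have u2 := geronimus_uS nu1 vn k y1.
  have t1 := geronimus_tS a mu1 (n + k) y1; have t2 := geronimus_tS b nu1 k y1.
  rewrite mulrBr !mulrA u1 u2 t1 t2 -/b realCB -mulc_conj -[a (n + k)%N]/(b k).
  move: (geronimus_u _ _ _ _) (geronimus_t _ _ _ _) (geronimus_u _ _ _ _)
    (geronimus_t _ _ _ _) (b k) ((b k)^*) => *; ring.
have d0 k : (1 - N (b k) ^+ 2)%:C%C != 0 :> C.
  by rewrite realC_eq0 gt_eqF // subr_gt0 expr_lt1 ?normc_ge0 // a1.
pose c k : C := \prod_(j < k) (1 - N (b j) ^+ 2)%:C%C.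
have c0 k : c k != 0 by apply/prodf_neq0 => j _; exact: d0.
have WE k y : N y < 1 -> W 0%N y = y ^+ k * ((c k)^-1 * W k y).
  move=> y1; elim: k => [|k IH]; first by rewrite /c big_ord0 invr1 !mul1r.
  rewrite IH; have -> : W k y = ((1 - N (b k) ^+ 2)%:C%C)^-1 * (y * W k.+1 y).
    by rewrite WS // mulKf.
  have -> : (c k.+1)^-1 = (c k)^-1 / (1 - N (b k) ^+ 2)%:C%C.
    by rewrite /c big_ord_recr /= invfM.
  move: ((c k)^-1) (((1 - N (b k) ^+ 2)%:C%C)^-1) (W k.+1 y) => *.
  by rewrite exprS; ring.
have := @flat_zero _ (W 0%N) (fun k y => (c k)^-1 * W k y) 1 (Wd 0%N) _ WE z z1.
rewrite /W addn0 => H; apply/eqP; rewrite -subr_eq0; apply/eqP/H => k y y1.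
by apply: cdiffM; [exact: cdiff_cst|exact: Wd].
Qed.

End Shift.

Lemma schurE (mu : {measure set TR -> \bar R}) (a : nat -> C) z : circle_prob mu ->
  verblunsky mu a -> N z < 1 -> schur mu z = geronimus_u mu a 0 z / geronimus_t mu a 0 z.
Proof.
move=> mu1 va z1; have t0 := geronimus_t0 a mu1; have u0 := geronimus_u0 a mu1.
rewrite /schur; case: eqVneq => [->|zn]; last first.
  rewrite t0 // -u0 //; field.
  by rewrite zn carath_add1_neq0.
have n0 : N (0 : C) < 1 by rewrite normc_0.
rewrite t0 // carath0 //; congr (_ / _).
have := cdiff_derive (cdiff_carath mu1 n0) => -[l -> lc].
rewrite carath0 // in lc.
have uc := cdiff_cont (cdiff_geronimus_u a mu1 0 n0).
have := cont_eq_at0 lc uc; rewrite eqxx; apply=> y y0 y1.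
by rewrite (negPf y0) subr0 -u0 // mulrC mulKf.
Qed.

End PolesAndShift.

Section ShiftedSzego.
Context {R : realType}.
Local Notation C := R[i].
Local Notation TR := (measurableTypeR R).
Let mC := @measurable_circ R.

Lemma weight_of_carath (nu nus : {measure set TR -> \bar R}) (wn : R -> R) (f : C -> C) b :
  circle_prob nu -> lebesgue_decomp nu wn nus -> 1 < b ->
  (forall y : C, N y < b -> cdiff f y) -> (forall y : C, N y < 1 -> f y = carath nu y) ->
  {ae leb, forall t, circ t -> wn t = Re (f (eit t))}.
Proof.
move=> nu1 [wn0 [mwn [[Nn [mNn [NnC [Nn0 nusN]]]] nuE]]] b1 fd fE.
have p2 := @pi2_gt0 R.
have n1 t : N (1%:C%C * eit t : C) = 1 by rewrite normc_circle_pos.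
have fc t : ccont f (1%:C%C * eit t) by apply/cdiff_cont/fd; rewrite n1.
have fi : cintegrable leb (circ : set TR) (fun t => f (eit t)).
  by apply: (@cintegrable_ext _ leb _ mC) (cintegrable_circle fc) => t _; rewrite mul1r.
pose h t := (pi *+ 2)^-1 * Re (f (eit t)).
have hi : leb.-integrable (circ : set TR) (EFin \o h).
  by have [ri _] := fi; exact: (eq_integrable mC _ _ _ (integrableZl mC (pi *+ 2)^-1 ri)).
have oi : nu.-integrable (circ : set TR) (EFin \o (fun=> 1 : R)).
  by have [] := cintegrable_cst nu1 1.
have keq z : N z < 1 ->
    Cint nu (circ : set TR) (fun t => (eit t + z) / (eit t - z) * (1 : R)%:C%C) =
    Cint leb (circ : set TR) (fun t => (eit t + z) / (eit t - z) * (h t)%:C%C).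
  move=> z1; have n0 : N (0 : C) < 1 by rewrite normc_0.
  transitivity (carath nu z); first by apply: Cint_ext => t _; rewrite mulr1.
  transitivity (Cint leb (circ : set TR) (fun t => twopi^-1 *
      ((eit t + z) / (eit t - z) * (Re (f (eit t)))%:C%C))); last first.
    apply: Cint_ext => t _; rewrite /h realCM realCV -/twopi.
    by rewrite mulrCA.
  rewrite CintZ //; last first.
    apply: (@cintegrable_mulb _ leb _ mC _ _ (2 / (1 - N z))).
    - by apply: cintegrable_real; case: fi.
    - exact: cmeas_szego_kernel.
    - by move=> t _; exact: kernel_norm.
  rewrite (schwarz_formula z1 b1 fd) (fE 0) // carath0 // mulr0 subr0 fE //.
  by rewrite mulrC mulfK // twopi_neq0.
have KU A := @kernel_unique _ nu leb (fun=> 1) h oi hi keq A.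
pose D := circ `\` Nn : set TR.
have mD : measurable D by exact: measurableD.
have DC : D `<=` circ by move=> t [].
have wi : measurable_fun D (EFin \o (fun t => wn t / (pi *+ 2))).
  apply/measurable_EFinP; apply: (@measurable_funS _ _ _ _ (circ : set TR)) => //.
  exact: measurable_funM.
have := @integral_ae_eq _ _ _ leb _ mD (EFin \o (fun t => wn t / (pi *+ 2))) (EFin \o h)
   (integrableS mC mD DC hi) wi.
move=> /(_ _)/wrap[E ED mE|AE].
  have EC : circ `&` E = E by rewrite setIC; apply/setIidPl; exact: subset_trans DC.
  have := KU E mE; rewrite EC => <-.
  rewrite integral_cst // mul1e nuE //.
  have -> : nus E = 0%E.
    apply/eqP; rewrite eq_le measure_ge0 andbT -nusN le_measure ?inE //.
      exact: measurableC.
    by move=> t /ED[].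
  by rewrite adde0 setIidl //; exact: subset_trans DC.
have AN : {ae leb, forall t, ~ Nn t}.
  by exists Nn; split=> // t /= /contrapT.
apply: (ae_imply _ (ae_and AE AN)) => t [H1 H2] ct.
have p0 : (pi *+ 2)^-1 != 0 :> R by rewrite invr_eq0 gt_eqF.
by have [H] := H1 (conj ct H2); apply: (mulIf p0); rewrite -H /h mulrC.
Qed.

Section Shifted.
Variables (mu : {measure set TR -> \bar R}) (w : R -> R) (Rad : R) (g P : C -> C) (a : nat -> C).
Hypothesis mu1 : circle_prob mu.
Hypothesis dec : lebesgue_decomp mu w mzero.
Hypothesis sz : szego_cond w.
Hypothesis Rad1 : 1 < Rad.
Hypothesis gd : forall y, N y < Rad -> cdiff g y.
Hypothesis gE : forall y, N y < 1 -> g y = (szego w y)^-1.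
Hypothesis Pd : forall y, N y < Rad -> cdiff P y.
Hypothesis PE : forall y, N y < 1 -> P y = g y * carath mu y.
Hypothesis Pcirc : forall y, N y = 1 -> P y * (g y)^* + (P y * (g y)^*)^* = 2.
Hypothesis va : verblunsky mu a.

Let g0 y : N y <= 1 -> g y != 0.
Proof. exact: (szego_inv_neq0 mu1 dec sz Rad1 gd gE). Qed.

Let lamd y : N y < 1 -> cdiff (fun y => - szego_log w y) y.
Proof. by move=> y1; apply: cdiffN; apply: cdiff_szego_log => //; exact: ln_weight_integrable mu1 dec sz. Qed.

Let lamE y : N y < 1 -> cexp (- szego_log w y) = g y.
Proof. by move=> y1; rewrite cexpN -szegoE gE. Qed.

Let lam00 : Im (- szego_log w 0) = 0.
Proof. by rewrite cImN Im_szego_log0 ?oppr0 //; exact: ln_weight_integrable mu1 dec sz. Qed.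

Let TU := szego_iteration Rad1 gd Pd g0 Pcirc PE (carath0 mu1) (carath_Re_gt0 mu1)
  (cdiff_carath mu1) lamd lamE lam00 (cdiff_geronimus_u a mu1) (geronimus_t0 a mu1)
  (geronimus_u0 a mu1) (geronimus_tS a mu1) (geronimus_uS mu1 va).

Lemma verblunsky_norm_lt1 k : N (a k) < 1.
Proof.
exact: (verblunsky_lt1 Rad1 gd Pd g0 Pcirc PE (carath0 mu1) (carath_Re_gt0 mu1)
  (cdiff_carath mu1) lamd lamE lam00 (cdiff_geronimus_u a mu1) (geronimus_t0 a mu1)
  (geronimus_u0 a mu1) (geronimus_tS a mu1) (geronimus_uS mu1 va)).
Qed.

(* This is [2 rho_0 ... rho_(n-1) / D^(n)], see [szego_shifted]. *)
Definition szego_denominator n y := (szTU g P a n).1 y - y * (szTU g P a n).2 y.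

Lemma cdiff_szego_denominator n y : N y < Rad -> cdiff (szego_denominator n) y.
Proof.
move=> yR; have [/(_ y yR)[Td Ud] _ _ _ _] := TU n.
by apply: cdiffB => //; apply: cdiffM => //; exact: cdiff_id.
Qed.

Lemma szego_denominatorE n y : N y < 1 ->
  szego_denominator n y = g y * (geronimus_t mu a n y - y * geronimus_u mu a n y).
Proof.
move=> y1; have [_ /(_ y y1)[TE UE] _ _ _] := TU n.
by rewrite /szego_denominator TE UE; ring.
Qed.

Lemma szego_denominator1 y : y * szego_denominator 1 y =
  y * ((1 + a 0%N) * (P y + g y)) - (1 + (a 0%N)^*) * (P y - g y).
Proof.
exact: (szTU1 Rad1 gd Pd PE (cdiff_geronimus_u a mu1) (geronimus_t0 a mu1)
  (geronimus_u0 a mu1) (geronimus_tS a mu1) (geronimus_uS mu1 va)).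
Qed.

Variables (n : nat) (nu nus : {measure set TR -> \bar R}) (wn : R -> R).
Hypothesis nu1 : circle_prob nu.
Hypothesis decn : lebesgue_decomp nu wn nus.
Hypothesis vn : verblunsky nu (fun k => a (n + k)%N).

Let T := (szTU g P a n).1.
Let U := (szTU g P a n).2.
Let G := szego_denominator n.
Let S y := T y + y * U y.
Let c := \prod_(j < n) (1 - N (a j) ^+ 2).

Let c0 : 0 < c.
Proof. by apply: prodr_gt0 => j _; rewrite subr_gt0 expr_lt1 ?normc_ge0 // verblunsky_norm_lt1. Qed.

Let yU_lt y : N y <= 1 -> N (y * U y) < N (T y).
Proof.
move=> y1; have [_ _ UT _ _] := TU n; apply: le_lt_trans (UT y y1).
by rewrite normc_M ler_piMl // normc_ge0.
Qed.

Let G0 y : N y <= 1 -> G y != 0.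
Proof.
move=> y1; rewrite -normc_gt0.
by have := normc_lB (T y) (y * U y); have := yU_lt y1; rewrite /G /szego_denominator -/T -/U; lra.
Qed.

Let carath_nu y : N y < 1 -> S y / G y = carath nu y.
Proof.
move=> y1; have [_ /(_ y y1)[TE UE] _ _ _] := TU n.
apply: (mulIf (G0 (ltW y1))); rewrite divfK ?G0 1?ltW //.
have H := geronimus_shift mu1 nu1 va vn verblunsky_norm_lt1 y1.
have t0 := geronimus_t0 (fun k => a (n + k)%N) nu1 y1.
have u0 := geronimus_u0 (fun k => a (n + k)%N) nu1 y1.
have {}H : y * U y * (carath nu y + 1) = (carath nu y - 1) * T y.
  by rewrite -t0 -u0 /T /U TE UE; move: H;
    move: (geronimus_t nu _ _ _) (geronimus_u nu _ _ _) => t' u' H; ring: H.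
rewrite /S /G /szego_denominator -/T -/U.
move: (y * U y) H => V H; apply/eqP; rewrite -subr_eq0; apply/eqP.
by transitivity (V * (carath nu y + 1) - (carath nu y - 1) * T y); [ring|rewrite H subrr].
Qed.

Let Re_circle y : N y = 1 -> Re (S y / G y) = 4 * c / N (G y) ^+ 2.
Proof.
move=> y1; have [_ _ _ /(_ y y1) E _] := TU n.
have NU : N (y * U y) = N (U y) by rewrite normc_M y1 mul1r.
rewrite cReM cReV cImV /S /G /szego_denominator -/T -/U.
have EV : N (T y) ^+ 2 - N (y * U y) ^+ 2 = 4 * c by rewrite NU.
rewrite -EV; move: (y * U y) => V; rewrite !normc_sqr !cReB !cImB !cReD !cImD.
rewrite mulrA mulrA -mulrBl; congr (_ / _).
by move: (Re (T y)) (Im (T y)) (Re V) (Im V) => *; ring.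
Qed.

Theorem szego_shifted y : N y < 1 ->
  szego_denominator n y / (2 * Num.sqrt c)%:C%C = (szego wn y)^-1.
Proof.
move=> y1; pose s := 2 * Num.sqrt c.
have s0 : 0 < s by rewrite mulr_gt0 // sqrtr_gt0.
have s2 : s ^+ 2 = 4 * c by rewrite exprMn sqr_sqrtr ?ltW // -natrX.
have sC : s%:C%C != 0 :> C by rewrite realC_eq0 gt_eqF.
have Gd z : N z < Rad -> cdiff G z by exact: cdiff_szego_denominator.
have [b [b1 bR Gb]] := zero_free_larger Rad1 (fun z zR => cdiff_cont (Gd z zR)) G0.
have [Hd _ _ _ [lam [ld le l0]]] := TU n.
have fd z : N z < b -> cdiff (fun z => S z / G z) z.
  move=> zb; have zR := lt_le_trans zb bR; have [Td Ud] := Hd z zR.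
  apply: cdiff_div; [exact: Gb| |exact: Gd].
  by apply: cdiffD => //; apply: cdiffM => //; exact: cdiff_id.
have W := weight_of_carath nu1 decn b1 fd carath_nu.
have T0 z : N z <= 1 -> T z != 0.
  by move=> z1; rewrite -normc_gt0; apply: le_lt_trans (yU_lt z1); exact: normc_ge0.
pose q z := 1 - z * U z / T z.
have qRe z : N z <= 1 -> 0 < Re (q z).
  move=> z1; apply: Re_gt0_of_lt1; rewrite normc_M normc_V ltr_pdivrMr ?normc_gt0 ?T0 //.
  by rewrite [ltRHS]mul1r yU_lt.
pose lam' z := lam z + clog (q z) - (ln s)%:C%C.
have GT z : N z <= 1 -> G z = T z * q z.
  by move=> z1; have Tz := T0 z z1; rewrite /G /szego_denominator -/T -/U /q; field.
apply/esym; rewrite (@szego_of_modulus _ (fun z => G z / s%:C%C) lam' Rad) ?invrK //.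
- move=> z zR; apply: ccontM; last exact: ccont_cst.
  exact/cdiff_cont/Gd.
- by move=> z z1; rewrite mulf_neq0 ?G0 // invr_eq0.
- move=> z z1; have [Td Ud] := Hd z (lt_trans z1 Rad1).
  apply: cdiffB; last exact: cdiff_cst.
  apply: cdiffD; first exact: ld.
  apply: (@cdiff_comp _ q); last exact/cdiff_clog/qRe/ltW.
  apply: cdiffB; first exact: cdiff_cst.
  apply: cdiff_div => //; first exact/T0/ltW.
  by apply: cdiffM => //; exact: cdiff_id.
- move=> z z1; rewrite !cexpD cexpN le // cexp_clog ?qRe 1?ltW // -/T -GT 1?ltW //.
  by rewrite cexp_real lnK.
- have q00 : q 0 = (1 : R)%:C%C by rewrite /q !mul0r subr0.
  by rewrite cImB cImD l0 q00 Im_clog_real Imreal addr0 subr0.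
- by case: decn => _ [].
apply: ae_imply W => t H ct; rewrite H // Re_circle ?normc_eit //.
rewrite normc_M normc_V normc_real gtr0_norm // -s2.
by rewrite expr_div_n invf_div.
Qed.

End Shifted.

End ShiftedSzego.

Section RelativeSzego.
Context {R : realType}.
Local Notation C := R[i].
Local Notation TR := (measurableTypeR R).

Lemma rho_neq0 (x : C) : N x < 1 -> rho x != 0.
Proof.
move=> x1; rewrite sqrtC_eq0 cnormE -realCX -(realCB 1) realC_eq0 gt_eqF // subr_gt0.
by rewrite expr_lt1 ?normc_ge0.
Qed.

Lemma rel_szegoE (mu nu : {measure set TR -> \bar R}) (a : nat -> C) z :
  circle_prob mu -> circle_prob nu -> verblunsky mu a -> verblunsky nu (fun k => a k.+1) ->
  (forall k, N (a k) < 1) -> N z < 1 ->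
  rel_szego mu nu (a 0%N) z =
  (geronimus_t mu a 1 z - z * geronimus_u mu a 1 z) / (2 * rho (a 0%N)).
Proof.
move=> mu1 nu1 va vn a1 z1.
have t0 := geronimus_t0 a mu1 z1; have u0 := geronimus_u0 a mu1 z1.
have s0 := geronimus_t0 (fun k => a k.+1) nu1 z1.
have v0 := geronimus_u0 (fun k => a k.+1) nu1 z1.
have t1 := geronimus_tS a mu1 0 z1; have u1 := geronimus_uS mu1 va 0 z1.
have sh := geronimus_shift (n := 1) mu1 nu1 va vn a1 z1.
have t0n := carath_add1_neq0 mu1 z1; have s0n := carath_add1_neq0 nu1 z1; rewrite -t0 in t0n; rewrite -s0 in s0n.
rewrite /rel_szego (schurE mu1 va z1) (schurE nu1 vn z1).
have rn := rho_neq0 (a1 0%N).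
have d2 : geronimus_t mu a 0 z - z * geronimus_u mu a 0 z = 2.
  by rewrite u0 t0; ring.
have d2n : geronimus_t mu a 0 z - z * geronimus_u mu a 0 z != 0 by rewrite d2 pnatr_eq0.
move: sh; rewrite -/(fun k => a k.+1) -d2 t1.
set T0 := geronimus_t mu a 0 z in t0n d2n *; set U0 := geronimus_u mu a 0 z in d2n *.
set U1 := geronimus_u mu a 1 z; set S0 := geronimus_t nu _ 0 z in s0n *.
set V0 := geronimus_u nu _ 0 z => sh.
clear -sh t0n s0n d2n rn; move: (rho _) ((a 0%N)^*) rn T0 U0 t0n d2n U1 S0 V0 s0n sh.
move=> r ac rn T0 U0 t0n d2n U1 S0 V0 s0n sh.
have -> : 1 - z * (V0 / S0) = (S0 - z * V0) / S0 by field.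
have -> : 1 - z * (U0 / T0) = (T0 - z * U0) / T0 by field.
have -> : 1 - ac * (U0 / T0) = (T0 - ac * U0) / T0 by field.
apply/eqP; rewrite -subr_eq0; apply/eqP.
transitivity (z * (U1 * S0 - V0 * (T0 - ac * U0)) / (S0 * r * (T0 - z * U0))).
  by field; rewrite s0n rn t0n d2n.
by rewrite sh subrr mulr0 mul0r.
Qed.

End RelativeSzego.

Theorem theorem2p5 (R : realType) (mu : {measure set (measurableTypeR R) -> \bar R})
    (w : R -> R) (Rad : R) :
  circle_prob mu -> lebesgue_decomp mu w mzero -> szego_cond w -> 1 < Rad ->
  forall g : R[i] -> R[i],
    holo (cball 0 Rad) g -> (forall z, cball 0 1 z -> g z = (szego w z)^-1) ->
  let Z := [set z | cball 0 Rad z /\ g z = 0] in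
  (* F is meromorphic in |z| < Rad, poles exactly at the zeros of g = D^{-1},
     pole order = zero order *)
  (exists G : R[i] -> R[i],
     (forall z, cball 0 1 z -> G z = carath mu z) /\
     holo (cball 0 Rad `\` Z) G /\
     forall p, Z p -> exists k : nat, zero_order g p k /\ pole_order G p k) /\
  (forall alpha : nat -> R[i], verblunsky mu alpha ->
     (* mu1 = mu^(1), with Lebesgue decomposition w1 dtheta/2pi + mus1 *)
     forall (mu1 : {measure set (measurableTypeR R) -> \bar R}) (w1 : R -> R)
            (mus1 : {measure set (measurableTypeR R) -> \bar R}),
       circle_prob mu1 -> lebesgue_decomp mu1 w1 mus1 ->
       verblunsky mu1 (fun k => alpha k.+1) ->
       (* delta_0 D is meromorphic in |z| < Rad, poles exactly at the poles
          of F, of order at most the order of the pole of F *)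
       (exists H : R[i] -> R[i],
          (forall z, cball 0 1 z -> H z = rel_szego mu mu1 (alpha 0%N) z) /\
          holo (cball 0 Rad `\` Z) H /\
          forall p, Z p -> exists k k' : nat,
              zero_order g p k /\ pole_order H p k' /\ (k' <= k)%N) /\
       (* (D^(1))^{-1} is analytic in |z| < Rad *)
       analytic_cont (fun z => (szego w1 z)^-1) Rad) /\
  (* and so is (D^(n))^{-1} for every n >= 1 *)
  (forall alpha : nat -> R[i], verblunsky mu alpha ->
     forall n : nat, (1 <= n)%N ->
     forall (nu : {measure set (measurableTypeR R) -> \bar R}) (wn : R -> R)
            (nus : {measure set (measurableTypeR R) -> \bar R}),
       circle_prob nu -> lebesgue_decomp nu wn nus ->
       verblunsky nu (fun k => alpha (n + k)%N) ->
       analytic_cont (fun z => (szego wn z)^-1) Rad).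
Proof.
move=> mu1 dec sz Rad1 g gh gE' Z.
have gd y : N y < Rad -> cdiff g y by move=> yR; have /holoP := gh; apply; rewrite cball0E.
have gE y : N y < 1 -> g y = (szego w y)^-1 by move=> y1; apply: gE'; rewrite cball0E.
have g0 y : N y <= 1 -> g y != 0 by exact: (szego_inv_neq0 mu1 dec sz Rad1 gd gE).
have g00 : g 0 != 0 by rewrite g0 // normc_0.
have [P [Pd PE P0 Pcirc]] := carath_numerator mu1 dec sz Rad1 gd gE.
have off_Z Q : (forall y, N y < Rad -> cdiff Q y) -> holo (cball 0 Rad `\` Z) (fun y => Q y / g y).
  move=> Qd; apply/holoP => y [yb yZ]; have yR : N y < Rad by move: yb; rewrite cball0E.
  apply: cdiff_div; [|exact: Qd|exact: gd].
  by apply/eqP => gy; apply: yZ.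
have ZE p : Z p -> [/\ N p < Rad, g p = 0 & 1 < N p].
  move=> [pb gp]; split=> //; first by move: pb; rewrite cball0E.
  by rewrite ltNge; apply/negP => /g0; rewrite gp eqxx.
have cont alpha : verblunsky mu alpha -> forall n (nu nus : {measure set (measurableTypeR R) -> \bar R}) wn,
    circle_prob nu -> lebesgue_decomp nu wn nus -> verblunsky nu (fun k => alpha (n + k)%N) ->
    analytic_cont (fun z => (szego wn z)^-1) Rad.
  move=> va n nu nus wn nu1 decn vn.
  exists (fun y => szego_denominator g P alpha n y / (2 * Num.sqrt (\prod_(j < n) (1 - N (alpha j) ^+ 2)))%:C%C).
  split.
    apply/holoP => y; rewrite cball0E => yR; apply: cdiffM; last exact: cdiff_cst.
    exact: (cdiff_szego_denominator mu1 dec sz Rad1 gd gE Pd PE Pcirc va).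
  move=> z; rewrite cball0E => z1.
  exact: (szego_shifted mu1 dec sz Rad1 gd gE Pd PE Pcirc va nu1 decn vn).
split; last split; last by move=> alpha va n _ nu wn nus nu1 decn vn; exact: (cont alpha va n nu nus wn).
- exists (fun y => P y / g y); split; last split.
  + move=> z; rewrite cball0E => z1; rewrite PE // mulrAC divff ?mul1r //.
    by rewrite g0 // ltW.
  + exact: off_Z.
  move=> p /ZE[pR gp p1].
  by apply: (quotient_pole gd Pd g00 pR gp); exact: P0.
move=> alpha va nu w1 nus nu1 decn vn; split; last exact: (cont alpha va 1 nu nus w1).
have a1 := verblunsky_norm_lt1 mu1 dec sz Rad1 gd gE Pd PE Pcirc va.
have rn := rho_neq0 (a1 0%N).
pose Q y := szego_denominator g P alpha 1 y / (2 * rho (alpha 0%N)).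
have Qd y : N y < Rad -> cdiff Q y.
  move=> yR; apply: cdiffM; last exact: cdiff_cst.
  exact: (cdiff_szego_denominator mu1 dec sz Rad1 gd gE Pd PE Pcirc va).
exists (fun y => Q y / g y); split; last split.
- move=> z; rewrite cball0E => z1; rewrite (rel_szegoE mu1 nu1 va vn a1 z1) /Q.
  rewrite (szego_denominatorE mu1 dec sz Rad1 gd gE Pd PE Pcirc va) //.
  have := g0 z (ltW z1); move: (g z) (_ - _) => gz b gz0.
  by field; rewrite gz0 rn.
- exact: off_Z.
move=> p /ZE[pR gp p1].
have p0 : p != 0 by rewrite -normc_gt0 (lt_trans _ p1).
have Qp : Q p != 0.
  rewrite /Q mulf_neq0 ?invr_eq0 ?mulf_neq0 ?pnatr_eq0 //.
  have := szego_denominator1 mu1 Rad1 gd Pd PE va p.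
  rewrite gp addr0 subr0 => E; apply: contraTneq (P0 p pR gp) => D; rewrite negbK.
  move: E; rewrite D mulr0 => /esym.
  have -> : p * ((1 + alpha 0%N) * P p) - (1 + (alpha 0%N)^*) * P p =
    (p * (1 + alpha 0%N) - (1 + (alpha 0%N)^*)) * P p by ring.
  move/eqP; rewrite mulf_eq0 => /orP[|//]; rewrite subr_eq0 => /eqP E.
  have {}E := congr1 N E; move: E.
  have -> : 1 + (alpha 0%N)^* = (1 + alpha 0%N)^* by rewrite rmorphD rmorph1.
  rewrite normc_conj normc_M => E.
  have A : 0 < N (1 + alpha 0%N).
    by have := normc_lB 1 (- alpha 0%N); rewrite opprK normc_N normc_1; have := a1 0%N; lra.
  by move: p1; rewrite -(ltr_pM2r A) mul1r E ltxx.
have [k [zk pk]] := quotient_pole gd Qd g00 pR gp Qp.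
by exists k, k.
Qed.
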